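(* Let $n\ge 2$ be an integer and let $p=(0,\dots,0,1)\in\mathbf{S}^n\subset\mathbf{R}^{n+1}$. Let $A\subset\mathbf{S}^n$ be an open set such that for every great circle $C\subset\mathbf{S}^n$ passing through $p$, the intersection $A\cap C$ contains a closed semicircle of $C$. If $n\geq 3$, suppose in addition that at least one of the following holds: (i) for every great circle $C$ through $p$, the set $A\cap C$ contains a closed semicircle of $C$ which contains $p$; or (ii) no great circle through $p$ is contained in $A$. Let $M$ be a closed orientable smooth $(n-1)$-manifold and let $f\colon M\to\mathbf{R}^{n}\times\{0\}\subset\mathbf{R}^{n+1}$ be a smooth ($C^\infty$) immersion. For every $q\in M$ let $C_q:=\mathbf{S}^n\cap df(T_qM)^\perp$ be the unit normal space of $f$ at $q$, where the orthogonal complement is taken in $\mathbf{R}^{n+1}$ (so $C_q$ is a great circle through $p$). Then: (a) There are smooth maps $N_1,N_2\colon M\to\mathbf{S}^n$ such that for every $q\in M$ the vectors $N_1(q),N_2(q)$ form an orthonormal basis of $df(T_qM)^\perp$, and the closed semicircle of $C_q$ centered at $N_1(q)$ lies in $A$. (b) For any pair of smooth maps $N_1,N_2$ as in (a), and for all sufficiently small $\varepsilon,\delta>0$, the map $F\colon M\times\mathbf{S}^1\to\mathbf{R}^{n+1}$, with $\mathbf{S}^1\simeq\mathbf{R}/2\pi\mathbf{Z}$, given by $$F(q,t):=f(q)+\varepsilon\big(\cos(t)\,N_1(q)+\delta\sin(2t)\,N_2(q)\big)$$ is a smooth $A$-directed immersion; that is, $F$ is a smooth immersion and its Gauss map $G_F\colon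 M\times\mathbf{S}^1\to\mathbf{S}^n$ satisfies $G_F(M\times\mathbf{S}^1)\subset A$.
   Context: A great circle of $\mathbf{S}^n$ is the intersection of $\mathbf{S}^n$ with a $2$-dimensional linear subspace of $\mathbf{R}^{n+1}$. A closed semicircle of a great circle $C$ is a closed arc of $C$ of length $\pi$; the closed semicircle of $C$ centered at $x\in C$ is $\{y\in C:\langle x,y\rangle\ge 0\}$. A closed manifold is a compact manifold without boundary. For an immersion $F\colon N^n\to\mathbf{R}^{n+1}$ of an oriented $n$-manifold $N$, the Gauss map $G_F\colon N\to\mathbf{S}^n$ is the continuous unit normal vector field of $F$ determined by the orientation, so $G_F(x)\perp dF(T_xN)$ for all $x$; reversing the orientation replaces $G_F$ by $-G_F$. For $A\subset\mathbf{S}^n$, the immersion $F$ is called $A$-directed if $G_F(N)\subset A$. Orientation convention: the figure eight curve $E_\delta(t)=(\cos t,\delta\sin 2t)$, $t\in\mathbf{R}/2\pi\mathbf{Z}$, is oriented so that its spherical image $G_{E_\delta}(\mathbf{S}^1)\subset\mathbf{S}^1$ is an arc with midpoint $(1,0)$, i.e. $G_{E_\delta}(t)$ is the normalization of $(2\delta\cos 2t,\sin t)$. Correspondingly, $M\times\mathbf{S}^1$ is oriented so that the Gauss map of $F$ satisfies $\langle G_F(q,0),N_1(q)\rangle>0$ for all $q\in M$. ''For all sufficiently small $\varepsilon,\delta>0$'' means: there exist $\varepsilon_0,\delta_0>0$ (depending on $A,f,N_1,N_2$) such that the assertion holds for all $0<\varepsilon<\varepsilon_0$ and $0<\delta<\delta_0$.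 *)

(* Defs.v *)
From HB Require Import structures.
From mathcomp Require Import all_boot all_order all_algebra.
From mathcomp Require Import all_classical all_reals all_analysis.

Set Implicit Arguments.
Unset Strict Implicit.
Unset Printing Implicit Defensive.

Import Order.TTheory GRing.Theory Num.Theory.
Import numFieldNormedType.Exports.
Local Open Scope classical_set_scope.
Local Open Scope ring_scope.

Section Smoothness.
Context {R : realType} {V W : normedModType R}.

(* Meaningful for open [U]: the values of [g] off [U] are irrelevant. *)
Fixpoint Ck_on (k : nat) (U : set V) (g : V -> W) : Prop :=
  match k with
  | 0%N => forall x, U x -> {for x, continuous g}
  | k'.+1 => (forall x, U x -> differentiable g x) /\
             (forall v : V, Ck_on k' U ('D_v g))
  end.

Definition smooth_on (U : set V) (g : V -> W) : Prop := forall k, Ck_on k U g.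

End Smoothness.

Section Manifolds.
Context {R : realType}.

(* [chart_inv] matters only on the image of [chart_map]; being total, it forces
   the carrier to be inhabited, so the empty manifold has the empty atlas. *)
Record chart (M : topologicalType) (d : nat) := Chart {
  chart_dom : set M;
  chart_map : M -> 'rV[R]_d;
  chart_inv : 'rV[R]_d -> M }.

Definition is_chart M d (c : chart M d) : Prop :=
  [/\ open (chart_dom c),
      open (chart_map c @` chart_dom c),
      forall x, chart_dom c x -> chart_inv c (chart_map c x) = x,
      forall x, chart_dom c x -> {for x, continuous (chart_map c)} &
      forall v, (chart_map c @` chart_dom c) v ->
        {for v, continuous (chart_inv c)}].

Definition transition M d (c c' : chart M d) : 'rV[R]_d -> 'rV[R]_d :=
  chart_map c' \o chart_inv c.

Definition covering M d (At : set (chart M d)) : Prop :=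
  forall x, exists2 c, At c & chart_dom c x.

Definition smooth_atlas M d (At : set (chart M d)) : Prop :=
  [/\ forall c, At c -> is_chart c,
      covering At &
      forall c c', At c -> At c' ->
        smooth_on (chart_map c @` (chart_dom c `&` chart_dom c'))
                  (transition c c')].

(* An orientation is given by an oriented atlas [O] of the smooth structure
   determined by [At]; the charts of [O] need not belong to [At]. *)
Definition orientation M d (At O : set (chart M d)) : Prop :=
  [/\ smooth_atlas (At `|` O),
      covering O &
      forall c c' x, O c -> O c' -> chart_dom c x -> chart_dom c' x ->
        0 < \det ('J (transition c c') (chart_map c x))].

Definition orientable M d (At : set (chart M d)) : Prop :=
  exists O, orientation At O.

Definition closed_manifold (M : topologicalType) d (At : set (chart M d)) :
    Prop :=
  [/\ smooth_atlas At, hausdorff_space M & compact [set: M]].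

Definition smooth_map M d (At : set (chart M d)) k (F : M -> 'rV[R]_k) : Prop :=
  forall c, At c -> smooth_on (chart_map c @` chart_dom c) (F \o chart_inv c).

Definition chart_diff M d (c : chart M d) k (F : M -> 'rV[R]_k) (x : M) :
    'rV[R]_d -> 'rV[R]_k :=
  'd (F \o chart_inv c) (chart_map c x).

Definition smooth_immersion M d (At : set (chart M d)) k (F : M -> 'rV[R]_k) :
    Prop :=
  smooth_map At F /\
  forall c x, At c -> chart_dom c x -> injective (chart_diff c F x).

(* dF(T_x M); any single chart at [x] already gives the whole subspace. *)
Definition tangent_image M d (At : set (chart M d)) k (F : M -> 'rV[R]_k)
    (x : M) : set 'rV[R]_k :=
  [set w | exists c, [/\ At c, chart_dom c x & range (chart_diff c F x) w]].

Definition prod_chart M d M' d' (c : chart M d) (c' : chart M' d') :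
    chart (M * M')%type (d + d') :=
  Chart (chart_dom c `*` chart_dom c')
        (fun x => row_mx (chart_map c x.1) (chart_map c' x.2))
        (fun v => (chart_inv c (lsubmx v), chart_inv c' (rsubmx v))).

Definition prod_atlas M d M' d' (At : set (chart M d)) (At' : set (chart M' d'))
    : set (chart (M * M')%type (d + d')) :=
  [set e | exists c c', [/\ At c, At' c' & e = prod_chart c c']].

End Manifolds.
Arguments chart R M d : clear implicits.

Section Circle.
Variable R : realType.
Local Open Scope quotient_scope.

Definition eq_mod2pi (s t : R) : bool := (s - t) / (pi *+ 2) \is a Num.int.

Lemma eq_mod2pi_equiv : equiv_class_of eq_mod2pi.
Proof.
split=> [s|s t|t s u]; rewrite /eq_mod2pi.
- by rewrite subrr mul0r rpred0.
- by rewrite -opprB mulNr rpredN.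
- move=> st tu; rewrite -(subrKA t) mulrDl; exact: rpredD.
Qed.

Canonical eq_mod2pi_rel := EquivRelPack eq_mod2pi_equiv.

Definition circle : Type := quotient_topology {eq_quot eq_mod2pi_rel}.

Definition angle (t : R) : circle := \pi_circle t.

(* The function on R/2piZ induced by a 2pi-periodic [h] (see [circle_funE]). *)
Definition circle_fun (h : R -> R) (x : circle) : R := h (repr x).

Lemma angle_eqP s t : angle s = angle t <-> exists k : int, s = t + pi *+ 2 *~ k.
Proof.
have p0 : (pi *+ 2 : R) != 0 by rewrite mulrn_eq0 /= gt_eqF// pi_gt0.
split=> [/eqmodP/= /intrP [k stk]|[k ->]].
- by exists k; apply/eqP; rewrite addrC -subr_eq -mulrzl -stk mulfVK.
- apply/eqmodP => /=; rewrite /eq_mod2pi addrC addKr -mulrzl mulfK//.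
Qed.

Lemma periodicz (h : R -> R) (k : int) : periodic h (pi *+ 2) ->
  forall t, h (t + pi *+ 2 *~ k) = h t.
Proof.
move=> hper t; case: k => k; first by rewrite -pmulrn (periodicn hper).
rewrite NegzE mulrNz -[in RHS](subrK (pi *+ 2 *+ k.+1) t).
by rewrite (periodicn hper).
Qed.

Lemma circle_funE (h : R -> R) : periodic h (pi *+ 2) ->
  forall t, circle_fun h (angle t) = h t.
Proof.
move=> hper t; rewrite /circle_fun.
have /angle_eqP [k ->] : angle (repr (angle t)) = angle t.
  by rewrite /angle reprK.
exact: periodicz.
Qed.

(* The inverse of [angle] on the arc of angles in ]a, a + 2pi[. *)
Definition circle_chart (a : R) : chart R circle 1 :=
  Chart (angle @` `]a, a + pi *+ 2[)
        (fun x => const_mx (get [set t | a < t < a + pi *+ 2 /\ angle t = x]))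
        (fun v => angle (v 0 0)).

Definition circle_atlas : set (chart R circle 1) := range circle_chart.

End Circle.
Arguments circle_atlas R : clear implicits.

Section Sphere.
Context {R : realType}.

Definition dotv k (u v : 'rV[R]_k) : R := \sum_(i < k) u 0 i * v 0 i.

Definition sphere {n} : set 'rV[R]_n.+1 := [set x | dotv x x = 1].

Definition north_pole n : 'rV[R]_n.+1 := delta_mx 0 ord_max.

Definition open_in_sphere n (A : set 'rV[R]_n.+1) : Prop :=
  exists2 U, open U & A = U `&` sphere.

Definition great_circle n (C : set 'rV[R]_n.+1) : Prop :=
  exists2 P : {vspace 'rV[R]_n.+1}, \dim P = 2 &
    C = sphere `&` [set x | x \in P].

Definition semicircle n (C : set 'rV[R]_n.+1) (x : 'rV[R]_n.+1) :
    set 'rV[R]_n.+1 :=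
  [set y | C y /\ 0 <= dotv x y].

End Sphere.

Section Hypersurfaces.
Context {R : realType}.

Definition normal_space (M : topologicalType) d (At : set (chart R M d)) k
    (F : M -> 'rV[R]_k) (x : M) : set 'rV[R]_k :=
  [set y | forall w, tangent_image At F x w -> dotv y w = 0].

(* [G] is the unit normal of the immersion [F] of [(M, O)] such that
   (dF(e_1), ..., dF(e_d), G) is a positive basis for positive (e_1, ..., e_d).
   [conform_mx] is only a cast: it is the identity when [d + 1 = k], and the
   condition is false in any other dimension. *)
Definition gauss_map (M : topologicalType) d (At O : set (chart R M d)) k
    (F G : M -> 'rV[R]_k) : Prop :=
  [/\ continuous G,
      forall x, dotv (G x) (G x) = 1,
      forall x, normal_space At F x (G x) &
      forall c x, O c -> chart_dom c x ->
        0 < \det (conform_mx (0 : 'M[R]_k)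
                    (col_mx ('J (F \o chart_inv c) (chart_map c x)) (G x)))].

(* The great circle C_q of the text is [sphere `&` normal_space At f q]. *)
Definition adapted_frame n (A : set 'rV[R]_n.+1) (M : topologicalType) d
    (At : set (chart R M d)) (f N1 N2 : M -> 'rV[R]_n.+1) : Prop :=
  [/\ smooth_map At N1 /\ smooth_map At N2,
      forall q, [/\ sphere (N1 q), sphere (N2 q) & dotv (N1 q) (N2 q) = 0],
      forall q, normal_space At f q =
        [set y | exists a b, y = a *: N1 q + b *: N2 q] &
      forall q, semicircle (sphere `&` normal_space At f q) (N1 q) `<=` A].

Definition figure_eight_tube n (M : topologicalType)
    (f N1 N2 : M -> 'rV[R]_n.+1) (eps delta : R) (x : M * circle R) :
    'rV[R]_n.+1 :=
  f x.1 + eps *: (circle_fun cos x.2 *: N1 x.1 +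
                  (delta * circle_fun (fun t => sin (2 * t)) x.2) *: N2 x.1).

Lemma figure_eight_tubeE n (M : topologicalType) (f N1 N2 : M -> 'rV[R]_n.+1)
    (eps delta : R) q t :
  figure_eight_tube f N1 N2 eps delta (q, angle t) =
  f q + eps *: (cos t *: N1 q + (delta * sin (2 * t)) *: N2 q).
Proof.
rewrite /figure_eight_tube /= !circle_funE//; last exact: cosD2pi.
move=> s; rewrite mulrDr [2 * (pi *+ 2)]mulr_natl [X in sin (_ + X)]mulr2n.
by rewrite addrA !sinD2pi.
Qed.

End Hypersurfaces.

(* Main.v *)
(* (a) Orientability gives a smooth unit normal [nu] of [f] in the horizontal
   hyperplane, and C_q is spanned by [nu q] and the pole p.  It thus suffices to
   find smooth functions [a], [b] on the horizontal unit sphere such that the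
   semicircle of the circle through u and p centered at [a u + b p] (normalized)
   lies in A.  The set of admissible (a, b) is open in (u, a, b) and stable under
   positive combinations, since a vector that makes an acute angle with a sum
   makes one with a summand; hence local constant choices can be glued by bump
   functions.  The glued (a, b) can only vanish where the whole circle lies in A.
   Under (i) the choices can be made with b > 0, under (ii) no circle lies in A,
   and for n = 2 the pair (a, b) is a Lipschitz closed curve in the plane, so
   that subtracting a small vector outside of its image makes it nonvanishing.

   (b) Let w be a unit normal of F at (q, t), and h its component in df(T_qM).
   As dF/dt is a multiple of T = - sin t N1 + 2 delta cos 2t N2, the component of
   w in span (N1, N2) is a multiple c of 2 delta cos 2t N1 + sin t N2, while
   |h|^2 <= 4 C eps^2 with C uniform, by compactness of M.  So c does not vanish;
   it is positive at t = 0, hence everywhere, and w is close to the semicircle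
   centered at N1 q when eps and delta are small.  The same estimate shows that
   F is an immersion, and the sign of c singles out a continuous unit normal,
   which in turn determines the orientation of M x S^1. *)

Require Import Defs.
From HB Require Import structures.
From mathcomp Require Import all_boot all_order all_algebra.
From mathcomp Require Import all_classical all_reals all_analysis.
From mathcomp Require Import finmap ring lra zify.

Set Implicit Arguments.
Unset Strict Implicit.
Unset Printing Implicit Defensive.

Import Order.TTheory GRing.Theory Num.Theory.
Import numFieldNormedType.Exports.
Local Open Scope classical_set_scope.
Local Open Scope ring_scope.

(** * Smooth functions between normed spaces *)

(** A semicircle is encoded by the linear inequality [0 <= c * a + s * b], so that centers can be
    added before they are normalized, and (0, 0) is a legitimate value: it says that the whole
    circle is admissible. This is what makes the perturbation for n = 2 harmless, since openness at
    (0, 0) allows any small vector instead. In (b), the spherical image of the figure eight is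
    slightly longer than a semicircle. The coordinate of a unit normal along N1 is 2 delta c cos 2t.
    It is negative only where cos 2t < 0; there sin^2 t >= 1/2 forces c <= 2, so the coordinate
    stays above - 4 delta. Both this excess and the tangential component h are absorbed by a
    neighborhood of the closed semicircles that is uniform in q. Signs are propagated along each
    circle {q} x S^1 from t = 0, where the convention fixes them, so M may be disconnected and any
    Gauss map obeying the convention is covered. *)

Lemma near_eq_differentiable (R : realType) (V W : normedModType R)
    (f g : V -> W) (x : V) :
  (\near x, f x = g x) -> differentiable f x -> differentiable g x.
Proof.
move=> fg df.
(* The added function vanishes near [x]; uniqueness of the differential gives it differential 0. *)
have -> : g = f + (fun y => g y - f y).
  by apply/funext => y; rewrite /GRing.add /= addrC subrK.
apply: differentiableD => //.
set k := fun y => g y - f y.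
have kx : k x = 0 by rewrite /k (nbhs_singleton fg) subrr.
have ko : k \o shift x = cst (k x) + (\0 : {linear V -> W}) +o_ (0 : V) id.
  apply/eqaddoP => e e0.
  have : \forall y \near 0, f (y + x) = g (y + x).
    by move: fg; rewrite (near_shift 0) /= subr0.
  apply: filterS => y fgy.
  rewrite kx [X in `|X|](_ : _ = k (y + x) - (0 + 0)) //.
  rewrite /k fgy subrr addr0 subr0 normr0.
  by rewrite mulr_ge0 // ltW.
have dk : 'd k x = (\0 : {linear V -> W}) :> (V -> W).
  by apply: diff_unique ko; exact: cst_continuous.
apply/diff_locallyP; split; last by rewrite dk.
by rewrite dk; exact: cst_continuous.
Qed.

Section CkCalculus.
Context {R : realType}.
Implicit Types V W : normedModType R.

(** Since [U] is open, agreement on [U] is agreement near each of its points, and this passes to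
    directional derivatives. *)
Lemma Ck_on_eq V W k (U : set V) (g h : V -> W) :
  open U -> (forall x, U x -> g x = h x) -> Ck_on k U g -> Ck_on k U h.
Proof.
move=> oU; elim: k g h => [|k IH] g h gh /=.
  move=> gc x Ux; rewrite /prop_for /continuous_at -(gh _ Ux).
  apply: cvg_trans (gc x Ux); apply: near_eq_cvg.
  near=> y; apply: gh; near: y; exact: open_nbhs_nbhs.
have nU x : U x -> \near x, g x = h x.
  move=> Ux; near=> y; apply: gh; near: y; exact: open_nbhs_nbhs.
move=> [dg Dg]; split=> [x Ux|v].
  exact: near_eq_differentiable (nU _ Ux) (dg _ Ux).
apply: IH (Dg v) => x Ux; exact: near_eq_derive (nU _ Ux).
Unshelve. all: by end_near. Qed.

Lemma Ck_on_locally V W k (U : set V) (g : V -> W) :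
  (forall x, U x -> exists2 U', U' x & Ck_on k U' g) -> Ck_on k U g.
Proof.
elim: k g => [|k IH] g /= loc.
  by move=> x /loc [U' U'x]; exact.
split=> [x /loc [U' U'x [+ _]]|v]; first exact.
by apply: IH => x /loc [U' U'x [_ /(_ v) ?]]; exists U'.
Qed.

Lemma Ck_on_lower V W k (U : set V) (g : V -> W) :
  Ck_on k.+1 U g -> Ck_on k U g.
Proof.
elim: k g => [|k IH] g /= [dg Dg].
  by move=> x /dg; exact: differentiable_continuous.
by split=> // v; exact/IH/Dg.
Qed.

Lemma Ck_on_cst V W k (U : set V) (w : W) : Ck_on k U (cst w).
Proof.
elim: k w => [|k IH] w /=; first by move=> x _; exact: cst_continuous.
split=> [x _|v]; first exact: differentiable_cst.
by rewrite (_ : 'D_v _ = cst 0) //; apply/funext => x; exact: derive_cst.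
Qed.

Lemma Ck_on_linear V W k (U : set V) (g : {linear V -> W}) :
  continuous g -> Ck_on k U g.
Proof.
move=> gc; case: k => [|k] /=; first by move=> x _; exact: gc.
split=> [x _|v]; first exact: linear_differentiable.
rewrite (_ : 'D_v _ = cst (g v)); first exact: Ck_on_cst.
apply/funext => x; rewrite deriveE ?diff_lin //; exact: linear_differentiable.
Qed.

Lemma Ck_onD V W k (U : set V) (g h : V -> W) : open U ->
  Ck_on k U g -> Ck_on k U h -> Ck_on k U (fun x => g x + h x).
Proof.
move=> oU; elim: k g h => [|k IH] g h /=.
  by move=> gc hc x Ux; apply: continuousD; [exact: gc|exact: hc].
move=> [dg Dg] [dh Dh]; split=> [x Ux|v].
  by apply: differentiableD; [exact: dg|exact: dh].
apply: Ck_on_eq (IH _ _ (Dg v) (Dh v)) => // x Ux.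
by rewrite (@deriveD _ _ _ g h) //; apply: diff_derivable; [exact: dg|exact: dh].
Qed.

Lemma Ck_on_sum V W k (U : set V) n (g : 'I_n -> V -> W) : open U ->
  (forall i, Ck_on k U (g i)) -> Ck_on k U (fun x => \sum_(i < n) g i x).
Proof.
move=> oU; elim: n g => [|n IH] g gk.
  rewrite (_ : (fun _ => _) = cst 0); first exact: Ck_on_cst.
  by apply/funext => x; rewrite big_ord0.
rewrite (_ : (fun _ => _) =
  fun x => \sum_(i < n) g (widen_ord (leqnSn n) i) x + g ord_max x).
  by apply: Ck_onD => //; apply: IH.
by apply/funext => x; rewrite big_ord_recr.
Qed.

Lemma Ck_onM V k (U : set V) (g h : V -> R) : open U ->
  Ck_on k U g -> Ck_on k U h -> Ck_on k U (fun x => g x * h x).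
Proof.
move=> oU; elim: k g h => [|k IH] g h.
  by move=> gc hc x Ux; apply: continuousM; [exact: gc|exact: hc].
move=> gk hk; have [dg Dg] := gk; have [dh Dh] := hk; split=> [x Ux|v].
  by apply: differentiableM; [exact: dg|exact: dh].
have := Ck_onD oU (IH _ _ (Ck_on_lower gk) (Dh v))
  (IH _ _ (Ck_on_lower hk) (Dg v)).
apply: Ck_on_eq => // x Ux.
by rewrite (@deriveM _ _ g h) //; apply: diff_derivable; [exact: dg|exact: dh].
Qed.

Lemma differentiable_rV V p (g : V -> 'rV[R]_p) x :
  (forall j, differentiable (fun y => g y 0 j) x) -> differentiable g x.
Proof.
move=> dg.
have -> : g = \sum_(j < p) (fun y => g y 0 j *: delta_mx 0 j).
  by apply/funext => y; rewrite fct_sumE -row_sum_delta.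
by apply: differentiable_sum => j; apply: differentiableZl.
Qed.

Lemma continuous_rV (T : topologicalType) p (g : T -> 'rV[R]_p) x :
  (forall j, {for x, continuous (fun y => g y 0 j)}) -> {for x, continuous g}.
Proof.
move=> cg; apply/cvgrPdist_lt => e e0.
near=> y; rewrite /Num.Def.normr /= mx_normrE.
apply: bigmax_lt => // -[i j] _ /=; rewrite ord1 !mxE {i}.
move: j; near: y; apply: filter_forall => j.
exact: (cvgrPdist_lt _ _).1 (cg j) _ e0.
Unshelve. all: by end_near. Qed.

Lemma Ck_on_coord V p k (U : set V) (g : V -> 'rV[R]_p) j : open U ->
  Ck_on k U g -> Ck_on k U (fun x => g x 0 j).
Proof.
move=> oU; elim: k g => [|k IH] g /=.
  move=> gc x Ux; apply: (@continuous_comp _ _ _ g (fun w : 'rV_p => w 0 j)).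
      exact: gc.
    exact: coord_continuous.
move=> [dg Dg]; split=> [x Ux|v].
  apply: (@differentiable_comp _ _ _ _ g (fun w : 'rV_p => w 0 j)).
      exact: dg.
    exact: differentiable_coord.
apply: Ck_on_eq (IH _ (Dg v)) => // x Ux.
by rewrite (derive_mx (@diff_derivable _ _ _ _ _ v (dg _ Ux))) mxE.
Qed.

Lemma Ck_on_rV V p k (U : set V) (g : V -> 'rV[R]_p) : open U ->
  (forall j, Ck_on k U (fun x => g x 0 j)) -> Ck_on k U g.
Proof.
move=> oU; elim: k g => [|k IH] g /= gk.
  by move=> x Ux; apply: continuous_rV => j; exact: gk.
have dg x : U x -> differentiable g x.
  by move=> Ux; apply: differentiable_rV => j; exact: (gk j).1.
split=> // v; apply: IH => j; apply: Ck_on_eq ((gk j).2 v) => // x Ux.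
by rewrite (derive_mx (@diff_derivable _ _ _ _ _ v (dg _ Ux))) mxE.
Qed.

Lemma derive_comp V W V' (g : V' -> W) (h : V -> V') x v :
  differentiable h x -> differentiable g (h x) ->
  'D_v (g \o h) x = 'D_('D_v h x) g (h x).
Proof.
move=> dh dg; rewrite (deriveE v dh) (deriveE _ dg).
rewrite (deriveE v (differentiable_comp dh dg)).
by rewrite (diff_comp dh dg).
Qed.

Lemma derive_rV p (g : 'rV[R]_p -> R) x (v : 'rV[R]_p) :
  differentiable g x ->
  'D_v g x = \sum_(j < p) v 0 j * 'D_(delta_mx 0 j) g x.
Proof.
move=> dg; rewrite deriveE // {1}(row_sum_delta v) linear_sum /=.
by apply: eq_bigr => j _; rewrite linearZ /= deriveE.
Qed.

(** In the chain rule the direction ['D_v h x] varies with [x], whereas [Ck_on] differentiates in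
    fixed directions. Expanding it in the standard basis leaves sums of products, to which the
    induction hypothesis applies. *)
Lemma Ck_on_comp_scalar V p k (U : set V) (U' : set 'rV[R]_p)
    (g : 'rV[R]_p -> R) (h : V -> 'rV[R]_p) : open U ->
  (forall x, U x -> U' (h x)) -> Ck_on k U' g -> Ck_on k U h ->
  Ck_on k U (g \o h).
Proof.
move=> oU hU; elim: k g h hU => [|k IH] g h hU.
  move=> gk hk x Ux; apply: continuous_comp; first exact: hk.
  exact/gk/hU.
move=> gk hk; have [dg Dg] := gk; have [dh Dh] := hk; split=> [x Ux|v].
  by apply: differentiable_comp; [exact: dh|exact/dg/hU].
have : Ck_on k U (fun x => \sum_(j < p)
    ('D_v h x) 0 j * ('D_(delta_mx 0 j) g \o h) x).
  apply: Ck_on_sum => // j; apply: Ck_onM => //.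
    exact: (Ck_on_coord j oU (Dh v)).
  exact: IH _ _ hU (Dg _) (Ck_on_lower hk).
apply: Ck_on_eq => // x Ux; have dgx := dg _ (hU _ Ux).
by rewrite (derive_comp v (dh _ Ux) dgx) (derive_rV _ dgx).
Qed.

Lemma Ck_on_comp V p q k (U : set V) (U' : set 'rV[R]_p)
    (g : 'rV[R]_p -> 'rV[R]_q) (h : V -> 'rV[R]_p) : open U -> open U' ->
  (forall x, U x -> U' (h x)) -> Ck_on k U' g -> Ck_on k U h ->
  Ck_on k U (g \o h).
Proof.
move=> oU oU' hU gk hk; apply: Ck_on_rV => // j.
exact: (Ck_on_comp_scalar oU hU (Ck_on_coord j oU' gk) hk).
Qed.

Lemma Ck_on_comp_real V k (U : set V) (U' : set R) (g : R -> R) (h : V -> R) :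
  open U -> (forall x, U x -> U' (h x)) -> Ck_on k U' g -> Ck_on k U h ->
  Ck_on k U (g \o h).
Proof.
move=> oU hU; elim: k g h hU => [|k IH] g h hU.
  move=> gk hk x Ux; apply: continuous_comp; first exact: hk.
  exact/gk/hU.
move=> gk hk; have [dg Dg] := gk; have [dh Dh] := hk; split=> [x Ux|v].
  by apply: differentiable_comp; [exact: dh|exact/dg/hU].
have : Ck_on k U (fun x => 'D_v h x * ('D_1 g \o h) x).
  exact: (Ck_onM oU (Dh v) (IH ('D_(1 : R) g) h hU (Dg 1) (Ck_on_lower hk))).
apply: Ck_on_eq => // x Ux; have dgx := dg _ (hU _ Ux).
rewrite (derive_comp v (dh _ Ux) dgx) (deriveE _ dgx) /= (deriveE (1 : R) dgx).
by rewrite -[in RHS](mulr1 ('D_v h x)) -[_ * 1]/(_ *: (1 : R)) linearZ.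
Qed.

(** A class of functions closed under differentiation consists of smooth functions; this replaces
    formulas for higher derivatives. *)
Lemma smooth_on_family (P : (R -> R) -> Prop) (U : set R) : open U ->
  (forall g, P g -> exists2 g', P g' & forall x, U x -> is_derive x 1 g (g' x)) ->
  forall g, P g -> smooth_on U g.
Proof.
move=> oU Pd g Pg k.
have dU (h h' : R -> R) (x : R) :
    (forall x, U x -> is_derive x 1 h (h' x)) -> U x -> differentiable h x.
  by move=> hh' /hh' [? _]; exact/derivable1_diffP.
elim: k g Pg => [|k IH] g /Pd [g' Pg' gg'].
  by move=> x Ux; apply: differentiable_continuous; exact: (dU g g' x gg' Ux).
split=> [x Ux|v]; first exact: (dU g g' x gg' Ux).
have : Ck_on k U (fun x => v * g' x).
  by apply: Ck_onM => //; [exact: (Ck_on_cst k U v)|exact: IH].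
apply: Ck_on_eq => // x Ux; have dx := dU _ _ _ gg' Ux.
have [_ <-] := gg' _ Ux; rewrite (deriveE _ dx) (deriveE _ dx).
by rewrite -[in RHS](mulr1 v) -[_ * 1]/(_ *: (1 : R)) linearZ.
Qed.

End CkCalculus.

(** * Smooth functions of one variable *)

Section OneVariable.
Context {R : realType}.

Lemma smooth_trig (a b : R) : smooth_on setT (fun x => a * cos x + b * sin x).
Proof.
apply: (@smooth_on_family _ (fun g => exists a b : R,
  g = fun x => a * cos x + b * sin x)).
- exact: openT.
- move=> _ [c [d ->]]; exists (fun x => d * cos x + (- c) * sin x).
    by exists d, (- c).
  move=> x _.
  have h := is_deriveD (is_deriveZ c (is_derive_cos x))
    (is_deriveZ d (is_derive_sin x)).
  apply: (is_derive_eq h).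
  by rewrite /GRing.scale /=; ring.
- by exists a, b.
Qed.

Lemma smooth_cos : smooth_on setT (@cos R).
Proof.
have := smooth_trig 1 0; congr smooth_on.
by apply/funext => x; rewrite mul1r mul0r addr0.
Qed.

Lemma smooth_sin : smooth_on setT (@sin R).
Proof.
have := smooth_trig 0 1; congr smooth_on.
by apply/funext => x; rewrite mul1r mul0r add0r.
Qed.

Lemma smooth_powR (a : R) : smooth_on [set x : R | 0 < x] (fun x => x `^ a).
Proof.
apply: (@smooth_on_family _ (fun g => exists c b : R, g = fun x => c * x `^ b)).
- exact: open_gt.
- move=> _ [c [b ->]]; exists (fun x => (c * b) * x `^ (b - 1)).
    by exists (c * b), (b - 1).
  move=> x /= x0.
  have -> : (fun x => c * x `^ b) = c *: (fun x => x `^ b) by [].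
  have ? := is_derive1_powR b x0.
  apply: is_derive_eq.
  by rewrite /GRing.scale /= mulrA.
- by exists 1, a; apply/funext => x; rewrite mul1r.
Qed.

(** Termwise, [y ^+ i] is at most i! times [expR y]. The summand 1 in the constant keeps it positive
    when [p] is 0. *)
Lemma horner_expR_bound (p : {poly R}) :
  exists2 C : R, 0 < C & forall y, 0 <= y -> `|p.[y]| <= C * expR y.
Proof.
exists (1 + \sum_(i < size p) `|p`_i| * i`!%:R) => [|y y0].
  rewrite ltr_pwDl // sumr_ge0 // => i _; exact: mulr_ge0.
rewrite horner_coef mulrDl mul1r mulr_suml.
apply: (le_trans (ler_norm_sum _ _ _)).
rewrite -[leLHS]add0r lerD ?expR_ge0 //.
apply: ler_sum => i _; rewrite normrM -mulrA ler_wpM2l //.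
rewrite ger0_norm ?exprn_ge0 //.
case: (nat_of_ord i) => [|k].
  by rewrite expr0 fact0 mul1r (le_trans _ (expR_ge1Dx y)) // lerDl.
have := expR_ge1Dxn k y0.
rewrite -ler_pdivrMl ?ltr0n ?fact_gt0 //; lra.
Qed.


(** For [p = 1] this is the classical flat function exp(-1/x). Its derivatives are polynomials in
    1/x times exp(-1/x), hence the parameter [p]. *)
Definition flat_fun (p : {poly R}) (x : R) : R :=
  if 0 < x then p.[x^-1] * expR (- x^-1) else 0.

Lemma is_derive_flat (p : {poly R}) (x : R) :
  is_derive x 1 (flat_fun p) (flat_fun ('X^2 * (p - p^`())) x).
Proof.
have [x0|x0|<-] := ltgtP 0 x.
- have xn0 : x != 0 by rewrite gt_eqF.
  apply: (@near_eq_is_derive _ _ _ (fun y : R => p.[y^-1] * expR (- y^-1))).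
    have := lt_nbhsr x0.
    by apply: filterS => y y0; rewrite /flat_fun y0.
  have dV : is_derive x 1 (fun y : R => y^-1) (- x ^- 2).
    have := @is_deriveV R id x 1 1 xn0 (is_derive_id _ _).
    by rewrite /GRing.scale /= mulr1.
  have dp : is_derive x 1 (horner p \o (fun y : R => y^-1)) (p^`().[x^-1] * (- x ^- 2)).
    by apply: is_derive1_comp.
  have de : is_derive x 1 (expR \o (fun y : R => - y^-1)) (expR (- x^-1) * (x ^- 2)).
    apply: is_derive1_comp; rewrite -[x ^- 2]opprK.
    exact: (@is_deriveN _ _ _ (fun y : R => y^-1)).
  have := @is_deriveM _ _ (horner p \o (fun y : R => y^-1))
    (expR \o (fun y : R => - y^-1)) x 1 _ _ dp de.
  move=> /is_derive_eq; apply.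
  rewrite /flat_fun x0 /= !hornerE /GRing.scale /= -exprVn; ring.
- apply: (@near_eq_is_derive _ _ _ (cst 0)).
    have := lt_nbhsl x0.
    by apply: filterS => y y0; rewrite /flat_fun ltNge (ltW y0).
  rewrite /flat_fun ltNge (ltW x0) /=; exact: is_derive_cst.
- rewrite /flat_fun ltxx.
  (* With 1/h written as h times 1/h^2, the factor ['X^2] absorbs 1/h^2, so the difference quotient
     at 0 is at most [C * h]. *)
  have [C C0 Cp] := horner_expR_bound ('X^2 * p).
  have fl0 : flat_fun p 0 = 0 by rewrite /flat_fun ltxx.
  suff L : (fun h : R => h^-1 *: (flat_fun p (h *: 1 + 0) - flat_fun p 0)) @ 0^'
      --> (0 : R).
    by apply: DeriveDef; [apply/cvg_ex; exists 0|exact: cvg_lim].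
  apply/cvgrPdist_le => e e0; near=> h.
  rewrite fl0 addr0 subr0 sub0r normrN /GRing.scale /= mulr1 /flat_fun.
  have [h0|h0] := ltP 0 h; last by rewrite mulr0 normr0 ltW.
  have hV : 0 <= h^-1 by rewrite invr_ge0 ltW.
  have Ch : `|h^-1 ^+ 2 * p.[h^-1]| <= C * expR h^-1.
    by have := Cp _ hV; rewrite !hornerE.
  rewrite [X in `|X|](_ : _ = h * (h^-1 ^+ 2 * p.[h^-1] * expR (- h^-1))); last first.
    by field; rewrite gt_eqF.
  rewrite normrM (normrM _ (expR _)) (ger0_norm (expR_ge0 _)) (ger0_norm (ltW h0)).
  have : h * (`|h^-1 ^+ 2 * p.[h^-1]| * expR (- h^-1)) <= h * C.
    rewrite ler_wpM2l ?(ltW h0) //.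
    by rewrite expRN ler_pdivrMr ?expR_gt0.
  move=> /le_trans; apply.
  rewrite -ler_pdivlMr //.
  have hn : `|h| <= e / C.
    near: h; apply: dnbhs0_le; exact: divr_gt0.
  by rewrite (ger0_norm (ltW h0)) in hn.
Unshelve. all: by end_near. Qed.

Lemma smooth_flat : smooth_on setT (flat_fun 1).
Proof.
apply: (@smooth_on_family _ (fun g => exists p, g = flat_fun p)).
- exact: openT.
- move=> _ [p ->]; exists (flat_fun ('X^2 * (p - p^`()))).
    by eexists.
  by move=> x _; exact: is_derive_flat.
- by exists 1.
Qed.

Lemma flat_fun_ge0 x : 0 <= flat_fun 1 x.
Proof.
by rewrite /flat_fun; case: ifP => // _; rewrite hornerC mul1r expR_ge0.
Qed.

Lemma flat_fun_gt0 x : (0 < flat_fun 1 x) = (0 < x).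
Proof.
by rewrite /flat_fun; case: ifP; rewrite ?ltxx // => _; rewrite hornerC mul1r expR_gt0.
Qed.

End OneVariable.

Section SmoothCalculus.
Context {R : realType}.
Implicit Types V W : normedModType R.

Lemma smooth_on_eq V W (U : set V) (g h : V -> W) :
  open U -> (forall x, U x -> g x = h x) -> smooth_on U g -> smooth_on U h.
Proof. by move=> oU gh gs k; exact: Ck_on_eq gh (gs k). Qed.

Lemma smooth_on_locally V W (U : set V) (g : V -> W) :
  (forall x, U x -> exists2 U', U' x & smooth_on U' g) -> smooth_on U g.
Proof.
by move=> loc k; apply: Ck_on_locally => x /loc [U' U'x gs]; exists U'.
Qed.

Lemma smooth_on_cst V W (U : set V) (w : W) : smooth_on U (fun=> w).
Proof. by move=> k; exact: Ck_on_cst. Qed.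

Lemma smooth_on_linear V W (U : set V) (g : {linear V -> W}) :
  continuous g -> smooth_on U g.
Proof. by move=> gc k; exact: Ck_on_linear. Qed.

Lemma smooth_on_continuous V W (U : set V) (g : V -> W) x :
  smooth_on U g -> U x -> {for x, continuous g}.
Proof. by move=> /(_ 0%N) gs Ux; exact: gs. Qed.

Lemma smooth_on_differentiable V W (U : set V) (g : V -> W) x :
  smooth_on U g -> U x -> differentiable g x.
Proof. by move=> /(_ 1%N) [gs _] Ux; exact: gs. Qed.

Lemma smooth_on_derive V W (U : set V) (g : V -> W) v :
  smooth_on U g -> smooth_on U ('D_v g).
Proof. by move=> gs k; exact: (gs k.+1).2. Qed.

Section OpenDomain.
Variables (V : normedModType R) (U : set V).
Hypothesis oU : open U.

Lemma smooth_onD W (g h : V -> W) : smooth_on U g -> smooth_on U h ->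
  smooth_on U (fun x => g x + h x).
Proof. by move=> gs hs k; exact: Ck_onD. Qed.

Lemma smooth_onM (g h : V -> R) : smooth_on U g -> smooth_on U h ->
  smooth_on U (fun x => g x * h x).
Proof. by move=> gs hs k; exact: Ck_onM. Qed.

Lemma smooth_onMl (g : V -> R) c : smooth_on U g ->
  smooth_on U (fun x => c * g x).
Proof. by apply: smooth_onM; exact: smooth_on_cst. Qed.

Lemma smooth_onN (g : V -> R) : smooth_on U g -> smooth_on U (fun x => - g x).
Proof.
move=> gs; apply: smooth_on_eq (smooth_onMl (- 1) gs) => // x _.
by rewrite mulN1r.
Qed.

Lemma smooth_on_coord p (g : V -> 'rV[R]_p) j : smooth_on U g ->
  smooth_on U (fun x => g x 0 j).
Proof. by move=> gs k; exact: (@Ck_on_coord _ _ _ _ _ g). Qed.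

Lemma smooth_on_rV p (g : V -> 'rV[R]_p) :
  (forall j, smooth_on U (fun x => g x 0 j)) -> smooth_on U g.
Proof. by move=> gs k; apply: Ck_on_rV => // j; exact: gs. Qed.

Lemma smooth_on_comp_scalar p (U' : set 'rV[R]_p) (g : 'rV[R]_p -> R)
    (h : V -> 'rV[R]_p) :
  (forall x, U x -> U' (h x)) -> smooth_on U' g -> smooth_on U h ->
  smooth_on U (fun x => g (h x)).
Proof. by move=> hU gs hs k; exact: (@Ck_on_comp_scalar _ _ _ _ _ U' g h). Qed.

Lemma smooth_on_comp p q (U' : set 'rV[R]_p) (g : 'rV[R]_p -> 'rV[R]_q)
    (h : V -> 'rV[R]_p) : open U' ->
  (forall x, U x -> U' (h x)) -> smooth_on U' g -> smooth_on U h ->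
  smooth_on U (fun x => g (h x)).
Proof. by move=> oU' hU gs hs k; exact: (@Ck_on_comp _ _ _ _ _ _ U' g h). Qed.

Lemma smooth_on_comp_real (U' : set R) (g : R -> R) (h : V -> R) :
  (forall x, U x -> U' (h x)) -> smooth_on U' g -> smooth_on U h ->
  smooth_on U (fun x => g (h x)).
Proof. by move=> hU gs hs k; exact: (@Ck_on_comp_real _ _ _ _ U' g h). Qed.

Lemma smooth_on_sum W (I : Type) (r : seq I) (g : I -> V -> W) :
  (forall i, smooth_on U (g i)) -> smooth_on U (fun x => \sum_(i <- r) g i x).
Proof.
move=> gs; elim: r => [|i r IH].
  apply: smooth_on_eq (smooth_on_cst _ (0 : W)) => // x _.
  by rewrite big_nil.
apply: smooth_on_eq (smooth_onD (gs i) IH) => // x _.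
by rewrite big_cons.
Qed.

Lemma smooth_on_prod (I : Type) (r : seq I) (g : I -> V -> R) :
  (forall i, smooth_on U (g i)) -> smooth_on U (fun x => \prod_(i <- r) g i x).
Proof.
move=> gs; elim: r => [|i r IH].
  apply: smooth_on_eq (smooth_on_cst _ (1 : R)) => // x _.
  by rewrite big_nil.
apply: smooth_on_eq (smooth_onM (gs i) IH) => // x _.
by rewrite big_cons.
Qed.

Lemma smooth_on_det n (B : V -> 'M[R]_n) :
  (forall i j, smooth_on U (fun x => B x i j)) ->
  smooth_on U (fun x => \det (B x)).
Proof.
move=> Bs; apply: smooth_on_sum => s; apply: smooth_onMl.
by apply: smooth_on_prod => i.
Qed.

Lemma smooth_on_dotv p (g h : V -> 'rV[R]_p) :
  smooth_on U g -> smooth_on U h -> smooth_on U (fun x => dotv (g x) (h x)).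
Proof.
move=> gs hs; apply: smooth_on_sum => i.
by apply: smooth_onM; exact: smooth_on_coord.
Qed.

Lemma smooth_onZ p (g : V -> R) (h : V -> 'rV[R]_p) :
  smooth_on U g -> smooth_on U h -> smooth_on U (fun x => g x *: h x).
Proof.
move=> gs hs; apply: smooth_on_rV => j.
apply: smooth_on_eq (smooth_onM gs (smooth_on_coord j hs)) => // x _.
by rewrite mxE.
Qed.

End OpenDomain.

Lemma jacobianE p q (g : 'rV[R]_p -> 'rV[R]_q) x i j :
  differentiable g x -> 'J g x i j = 'D_(delta_mx 0 i) g x 0 j.
Proof. by move=> dg; rewrite deriveEjacobian // -rowE [RHS]mxE. Qed.

Lemma smooth_on_jacobian p q (U : set 'rV[R]_p) (g : 'rV[R]_p -> 'rV[R]_q) i j :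
  open U -> smooth_on U g -> smooth_on U (fun x => 'J g x i j).
Proof.
move=> oU gs.
have := smooth_on_coord oU j (smooth_on_derive (delta_mx 0 i) gs).
apply: smooth_on_eq => // x Ux.
by rewrite jacobianE //; exact: smooth_on_differentiable gs Ux.
Qed.

(** Differentials act on row vectors by multiplication on the right, so the inner map comes
    first. *)
Lemma jacobian_comp p q r (g : 'rV[R]_q -> 'rV[R]_r) (h : 'rV[R]_p -> 'rV[R]_q)
    x : differentiable h x -> differentiable g (h x) ->
  'J (g \o h) x = 'J h x *m 'J g (h x).
Proof.
move=> dh dg; apply/row_matrixP => i; rewrite !rowE mulmxA.
rewrite -(deriveEjacobian _ dh) -(deriveEjacobian _ dg).
rewrite -(deriveEjacobian _ (differentiable_comp dh dg)).
exact: derive_comp.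
Qed.

Lemma near_eq_jacobian p q (g h : 'rV[R]_p -> 'rV[R]_q) x :
  (\near x, g x = h x) -> differentiable g x -> 'J g x = 'J h x.
Proof.
move=> gh dg; have dh := near_eq_differentiable gh dg.
apply/matrixP => i j.
apply: etrans (jacobianE i j dg) _; apply: etrans _ (esym (jacobianE i j dh)).
by congr (fun_of_matrix _ _ _); exact: near_eq_derive.
Qed.

End SmoothCalculus.

(** * Dot and cross products *)

Section Dot.
Context {R : realType} {k : nat}.
Implicit Types u v w : 'rV[R]_k.

Lemma dotvE u v : dotv u v = (u *m v^T) 0 0.
Proof. by rewrite mxE; apply: eq_bigr => i _; rewrite mxE. Qed.

Lemma dotvC u v : dotv u v = dotv v u.
Proof. by apply: eq_bigr => i _; rewrite mulrC. Qed.

Lemma dotvDl u v w : dotv (u + v) w = dotv u w + dotv v w.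
Proof. by rewrite !dotvE mulmxDl mxE. Qed.

Lemma dotvDr u v w : dotv w (u + v) = dotv w u + dotv w v.
Proof. by rewrite dotvC dotvDl !(dotvC w). Qed.

Lemma dotvZl a u v : dotv (a *: u) v = a * dotv u v.
Proof. by rewrite !dotvE -scalemxAl mxE. Qed.

Lemma dotvZr a u v : dotv v (a *: u) = a * dotv v u.
Proof. by rewrite dotvC dotvZl dotvC. Qed.

Lemma dotvNl u v : dotv (- u) v = - dotv u v.
Proof. by rewrite -scaleN1r dotvZl mulN1r. Qed.

Lemma dotvNr u v : dotv v (- u) = - dotv v u.
Proof. by rewrite -scaleN1r dotvZr mulN1r. Qed.

Lemma dotv0l u : dotv 0 u = 0.
Proof. by rewrite -(scale0r 0) dotvZl mul0r. Qed.

Lemma dotv0r u : dotv u 0 = 0.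
Proof. by rewrite dotvC dotv0l. Qed.

Definition dotv_lin := (dotvDl, dotvDr, dotvNl, dotvNr, dotvZl, dotvZr,
  dotv0l, dotv0r).

Lemma dotv_ge0 u : 0 <= dotv u u.
Proof. by apply: sumr_ge0 => i _; rewrite -expr2 sqr_ge0. Qed.

Lemma dotv_eq0 u : (dotv u u == 0) = (u == 0).
Proof.
apply/eqP/eqP => [|->]; last exact: dotv0l.
move/eqP; rewrite psumr_eq0 => [/allP u0|i _]; last by rewrite -expr2 sqr_ge0.
apply/rowP => i; rewrite mxE.
by have := u0 i; rewrite mem_index_enum => /(_ isT); rewrite -expr2 sqrf_eq0 => /eqP.
Qed.

Lemma dotv_gt0 u : (0 < dotv u u) = (u != 0).
Proof. by rewrite lt_neqAle dotv_ge0 andbT eq_sym dotv_eq0. Qed.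

(** Cauchy-Schwarz, from the squared length of [dotv v v *: u - dotv u v *: v]. *)
Lemma dotv_sqr_le u v : dotv u v ^+ 2 <= dotv u u * dotv v v.
Proof.
have [->|v0] := eqVneq v 0; first by rewrite !dotv_lin expr0n mulr0.
have vv : 0 < dotv v v by rewrite dotv_gt0.
have := dotv_ge0 (dotv v v *: u - dotv u v *: v).
rewrite !dotv_lin (dotvC v u) => h.
have : 0 <= dotv v v * (dotv u u * dotv v v - dotv u v ^+ 2).
  by apply: le_trans h _; rewrite le_eqVlt; apply/orP; left; apply/eqP; ring.
by rewrite pmulr_rge0 // subr_ge0.
Qed.

(** Links the Euclidean length to the max norm, which defines the topology on row vectors. *)
Lemma coord_sqr_le u i : u 0 i ^+ 2 <= dotv u u.
Proof.
rewrite /dotv (bigD1 i) //= -expr2 lerDl sumr_ge0 // => j _.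
by rewrite -expr2 sqr_ge0.
Qed.

Lemma dotv_delta u i : dotv u (delta_mx 0 i) = u 0 i.
Proof.
rewrite /dotv (bigD1 i) //= mxE !eqxx mulr1 big1 ?addr0 // => j /negPf ji.
by rewrite mxE eqxx ji mulr0.
Qed.

End Dot.

Section Cross.
Context {R : realType}.

(* The generalized cross product of the rows of [B], meant for [k = r + 1]. *)
Definition cross r k (B : 'M[R]_(r, k)) : 'rV[R]_k :=
  \row_j \det (conform_mx (0 : 'M[R]_k) (col_mx B (delta_mx 0 j : 'rV_k))).

Variables (r k : nat).
Hypothesis rk : k = (r + 1)%N.
Implicit Type B : 'M[R]_(r, k).

(** Laplace expansion along the last row: the cofactors depend on [B] alone, and a unit vector as
    last row isolates one of them. *)
Lemma det_crossE B y :
  \det (conform_mx (0 : 'M[R]_k) (col_mx B y)) = dotv (cross B) y.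
Proof.
subst k; rewrite conform_mx_id.
rewrite (expand_det_row _ (rshift r 0)); apply: eq_bigr => j _.
rewrite col_mxEd mulrC; congr (_ * _).
rewrite mxE conform_mx_id (expand_det_row _ (rshift r 0)) (bigD1 j) //=.
rewrite big1 => [|i /negPf ij]; last by rewrite col_mxEd mxE eqxx ij mul0r.
rewrite col_mxEd mxE !eqxx mul1r addr0; congr (_ * \det _).
apply/matrixP => a b; rewrite !mxE; case: splitP => // c ac.
(* A row of the minor is never the deleted last row. *)
case/eqP: (neq_lift (rshift r (0 : 'I_1)) a); apply/val_inj.
by rewrite [RHS]ac ord1.
Qed.

(** With [v *m B] as last row the matrix is singular: (v, -1) lies in its left kernel. *)
Lemma cross_orth B (v : 'rV_r) : dotv (cross B) (v *m B) = 0.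
Proof.
rewrite -det_crossE; subst k; rewrite conform_mx_id.
apply/eqP/det0P; exists (row_mx v (- 1%:M)).
  rewrite -[X in _ != X]row_mx0; apply/eqP => /eq_row_mx [_].
  by move/eqP; rewrite oppr_eq0 oner_eq0.
by rewrite mul_row_col mulNmx mul1mx subrr.
Qed.

(** Applied to Jacobians, this says that a change of chart affects the line of the normal not at all
    and its direction only through the sign of a determinant. *)
Lemma cross_mul (P : 'M[R]_r) B : cross (P *m B) = \det P *: cross B.
Proof.
apply/rowP => j; rewrite !mxE; subst k; rewrite !conform_mx_id.
have -> : col_mx (P *m B) (delta_mx 0 j : 'rV_(r + 1)) =
    block_mx P 0 0 1%:M *m col_mx B (delta_mx 0 j).
  by rewrite mul_block_col !mul0mx mul1mx addr0 add0r.
by rewrite det_mulmx det_ublock det1 mulr1.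
Qed.

(** The rows of [B] together with [cross B] form a basis, because their determinant is the squared
    length of [cross B]. *)
Lemma orth_eq0 B y :
  dotv y (cross B) = 0 -> (forall v : 'rV_r, dotv y (v *m B) = 0) ->
  cross B != 0 -> y = 0.
Proof.
move=> yc yB c0; have := dotv_gt0 (cross B); rewrite c0 -det_crossE.
move: y yc yB; subst k => y yc yB; rewrite conform_mx_id => d0.
have u : col_mx B (cross B) \in unitmx by rewrite unitmxE unitfE gt_eqF.
apply/eqP; rewrite -dotv_eq0.
rewrite {2}(_ : y = y *m invmx (col_mx B (cross B)) *m col_mx B (cross B)).
  rewrite -[y *m invmx _]hsubmxK mul_row_col dotvDr yB add0r.
  by rewrite [rsubmx _]mx11_scalar mul_scalar_mx dotvZr yc mulr0.
by rewrite mulmxKV.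
Qed.

(** As r < k, some [y] lies outside the row space. If [cross B] were 0, then [B] with the row [y]
    appended would be singular, and a kernel vector would exhibit either a relation between the rows
    of [B] or [y] in their span. *)
Lemma cross_neq0 B : row_free B -> cross B != 0.
Proof.
move=> /row_freeP [B' BB'].
have [y yB] : exists y : 'rV_k, ~~ (y <= B)%MS.
  apply/not_existsP => h.
  have /mxrankS : (1%:M <= B)%MS.
    by apply/row_subP => i; apply: contrapT => /negP; exact: h.
  rewrite mxrank1 => /leq_trans /(_ (rank_leq_row B)).
  by rewrite rk addn1 ltnn.
apply/eqP => c0; have := det_crossE B y; rewrite c0 dotv0l.
move: y yB B' BB' {c0}; subst k => y yB B' BB'; rewrite conform_mx_id.
move=> /eqP /det0P [w w0]; rewrite -[w]hsubmxK mul_row_col => /eqP.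
rewrite addr_eq0 => /eqP we.
have [s0|s0] := eqVneq (rsubmx w) 0.
  case/eqP: w0; rewrite -[w]hsubmxK s0; move: we; rewrite s0 mul0mx oppr0 => we.
  by rewrite -[lsubmx w]mulmx1 -BB' mulmxA we mul0mx row_mx0.
case/negP: yB; move: we s0; rewrite [rsubmx w]mx11_scalar.
set s := rsubmx w 0 0; rewrite mul_scalar_mx => we s0.
have sn : s != 0 by apply: contraNneq s0 => ->; rewrite raddf0.
have -> : y = (- s^-1 *: lsubmx w) *m B.
  by rewrite -scalemxAl we scalerN scaleNr opprK scalerA mulVf ?scale1r.
exact: submxMl.
Qed.

End Cross.

(** The vectors orthogonal to all rows form the kernel of the transpose; if it is 0, the rank is
    full. *)
Lemma spanning_of_orth (R : realType) r k (B : 'M[R]_(r, k)) :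
  (forall y : 'rV_k, (forall v : 'rV_r, dotv y (v *m B) = 0) -> y = 0) ->
  forall w : 'rV_k, exists z : 'rV_r, w = z *m B.
Proof.
move=> yB w; suff /submxP [z ->] : (w <= B)%MS by exists z.
apply: submx_full; rewrite /row_full -mxrank_tr -/(row_free B^T) -kermx_eq0.
apply/rowV0P => y /sub_kermxP yB0; apply: yB => v.
by rewrite dotvE trmx_mul mulmxA yB0 mul0mx mxE.
Qed.

Lemma smooth_on_cross (R : realType) (V : normedModType R) (U : set V) r k
    (B : V -> 'M[R]_(r, k)) : open U -> k = (r + 1)%N ->
  (forall i j, smooth_on U (fun x => B x i j)) ->
  smooth_on U (fun x => cross (B x)).
Proof.
move=> oU rk Bs; apply: smooth_on_rV => // j; subst k.
have : smooth_on U (fun x => \det (col_mx (B x) (delta_mx 0 j : 'rV_(r + 1)))).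
  apply: smooth_on_det => // a b; rewrite -[a]splitK.
  case: (fintype.split a) => c /=.
    by apply: smooth_on_eq (Bs c b) => // x _; rewrite col_mxEu.
  apply: smooth_on_eq (smooth_on_cst U ((delta_mx 0 j : 'rV[R]_(r + 1)) c b)) => // x _.
  by rewrite col_mxEd.
by apply: smooth_on_eq => // x _; rewrite mxE conform_mx_id.
Qed.

(** * Smooth manifolds *)

Section Charts.
Context {R : realType} {M : topologicalType} {d : nat}.
Implicit Types (c : chart R M d) (B : set (chart R M d)).

Lemma chart_invK c v : is_chart c -> (chart_map c @` chart_dom c) v ->
  chart_map c (chart_inv c v) = v.
Proof. by move=> [_ _ cK _ _] [x cx <-]; rewrite cK. Qed.

Lemma chart_inv_dom c v : is_chart c -> (chart_map c @` chart_dom c) v ->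
  chart_dom c (chart_inv c v).
Proof. by move=> [_ _ cK _ _] [x cx <-]; rewrite cK. Qed.

Lemma chart_image_open c (W : set M) : is_chart c -> open W ->
  open (chart_map c @` (chart_dom c `&` W)).
Proof.
move=> cc oW; have [od oi cK _ ci] := cc.
rewrite openE => _ [x [cx Wx] <-].
have Ix : (chart_map c @` chart_dom c) (chart_map c x) by exists x.
have : \forall v \near chart_map c x, W (chart_inv c v).
  by apply: (ci _ Ix); rewrite cK //; exact: open_nbhs_nbhs.
have : \forall v \near chart_map c x, (chart_map c @` chart_dom c) v.
  exact: open_nbhs_nbhs.
apply: filterS2 => v Iv Wv; exists (chart_inv c v); last exact: chart_invK.
by split=> //; exact: chart_inv_dom.
Qed.

Lemma chart_overlap_open c c' : is_chart c -> is_chart c' ->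
  open (chart_map c @` (chart_dom c `&` chart_dom c')).
Proof. by move=> cc [od' _ _ _ _]; exact: chart_image_open. Qed.

Lemma transitionE c c' x : is_chart c -> chart_dom c x ->
  transition c c' (chart_map c x) = chart_map c' x.
Proof. by move=> [_ _ cK _ _] cx; rewrite /transition /= cK. Qed.

Lemma comp_transition (T : Type) (F : M -> T) c c' v :
  is_chart c -> is_chart c' ->
  (chart_map c @` (chart_dom c `&` chart_dom c')) v ->
  F (chart_inv c v) = F (chart_inv c' (transition c c' v)).
Proof.
move=> cc cc' [x [cx c'x] <-]; have [_ _ cK _ _] := cc.
by have [_ _ cK' _ _] := cc'; rewrite transitionE // cK // cK'.
Qed.

Lemma transition_image c c' v : is_chart c ->
  (chart_map c @` (chart_dom c `&` chart_dom c')) v ->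
  (chart_map c' @` (chart_dom c' `&` chart_dom c)) (transition c c' v).
Proof. by move=> cc [x [cx c'x] <-]; rewrite transitionE //; exists x. Qed.

(** Near each point, [F] read in a chart of [B'] is [F] read in a chart of [B] after a smooth
    transition. This moves smoothness between the given atlas, an oriented one and their common
    enlargements. *)
Lemma smooth_map_sub B B' k (F : M -> 'rV[R]_k) : smooth_atlas B' ->
  covering B -> B `<=` B' -> smooth_map B F -> smooth_map B' F.
Proof.
move=> [B'c _ B's] Bcov BB' sF c B'C; apply: smooth_on_locally => _ [x cx <-].
have [c1 Bc1 c1x] := Bcov x.
exists (chart_map c @` (chart_dom c `&` chart_dom c1)); first by exists x.
have oI := chart_overlap_open (B'c _ B'C) (B'c _ (BB' _ Bc1)).
have [_ oI1 _ _ _] := B'c _ (BB' _ Bc1).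
have := smooth_on_comp oI oI1 _ (sF _ Bc1) (B's _ _ B'C (BB' _ Bc1)).
move=> h; apply: smooth_on_eq (h _) => //.
  by move=> v /(comp_transition F (B'c _ B'C) (B'c _ (BB' _ Bc1))) /= ->.
move=> v /(transition_image (B'c _ B'C)) [y [? ?] <-]; by exists y.
Qed.

Lemma differentiable_in_chart B c x k (F : M -> 'rV[R]_k) :
  smooth_map B F -> B c -> chart_dom c x ->
  differentiable (F \o chart_inv c) (chart_map c x).
Proof.
by move=> sF Bc cx; apply: (smooth_on_differentiable (sF _ Bc)); exists x.
Qed.

Lemma differentiable_transition B c c' x : smooth_atlas B -> B c -> B c' ->
  chart_dom c x -> chart_dom c' x ->
  differentiable (transition c c') (chart_map c x).
Proof.
move=> [_ _ Bs] Bc Bc' cx c'x.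
by apply: (smooth_on_differentiable (Bs _ _ Bc Bc')); exists x.
Qed.

(** All later independence of charts (normal spaces, rank, signs of normals, derivative bounds)
    rests on this identity. *)
Lemma jacobian_chart_change B c c' x k (F : M -> 'rV[R]_k) :
  smooth_atlas B -> smooth_map B F -> B c -> B c' ->
  chart_dom c x -> chart_dom c' x ->
  'J (F \o chart_inv c) (chart_map c x) =
  'J (transition c c') (chart_map c x) *m
  'J (F \o chart_inv c') (chart_map c' x).
Proof.
move=> sB sF Bc Bc' cx c'x; have [Bch _ _] := sB.
have := jacobian_comp (differentiable_transition sB Bc Bc' cx c'x).
rewrite (transitionE _ (Bch _ Bc) cx) => <-.
  apply: near_eq_jacobian; last exact: differentiable_in_chart sF Bc cx.
  near=> v; apply: (comp_transition F (Bch _ Bc) (Bch _ Bc')).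
  near: v; apply: open_nbhs_nbhs; split; last by exists x.
  exact: chart_overlap_open (Bch _ Bc) (Bch _ Bc').
exact: differentiable_in_chart sF Bc' c'x.
Unshelve. all: by end_near. Qed.

Lemma jacobian_id p (x : 'rV[R]_p) : 'J id x = 1%:M.
Proof.
apply/matrixP => i j; rewrite jacobianE // derive_id !mxE eqxx /=.
by rewrite eq_sym.
Qed.

Lemma jacobian_transitionK B c c' x :
  smooth_atlas B -> B c -> B c' -> chart_dom c x -> chart_dom c' x ->
  'J (transition c c') (chart_map c x) *m
  'J (transition c' c) (chart_map c' x) = 1%:M.
Proof.
move=> sB Bc Bc' cx c'x; have [Bch _ _] := sB.
have := jacobian_comp (differentiable_transition sB Bc Bc' cx c'x).
rewrite (transitionE _ (Bch _ Bc) cx) => <-.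
  rewrite -(jacobian_id (chart_map c x)); apply/esym/near_eq_jacobian => //.
  near=> v; have Iv : (chart_map c @` (chart_dom c `&` chart_dom c')) v.
    near: v; apply: open_nbhs_nbhs; split; last by exists x.
    exact: chart_overlap_open (Bch _ Bc) (Bch _ Bc').
  change (v = chart_map c (chart_inv c' (transition c c' v))).
  rewrite -(comp_transition id (Bch _ Bc) (Bch _ Bc') Iv).
  by rewrite (chart_invK (Bch _ Bc)) //; case: Iv => y [? ?] <-; exists y.
exact: (differentiable_transition sB Bc' Bc c'x cx).
Unshelve. all: by end_near. Qed.

Lemma chart_diffE c k (F : M -> 'rV[R]_k) x v :
  chart_diff c F x v = v *m 'J (F \o chart_inv c) (chart_map c x).
Proof. by rewrite /jacobian mul_rV_lin1. Qed.

(** One chart suffices: passing to another multiplies [v] by the Jacobian of a transition. *)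
Lemma normal_spaceP B c x k (F : M -> 'rV[R]_k) y :
  smooth_atlas B -> smooth_map B F -> B c -> chart_dom c x ->
  Defs.normal_space B F x y <->
  forall v, dotv y (v *m 'J (F \o chart_inv c) (chart_map c x)) = 0.
Proof.
move=> sB sF Bc cx; split=> [yn v|yn w [c' [Bc' c'x [v _ <-]]]].
  by apply: yn; exists c; split=> //; exists v => //; rewrite chart_diffE.
by rewrite chart_diffE (jacobian_chart_change sB sF Bc' Bc c'x cx) mulmxA yn.
Qed.

Lemma injective_jacobian p q (g : 'rV[R]_p -> 'rV[R]_q) x :
  injective ('d g x) <-> row_free ('J g x).
Proof.
have dE v : 'd g x v = v *m 'J g x by rewrite /jacobian mul_rV_lin1.
split=> [inj|/row_freeP [J' JJ'] v w].
  rewrite -kermx_eq0; apply/rowV0P => v /sub_kermxP vJ; apply: inj.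
  by rewrite !dE vJ mul0mx.
by rewrite !dE => vw; rewrite -[v]mulmx1 -[w]mulmx1 -JJ' !mulmxA vw.
Qed.

Lemma row_free_chart_change B c c' x k (F : M -> 'rV[R]_k) :
  smooth_atlas B -> smooth_map B F -> B c -> B c' ->
  chart_dom c x -> chart_dom c' x ->
  row_free ('J (F \o chart_inv c) (chart_map c x)) ->
  row_free ('J (F \o chart_inv c') (chart_map c' x)).
Proof.
move=> sB sF Bc Bc' cx c'x /row_freeP [J' JJ']; apply/row_freeP.
exists (J' *m 'J (transition c c') (chart_map c x)).
rewrite (jacobian_chart_change sB sF Bc' Bc c'x cx) mulmxA -(mulmxA _ _ J') JJ' mulmx1.
exact: jacobian_transitionK sB Bc' Bc c'x cx.
Qed.

Lemma smooth_map_continuous B k (F : M -> 'rV[R]_k) :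
  smooth_atlas B -> smooth_map B F -> continuous F.
Proof.
move=> [Bch Bcov _] sF x; have [c Bc cx] := Bcov x.
have [od _ cK cc _] := Bch _ Bc.
have : {for x, continuous ((F \o chart_inv c) \o chart_map c)}.
  apply: continuous_comp; first exact: cc.
  by apply: (smooth_on_continuous (sF _ Bc)); exists x.
rewrite /prop_for /continuous_at /= cK //; apply: cvg_trans.
apply: near_eq_cvg; near=> y; rewrite /= cK //.
near: y; exact: open_nbhs_nbhs.
Unshelve. all: by end_near. Qed.

End Charts.

Lemma smooth_on_id (R : realType) (V : normedModType R) (U : set V) :
  smooth_on U (fun x => x).
Proof.
exact: (@smooth_on_linear _ _ _ U (idfun : {linear V -> V}) (fun=> cvg_id)).
Qed.

(** * The circle as a smooth manifold *)

Section Circle.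
Context {R : realType}.
Implicit Types (a b s t : R).

Lemma angle_continuous : continuous (@angle R).
Proof. exact: pi_continuous. Qed.

Lemma angle_shift t (k : int) : angle (t + pi *+ 2 *~ k) = angle t.
Proof. by apply/angle_eqP; exists k. Qed.

(** The preimage of the image is the union of the translates of [W] by multiples of 2 pi. *)
Lemma angle_open (W : set R) : open W -> open (@angle R @` W).
Proof.
move=> oW; rewrite /open /= /quotient_open openE => s [t Wt ts].
have /angle_eqP [k sk] := esym ts.
have : \forall s' \near s, W (s' - pi *+ 2 *~ k).
  have c : {for s, continuous (fun s' : R => s' - pi *+ 2 *~ k)}.
    by apply: continuousB; [exact: cvg_id|exact: cst_continuous].
  by apply: c; rewrite sk addrK; exact: open_nbhs_nbhs.
apply: filterS => s' Ws'; exists (s' - pi *+ 2 *~ k) => //.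
by apply/angle_eqP; exists (- k); rewrite mulrNz.
Qed.

(** Two representatives in the open interval differ by a multiple of 2 pi of absolute value less
    than 2 pi, so [get] has only one candidate. *)
Lemma circle_chartK a t : a < t < a + pi *+ 2 ->
  chart_map (circle_chart a) (angle t) = const_mx t.
Proof.
move=> ta; rewrite /=; congr const_mx.
have : [set s | a < s < a + pi *+ 2 /\ angle s = angle t]
    (get [set s | a < s < a + pi *+ 2 /\ angle s = angle t]).
  by apply: (@getI _ _ t); split.
set s := get _ => -[/andP[as1 as2] /angle_eqP [k sk]].
move: ta => /andP[at1 at2].
have p0 : 0 < (pi *+ 2 : R) by rewrite mulrn_wgt0 // pi_gt0.
suff k0 : k = 0 by move: sk; rewrite k0 mulr0z addr0.
have h1 : (pi *+ 2 : R) *~ k < pi *+ 2 *~ 1 by rewrite mulr1z; lra.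
have h2 : (pi *+ 2 : R) *~ (-1) < pi *+ 2 *~ k by rewrite mulrNz mulr1z; lra.
rewrite ltr_pMz2l // in h1; rewrite ltr_pMz2l // in h2.
by lia.
Qed.

Lemma circle_chart_is_chart a : is_chart (circle_chart a).
Proof.
have oI : open [set` `]a, a + pi *+ 2[] by exact: interval_open.
have iE : chart_map (circle_chart a) @` chart_dom (circle_chart a) =
    [set v : 'rV[R]_1 | v 0 0 \in `]a, a + pi *+ 2[].
  apply/seteqP; split=> [_ [_ [t ta <-] <-]|v va].
    by rewrite circle_chartK //= mxE.
  exists (angle (v 0 0)); first by exists (v 0 0).
  by rewrite circle_chartK //; apply/rowP => j; rewrite !ord1 mxE.
split.
- exact: angle_open.
- rewrite iE.
  have /continuousP := @coord_continuous R 1 1 0 0.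
  by move=> /(_ _ oI).
- by move=> _ [t ta <-]; rewrite circle_chartK //= mxE.
(* Continuity of the chart map amounts to openness of [angle]. *)
- move=> _ [t ta <-] V.
  rewrite circle_chartK // => Vt.
  have ct : {for t, continuous (fun s : R => const_mx s : 'rV[R]_1)}.
    apply: continuous_rV => j; rewrite (_ : (fun _ => _) = id).
      exact: cvg_id.
    by apply/funext => s; rewrite mxE.
  have : nbhs t ([set` `]a, a + pi *+ 2[] `&` [set s : R | V (const_mx s)]).
    by apply: filterI; [exact: open_nbhs_nbhs|exact: ct].
  rewrite nbhsE => -[W [oW Wt] WV].
  have : nbhs (angle t) (@angle R @` W).
    by apply: open_nbhs_nbhs; split; [exact: angle_open|exists t].
  apply: filterS => _ [s Ws <-]; have [sa Vs] := WV _ Ws.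
  by change (V (chart_map (circle_chart a) (angle s))); rewrite circle_chartK.
- move=> v _; apply: (@continuous_comp _ _ _ (fun v : 'rV[R]_1 => v 0 0)).
    exact: coord_continuous.
  exact: angle_continuous.
Qed.

Lemma smooth_circle_atlas : smooth_atlas (circle_atlas R).
Proof.
split.
- by move=> _ [a _ <-]; exact: circle_chart_is_chart.
- move=> x; exists (circle_chart (repr x - pi)); first by exists (repr x - pi).
  exists (repr x); last by rewrite /angle reprK.
  have := pi_gt0 R; rewrite /= in_itv /=; lra.
(* The overlap of two arcs may have two components. The transition is a translation by 2 pi k with
   [k] depending on the component, so the argument is local. *)
move=> _ _ [a _ <-] [b _ <-]; apply: smooth_on_locally => _ [_ [[t ta <-] [s sb st]] <-].
have /angle_eqP [k sk] := st.
have ca := circle_chart_is_chart a; have cb := circle_chart_is_chart b.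
pose U := [set v : 'rV[R]_1 | a < v 0 0 < a + pi *+ 2 /\
                             b < v 0 0 + pi *+ 2 *~ k < b + pi *+ 2].
have oI c : open [set` `]c, c + pi *+ 2[ : interval R] by exact: interval_open.
have oU : open U.
  have -> : U = (fun v : 'rV[R]_1 => v 0 0) @^-1` [set` `]a, a + pi *+ 2[] `&`
    (fun v : 'rV[R]_1 => v 0 0 + pi *+ 2 *~ k) @^-1` [set` `]b, b + pi *+ 2[].
    by apply/seteqP; split=> v.
  apply: openI.
    have /continuousP := @coord_continuous R 1 1 0 0.
    by move=> /(_ _ (oI a)).
  have /continuousP : continuous (fun v : 'rV[R]_1 => v 0 0 + pi *+ 2 *~ k).
    move=> v; apply: continuousD; first exact: coord_continuous.
    exact: cst_continuous.
  by move=> /(_ _ (oI b)).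
exists U.
  rewrite circle_chartK // /U /= mxE; split; first by [].
  by rewrite -sk.
have : smooth_on U (fun v : 'rV[R]_1 => v + const_mx (pi *+ 2 *~ k)).
  apply: smooth_onD => //; last exact: smooth_on_cst.
  exact: smooth_on_id.
apply: smooth_on_eq => // v [va vb].
change (v + const_mx (pi *+ 2 *~ k) = chart_map (circle_chart b) (angle (v 0 0))).
rewrite -(angle_shift (v 0 0) k) circle_chartK //.
by apply/rowP => j; rewrite ord1 !mxE.
Qed.

End Circle.

(** * Product charts *)

Section Product.
Context {R : realType} {M M' : topologicalType} {d d' : nat}.
Implicit Types (c : chart R M d) (e : chart R M' d').

Lemma prod_chart_imageE c e :
  chart_map (prod_chart c e) @` chart_dom (prod_chart c e) =
  [set v | (chart_map c @` chart_dom c) (lsubmx v) /\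
           (chart_map e @` chart_dom e) (rsubmx v)].
Proof.
apply/seteqP; split=> [_ [x [cx ex] <-]|v [[x cx xv] [y ey yv]]] /=.
  by rewrite row_mxKl row_mxKr; split; [exists x.1|exists x.2].
by exists (x, y) => //=; rewrite xv yv hsubmxK.
Qed.

Lemma prod_chart_is_chart c e : is_chart c -> is_chart e ->
  is_chart (prod_chart c e).
Proof.
move=> [oc oic cK cc cci] [oe oie eK ec eci]; split.
- rewrite openE => -[x y] [/= cx ey].
  exists (chart_dom c, chart_dom e) => //=.
  by split; exact: open_nbhs_nbhs.
- rewrite prod_chart_imageE; apply: openI.
    have /continuousP := @continuous_lsubmx R 1 d d'.
    exact.
  have /continuousP := @continuous_rsubmx R 1 d d'.
  exact.
- by move=> [x y] [/= cx ey]; rewrite row_mxKl row_mxKr cK // eK.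
- move=> [x y] [/= cx ey]; apply: continuous_rV => j; rewrite -[j]splitK.
  case: (fintype.split j) => i /=.
    rewrite (_ : (fun _ => _) =
      (fun v : 'rV[R]_d => v 0 i) \o chart_map c \o (@fst M M')).
      apply: continuous_comp; first exact: cvg_fst.
      apply: continuous_comp; [exact: cc|exact: coord_continuous].
    by apply/funext => z; rewrite row_mxEl.
  rewrite (_ : (fun _ => _) =
    (fun v : 'rV[R]_d' => v 0 i) \o chart_map e \o (@snd M M')).
    apply: continuous_comp; first exact: cvg_snd.
    apply: continuous_comp; [exact: ec|exact: coord_continuous].
  by apply/funext => z; rewrite row_mxEr.
- move=> v; rewrite prod_chart_imageE => -[cv ev].
  have cl : {for v, continuous (chart_inv c \o lsubmx)}.
    apply: continuous_comp; [exact: continuous_lsubmx|exact: cci].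
  have cr : {for v, continuous (chart_inv e \o rsubmx)}.
    apply: continuous_comp; [exact: continuous_rsubmx|exact: eci].
  exact: (cvg_pair cl cr).
Qed.

Lemma smooth_on_lsubmx (U : set 'rV[R]_(d + d')) :
  smooth_on U (lsubmx : 'rV[R]_(d + d') -> 'rV[R]_d).
Proof. by apply: smooth_on_linear; exact: continuous_lsubmx. Qed.

Lemma smooth_on_rsubmx (U : set 'rV[R]_(d + d')) :
  smooth_on U (rsubmx : 'rV[R]_(d + d') -> 'rV[R]_d').
Proof. by apply: smooth_on_linear; exact: continuous_rsubmx. Qed.

Lemma smooth_on_row_mx (V : normedModType R) (U : set V) (g : V -> 'rV[R]_d)
    (h : V -> 'rV[R]_d') : open U -> smooth_on U g -> smooth_on U h ->
  smooth_on U (fun x => row_mx (g x) (h x)).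
Proof.
move=> oU gs hs; apply: smooth_on_rV => // j; rewrite -[j]splitK.
case: (fintype.split j) => i /=.
  apply: smooth_on_eq (smooth_on_coord oU i gs) => // x _.
  by rewrite row_mxEl.
apply: smooth_on_eq (smooth_on_coord oU i hs) => // x _.
by rewrite row_mxEr.
Qed.

Lemma smooth_prod_atlas (At : set (chart R M d)) (At' : set (chart R M' d')) :
  smooth_atlas At -> smooth_atlas At' -> smooth_atlas (prod_atlas At At').
Proof.
move=> [Ach Acov As] [Ach' Acov' As']; split.
- by move=> _ [c [e [Ac Ae ->]]]; apply: prod_chart_is_chart; [exact: Ach|exact: Ach'].
- move=> [x y]; have [c Ac cx] := Acov x; have [e Ae ey] := Acov' y.
  by exists (prod_chart c e) => //; exists c, e.
move=> _ _ [c1 [e1 [Ac1 Ae1 ->]]] [c2 [e2 [Ac2 Ae2 ->]]].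
have o1 : open (chart_map (prod_chart c1 e1) @`
    (chart_dom (prod_chart c1 e1) `&` chart_dom (prod_chart c2 e2))).
  by apply: chart_overlap_open; apply: prod_chart_is_chart; auto.
apply: smooth_on_row_mx => //.
  apply: (@smooth_on_comp _ _ _ o1 _ _
    (chart_map c1 @` (chart_dom c1 `&` chart_dom c2)) (transition c1 c2)).
  - by apply: chart_overlap_open; auto.
  - by move=> _ [[x y] [[/= ? ?] [/= ? ?]] <-] /=; rewrite row_mxKl; exists x.
  - exact: As.
  - exact: smooth_on_lsubmx.
apply: (@smooth_on_comp _ _ _ o1 _ _
  (chart_map e1 @` (chart_dom e1 `&` chart_dom e2)) (transition e1 e2)).
- by apply: chart_overlap_open; auto.
- by move=> _ [[x y] [[/= ? ?] [/= ? ?]] <-] /=; rewrite row_mxKr; exists y.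
- exact: As'.
- exact: smooth_on_rsubmx.
Qed.

End Product.

(** * Charts modified by restriction and by a linear automorphism *)

Section Orientation.
Context {R : realType} {M : topologicalType} {d : nat}.
Implicit Types (c : chart R M d) (B : set (chart R M d)).

Lemma smooth_on_mulmx (V : normedModType R) (U : set V) p q
    (g : V -> 'rV[R]_p) (P : 'M[R]_(p, q)) :
  open U -> smooth_on U g -> smooth_on U (fun x => g x *m P).
Proof.
move=> oU gs; apply: smooth_on_rV => // j.
have : smooth_on U (fun x => \sum_(i < p) g x 0 i * P i j).
  apply: smooth_on_sum => // i; apply: smooth_onM => //.
    exact: (@smooth_on_coord _ _ _ oU _ g).
  exact: smooth_on_cst.
by apply: smooth_on_eq => // x _; rewrite mxE.
Qed.

Lemma continuous_mulmxr p q (P : 'M[R]_(p, q)) :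
  continuous (fun v : 'rV[R]_p => v *m P).
Proof.
move=> v; have h := smooth_on_mulmx P (@openT _) (@smooth_on_id R _ [set: 'rV[R]_p]).
exact: smooth_on_continuous h _.
Qed.

Lemma jacobian_mulmxr p q (P : 'M[R]_(p, q)) x :
  'J (fun v : 'rV[R]_p => v *m P) x = P.
Proof.
have d1 : is_diff x (mulmxr P : {linear 'rV[R]_p -> 'rV[R]_q}) (mulmxr P).
  apply: DiffDef; first exact/linear_differentiable/continuous_mulmxr.
  by rewrite diff_lin //; exact: continuous_mulmxr.
apply/row_matrixP => i; rewrite rowE [RHS]rowE /jacobian mul_rV_lin1.
by rewrite (@diff_val _ _ _ _ _ _ _ d1).
Qed.

Lemma continuous_dotv (T : topologicalType) k (g h : T -> 'rV[R]_k) x :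
  {for x, continuous g} -> {for x, continuous h} ->
  {for x, continuous (fun y => dotv (g y) (h y))}.
Proof.
move=> cg ch; rewrite /dotv; elim: (index_enum _) => [|i r IH].
  rewrite (_ : (fun _ => _) = cst 0); first exact: cst_continuous.
  by apply/funext => y; rewrite big_nil.
rewrite (_ : (fun _ => _) =
    fun y => g y 0 i * h y 0 i + \sum_(j <- r) g y 0 j * h y 0 j).
  apply: continuousD IH; apply: continuousM.
    apply: (@continuous_comp _ _ _ g (fun v : 'rV[R]_k => v 0 i)) => //.
    exact: coord_continuous.
  apply: (@continuous_comp _ _ _ h (fun v : 'rV[R]_k => v 0 i)) => //.
  exact: coord_continuous.
by apply/funext => y; rewrite big_cons.
Qed.

Definition mod_chart c (W : set M) (L : 'M[R]_d) : chart R M d :=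
  Chart (chart_dom c `&` W) (fun x => chart_map c x *m L)
        (fun v => chart_inv c (v *m invmx L)).

Lemma mod_chart_id c : mod_chart c setT 1%:M = c.
Proof.
case: c => D f g; rewrite /mod_chart /= setIT; congr Chart.
  by apply/funext => x; rewrite mulmx1.
by apply/funext => x; rewrite invmx1 mulmx1.
Qed.

Lemma mod_chart_is_chart c W L : is_chart c -> open W -> L \in unitmx ->
  is_chart (mod_chart c W L).
Proof.
move=> cc oW uL; have [od _ cK cm ci] := cc.
have iE : chart_map (mod_chart c W L) @` chart_dom (mod_chart c W L) =
    (fun v => v *m invmx L) @^-1` (chart_map c @` (chart_dom c `&` W)).
  apply/seteqP; split=> [_ [x cx <-]|v [x cx xv]] /=.
    by rewrite mulmxK //; exists x.
  by exists x => //=; rewrite xv mulmxKV.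
split.
- exact: openI.
- rewrite iE; have /continuousP := @continuous_mulmxr _ _ (invmx L).
  by apply; exact: chart_image_open.
- by move=> x [cx _] /=; rewrite mulmxK // cK.
- move=> x [cx _]; apply: (@continuous_comp _ _ _ (chart_map c) (mulmxr L)).
    exact: cm.
  exact: continuous_mulmxr.
- move=> v; rewrite iE => -[x [cx _] xv].
  apply: (@continuous_comp _ _ _ (mulmxr (invmx L)) (chart_inv c)).
    exact: continuous_mulmxr.
  by apply: ci; exists x.
Qed.

(** All modifications are put into one smooth atlas, so that compatibility is established once for
    every oriented subfamily. *)
Definition mod_atlas B : set (chart R M d) :=
  [set e | exists c W L, [/\ B c, open W, L \in unitmx & e = mod_chart c W L]].

Lemma mod_atlas_sub B : B `<=` mod_atlas B.
Proof.
move=> c Bc; exists c, setT, 1%:M; split=> //; first exact: openT.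
  exact: unitmx1.
by rewrite mod_chart_id.
Qed.

Lemma smooth_mod_atlas B : smooth_atlas B -> smooth_atlas (mod_atlas B).
Proof.
move=> [Bch Bcov Bs]; split.
- by move=> _ [c [W [L [Bc oW uL ->]]]]; apply: mod_chart_is_chart => //; exact: Bch.
- by move=> x; have [c Bc cx] := Bcov x; exists c => //; exact: mod_atlas_sub.
move=> _ _ [c [W [L [Bc oW uL ->]]]] [c' [W' [L' [Bc' oW' uL' ->]]]].
have o1 : open (chart_map (mod_chart c W L) @`
    (chart_dom (mod_chart c W L) `&` chart_dom (mod_chart c' W' L'))).
  by apply: chart_overlap_open; apply: mod_chart_is_chart; auto.
apply: smooth_on_mulmx => //.
apply: (@smooth_on_comp _ _ _ o1 _ _
  (chart_map c @` (chart_dom c `&` chart_dom c')) (transition c c')).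
- by apply: chart_overlap_open; auto.
- by move=> _ [x [[? ?] [? ?]] <-] /=; rewrite mulmxK //; exists x.
- exact: Bs.
- by apply: smooth_on_mulmx => //; exact: smooth_on_id.
Qed.

End Orientation.

(* Restrict the charts to the open sets where they are positive with respect to
   the normal, and reflect them where they are negative. *)
Section OrientationOfNormal.
Context {R : realType} {M : topologicalType} {d k : nat}.
Variables (At : set (chart R M d)) (F G : M -> 'rV[R]_k).
Hypothesis kd : k = (d + 1)%N.
Hypothesis sAt : smooth_atlas At.
Hypothesis iF : smooth_immersion At F.

Lemma jacobian_mod_chart c (W : set M) (L : 'M[R]_d) x :
  At c -> L \in unitmx -> chart_dom c x ->
  'J (F \o chart_inv (mod_chart c W L)) (chart_map (mod_chart c W L) x) =
  invmx L *m 'J (F \o chart_inv c) (chart_map c x).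
Proof.
move=> Ac uL cx.
have e : chart_map c x *m L *m invmx L = chart_map c x by rewrite mulmxK.
have := @jacobian_comp R _ _ _ (F \o chart_inv c) (fun v => v *m invmx L)
  (chart_map c x *m L).
rewrite e jacobian_mulmxr; apply.
  apply: (smooth_on_differentiable (U := setT)) => //.
  by apply: smooth_on_mulmx; [exact: openT|exact: smooth_on_id].
exact: differentiable_in_chart iF.1 Ac cx.
Qed.

(** By [det_crossE] this is the determinant of the coordinate tangent vectors of [c] followed by
    [G x], whose sign compares [c] with the orientation that [G] defines. *)
Definition normal_sign (c : chart R M d) x : R :=
  dotv (cross ('J (F \o chart_inv c) (chart_map c x))) (G x).

Hypothesis cG : continuous G.
Hypothesis G1 : forall x, dotv (G x) (G x) = 1.
Hypothesis Gn : forall x, Defs.normal_space At F x (G x).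

Lemma row_free_immersion c x : At c -> chart_dom c x ->
  row_free ('J (F \o chart_inv c) (chart_map c x)).
Proof. by move=> Ac cx; apply/injective_jacobian; exact: iF.2. Qed.

(** Otherwise [G x] would be orthogonal to the tangent space and to the cross product, hence 0. *)
Lemma normal_sign_neq0 c x : At c -> chart_dom c x -> normal_sign c x != 0.
Proof.
move=> Ac cx; apply/eqP => s0.
have /(normal_spaceP (G x) sAt iF.1 Ac cx) Gv := @Gn x.
have c0 := cross_neq0 kd (row_free_immersion Ac cx).
have G0 : G x = 0 by apply: (orth_eq0 kd _ Gv c0); rewrite dotvC.
by have := G1 x; rewrite G0 dotv0l => /eqP; rewrite eq_sym oner_eq0.
Qed.

Lemma normal_sign_continuous c x : At c -> chart_dom c x ->
  {for x, continuous (normal_sign c)}.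
Proof.
move=> Ac cx; apply: continuous_dotv; last exact: cG.
have [Ach _ _] := sAt; have [_ oi _ cm _] := Ach _ Ac.
have := @continuous_comp _ _ _ (chart_map c)
  (fun v => cross ('J (F \o chart_inv c) v)) x (cm _ cx).
apply; apply: (smooth_on_continuous (U := chart_map c @` chart_dom c)).
  apply: smooth_on_cross => // i j; apply: smooth_on_jacobian => //.
  exact: iF.1.
by exists x.
Qed.

Lemma normal_sign_open c (P : R -> Prop) : At c -> open [set y | P y] ->
  open (chart_dom c `&` [set x | P (normal_sign c x)]).
Proof.
move=> Ac oP; have [Ach _ _] := sAt; have [od _ _ _ _] := Ach _ Ac.
rewrite openE => x [cx Px].
apply: filterI; first exact: open_nbhs_nbhs.
by apply: (normal_sign_continuous Ac cx); exact: open_nbhs_nbhs.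
Qed.

Lemma orientation_of_normal : (0 < d)%N ->
  exists O, orientation At O /\ gauss_map At O F G.
Proof.
move=> d0; have [Ach Acov As] := sAt.
pose i0 := Ordinal d0.
(* A reflection in one coordinate, which exists because [0 < d]. *)
pose L : 'M[R]_d := diag_mx (\row_j if j == i0 then -1 else 1).
have detL : \det L = -1.
  rewrite det_diag (bigD1 i0) //= mxE eqxx big1 ?mulr1 // => j /negPf ji.
  by rewrite mxE ji.
have uL : L \in unitmx by rewrite unitmxE detL unitrN1.
pose W c (P : R -> Prop) := chart_dom c `&` [set x | P (normal_sign c x)].
pose O : set (chart R M d) := [set e | exists2 c, At c &
  e = mod_chart c (W c (fun s => 0 < s)) 1%:M \/
  e = mod_chart c (W c (fun s => s < 0)) L].
have OB : At `|` O `<=` mod_atlas At.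
  move=> e [Ae|[c Ac [->|->]]]; first exact: mod_atlas_sub.
    exists c, (W c (fun s => 0 < s)), 1%:M; split=> //; last exact: unitmx1.
    by apply: normal_sign_open => //; exact: open_gt.
  exists c, (W c (fun s => s < 0)), L; split=> //.
  by apply: normal_sign_open => //; exact: open_lt.
have sB := smooth_mod_atlas sAt.
have Opos e x : O e -> chart_dom e x ->
    0 < dotv (cross ('J (F \o chart_inv e) (chart_map e x))) (G x).
  move=> [c Ac [->|->]] [cx [_ Wx]].
    rewrite jacobian_mod_chart ?unitmx1 // (cross_mul kd) dotvZl.
    by rewrite invmx1 det1 mul1r.
  rewrite jacobian_mod_chart // (cross_mul kd) dotvZl det_inv detL invrN1 mulN1r.
  by rewrite oppr_gt0.
have Ocov : covering O.
  move=> x; have [c Ac cx] := Acov x.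
  have := normal_sign_neq0 Ac cx; rewrite neq_lt => /orP [s0|s0].
    exists (mod_chart c (W c (fun s => s < 0)) L); last by split.
    by exists c => //; right.
  exists (mod_chart c (W c (fun s => 0 < s)) 1%:M); last by split.
  by exists c => //; left.
exists O; split; last first.
  split=> // e x Oe ex.
  by rewrite (det_crossE kd); exact: Opos.
split=> //.
  have [Bch Bcov Bs] := sB; split.
  - by move=> e /OB; exact: Bch.
  - by move=> x; have [c Ac cx] := Acov x; exists c => //; left.
  - by move=> c c' /OB Bc /OB Bc'; exact: Bs.
move=> c c' x Oc Oc' cx c'x.
have sFB : smooth_map (mod_atlas At) F.
  exact: smooth_map_sub sB Acov (@mod_atlas_sub _ _ _ At) iF.1.
have Bc : mod_atlas At c by apply: OB; right.
have Bc' : mod_atlas At c' by apply: OB; right.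
(* The signs of [c] and [c'] are both positive and differ by the determinant of the transition,
   which is therefore positive. *)
have := Opos _ _ Oc cx.
rewrite (jacobian_chart_change sB sFB Bc Bc' cx c'x) (cross_mul kd) dotvZl.
by rewrite pmulr_lgt0 //; exact: Opos.
Qed.

End OrientationOfNormal.

(** * Choice of the semicircles *)

(** The parameter ranges over a compact interval, which lets [semicircle_in] be studied by
    compactness. *)
Lemma cos_sin_surj (R : realType) (c s : R) : c ^+ 2 + s ^+ 2 = 1 ->
  exists t, [/\ - pi <= t <= pi, c = cos t & s = sin t].
Proof.
move=> cs; have c1 : -1 <= c <= 1.
  by rewrite -ler_norml -(@expr_le1 _ 2) // real_normK ?num_real //; nra.
have s2 : s ^+ 2 = 1 - c ^+ 2 by rewrite -cs; ring.
have := acos_ge0 c1; have := acos_lepi c1; have := pi_ge0 R => p0 a1 a0.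
have [s0|s0] := leP 0 s.
  exists (acos c); split; first lra.
    by rewrite acosK // in_itv.
  by rewrite sin_acos // -s2 sqrtr_sqr ger0_norm.
exists (- acos c); split; first lra.
  by rewrite cosN acosK // in_itv.
by rewrite sinN sin_acos // -s2 sqrtr_sqr ltr0_norm // opprK.
Qed.

Lemma unit_sphere_compact (R : realType) k : compact [set u : 'rV[R]_k | dotv u u = 1].
Proof.
apply: bounded_closed_compact.
  exists 1; split; first exact: num_real.
  move=> x x1 u u1; rewrite /Num.Def.normr /= mx_normrE.
  apply: bigmax_le => [|[i j] _]; first by rewrite (le_trans _ (ltW x1)).
  rewrite ord1 (le_trans _ (ltW x1)) // -(@expr_le1 _ 2) // real_normK ?num_real //=.
  by rewrite -u1 coord_sqr_le.
have -> : [set u : 'rV[R]_k | dotv u u = 1] = (fun u => dotv u u) @^-1` [set 1] by [].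
apply: preimage_closed; last exact: closed_eq.
by move=> u _; apply: continuous_dotv; exact: cvg_id.
Qed.

Section Equator.
Context {R : realType} {n : nat}.
Local Notation p := (@north_pole R n).
Implicit Types (u : 'rV[R]_n.+1) (U : set 'rV[R]_n.+1).

Definition equator : set 'rV[R]_n.+1 :=
  [set u | dotv u u = 1 /\ dotv u p = 0].

Lemma dotv_pole : dotv p p = 1.
Proof. by rewrite dotv_delta mxE !eqxx. Qed.

(* The closed semicircle centered at [(a u + b p) / |a u + b p|] of the great
   circle through [u] and [p] lies in [U]; for [a = b = 0] this is the whole
   great circle. *)
Definition semicircle_in U u (a b : R) :=
  forall c s, c ^+ 2 + s ^+ 2 = 1 -> 0 <= c * a + s * b -> U (c *: u + s *: p).

(** At a fixed angle, either the inequality fails strictly or the point lies in the open set [U];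
    both persist under small changes of all data. Compactness of the interval of angles makes this
    uniform. *)
Lemma semicircle_in_open U u a b : open U -> semicircle_in U u a b ->
  \forall z \near (u, (a, b)), semicircle_in U z.1 z.2.1 z.2.2.
Proof.
move=> oU Uab.
have /compact_near_coveringP cpt : compact `[- pi, (pi : R)] by exact: segment_compact.
have H : \forall z \near (u, (a, b)), `[- pi, (pi : R)] `<=`
    (fun t => 0 <= cos t * z.2.1 + sin t * z.2.2 ->
       U (cos t *: z.1 + sin t *: p)).
  apply: (cpt _ (nbhs (u, (a, b)))
    (fun z t => 0 <= cos t * z.2.1 + sin t * z.2.2 ->
       U (cos t *: z.1 + sin t *: p))) => t _.
  have ct : cos z.1 @[z --> (t, (u, (a, b)))] --> cos t.
    by apply: cvg_comp; [exact: cvg_fst|exact: continuous_cos].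
  have st : sin z.1 @[z --> (t, (u, (a, b)))] --> sin t.
    by apply: cvg_comp; [exact: cvg_fst|exact: continuous_sin].
  have cu : z.2.1 @[z --> (t, (u, (a, b)))] --> u.
    by apply: cvg_comp; [exact: cvg_snd|exact: cvg_fst].
  have ca : z.2.2.1 @[z --> (t, (u, (a, b)))] --> a.
    apply: cvg_comp; first by apply: cvg_comp; [exact: cvg_snd|exact: cvg_snd].
    exact: cvg_fst.
  have cb : z.2.2.2 @[z --> (t, (u, (a, b)))] --> b.
    apply: cvg_comp; first by apply: cvg_comp; [exact: cvg_snd|exact: cvg_snd].
    exact: cvg_snd.
  have [neg|pos] := ltP (cos t * a + sin t * b) 0.
    have h : cos z.1 * z.2.2.1 + sin z.1 * z.2.2.2 @[z --> (t, (u, (a, b)))]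
        --> cos t * a + sin t * b.
      exact: (cvgD (cvgM ct ca) (cvgM st cb)).
    have {}h : \forall z \near (t, (u, (a, b))),
      cos z.1 * z.2.2.1 + sin z.1 * z.2.2.2 < 0 := h _ (lt_nbhsl neg).
    by apply: filterS h => z z0; rewrite leNgt z0.
  have h : cos z.1 *: z.2.1 + sin z.1 *: p @[z --> (t, (u, (a, b)))]
      --> cos t *: u + sin t *: p.
    exact: (cvgD (cvgZ ct cu) (cvgZ st (cvg_cst p))).
  have Ut := Uab _ _ (cos2Dsin2 t) pos.
  have {}h : \forall z \near (t, (u, (a, b))),
    U (cos z.1 *: z.2.1 + sin z.1 *: p) := h _ (open_nbhs_nbhs (conj oU Ut)).
  by apply: filterS h => z ? _.
apply: filterS H => z Hz c s cs cs0.
have [t [tp ct st]] := cos_sin_surj cs.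
by subst c s; apply: (Hz t) => //=; rewrite in_itv.
Qed.

Lemma equator_compact : compact equator.
Proof.
have -> : equator = [set u : 'rV[R]_n.+1 | dotv u u = 1] `&`
    (fun u => dotv u p) @^-1` [set 0] by [].
apply: (compact_closedI (@unit_sphere_compact R n.+1)).
apply: preimage_closed; last exact: closed_eq.
by move=> u _; apply: continuous_dotv; [exact: cvg_id|exact: cst_continuous].
Qed.

(** Euclidean balls are wanted because, unlike the max norm, the squared Euclidean distance is
    smooth and can be fed to a bump function. *)
Lemma nbhs_dotv_ball u (V : set 'rV[R]_n.+1) : nbhs u V ->
  exists2 r, 0 < r & forall w, dotv (w - u) (w - u) < r -> V w.
Proof.
move=> /nbhs_ballP [e /= e0 eV]; exists (e ^+ 2); first exact: exprn_gt0.
move=> w wr; apply: eV; rewrite -ball_normE /= /Num.Def.normr /= mx_normrE.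
apply: bigmax_lt => // -[i j] _ /=; rewrite ord1.
rewrite -(@ltr_pXn2r _ 2) // ?nnegrE ?normr_ge0 ?ltW // real_normK ?num_real //.
apply: le_lt_trans wr; apply: le_trans (coord_sqr_le _ j).
by rewrite !mxE -sqrrN opprB.
Qed.

End Equator.

Lemma continuous_pair (T U V : topologicalType) (f : T -> U) (g : T -> V) x :
  {for x, continuous f} -> {for x, continuous g} ->
  {for x, continuous (fun y => (f y, g y))}.
Proof. by move=> cf cg; exact: (cvg_pair cf cg). Qed.

(** * Gluing local choices of centers *)

Section Selection.
Context {R : realType} {n : nat}.
Local Notation p := (@north_pole R n).
Implicit Types (u : 'rV[R]_n.+1) (U : set 'rV[R]_n.+1).

(** If [c * a i + s * b i] were negative whenever [w i] is positive, the term [i0] would make the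
    whole sum negative. *)
Lemma semicircle_in_sum U u (I : eqType) (r : seq I) (w a b : I -> R) i0 :
  i0 \in r -> 0 < w i0 -> (forall i, 0 <= w i) ->
  (forall i, i \in r -> 0 < w i -> semicircle_in U u (a i) (b i)) ->
  semicircle_in U u (\sum_(i <- r) w i * a i) (\sum_(i <- r) w i * b i).
Proof.
move=> i0r wi0 w0 ab c s cs.
rewrite !mulr_sumr -big_split /= => sum0.
have [[i [ir wi abi]]|none] := pselect (exists i, [/\ i \in r, 0 < w i &
    0 <= c * a i + s * b i]).
  exact: ab ir wi _ _ cs abi.
have neg i : i \in r -> 0 < w i -> c * a i + s * b i < 0.
  by move=> ir wi; rewrite ltNge; apply/negP => h; apply: none; exists i.
exfalso; move: sum0; rewrite leNgt => /negP; apply.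
rewrite (big_rem i0) //= -[ltRHS]addr0.
have -> : c * (w i0 * a i0) + s * (w i0 * b i0) =
  w i0 * (c * a i0 + s * b i0) by ring.
apply: ltr_leD; first by rewrite pmulr_rlt0 // neg.
rewrite big_seq; apply: sumr_le0 => i /mem_rem ir.
have -> : c * (w i * a i) + s * (w i * b i) = w i * (c * a i + s * b i) by ring.
have [wi|wi] := ltP 0 (w i); first by rewrite pmulr_rle0 // ltW // neg.
by have -> : w i = 0 by [apply/eqP; rewrite eq_le wi w0]; rewrite mul0r.
Qed.

(** The last clause serves alternative (i): if all local centers lie strictly on the side of the
    pole, so does the glued one. *)
Lemma smooth_section U (sel : 'rV[R]_n.+1 -> R * R) : open U ->
  (forall u, equator u -> semicircle_in U u (sel u).1 (sel u).2) ->
  exists a b : 'rV[R]_n.+1 -> R, [/\ smooth_on setT a, smooth_on setT b &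
    forall u, equator u -> semicircle_in U u (a u) (b u) /\
      ((forall u, equator u -> 0 < (sel u).2) -> 0 < b u)].
Proof.
move=> oU selU.
have rad u : exists r : R, equator u -> 0 < r /\ forall w,
    dotv (w - u) (w - u) < r -> semicircle_in U w (sel u).1 (sel u).2.
  have [eu|] := pselect (equator u); last by exists 0.
  have nu : \forall w \near u, semicircle_in U w (sel u).1 (sel u).2.
    have h : (w, ((sel u).1, (sel u).2)) @[w --> u] --> (u, ((sel u).1, (sel u).2)).
      by apply: continuous_pair; [exact: cvg_id|exact: cst_continuous].
    exact: (h _ (semicircle_in_open oU (selU _ eu))).
  by have [r r0 ur] := nbhs_dotv_ball nu; exists r.
have [r rP] := choice rad.
have sd u : smooth_on setT (fun w : 'rV[R]_n.+1 => dotv (w - u) (w - u)).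
  have sub : smooth_on setT (fun v : 'rV[R]_n.+1 => v - u).
    by apply: smooth_onD; [exact: openT|exact: smooth_on_id|exact: smooth_on_cst].
  by apply: smooth_on_dotv => //; exact: openT.
have cd u : continuous (fun w : 'rV[R]_n.+1 => dotv (w - u) (w - u)).
  by move=> w; apply: (smooth_on_continuous (sd u)).
have := @equator_compact R n; rewrite compact_cover.
move=> /(_ _ equator (fun u => [set w | dotv (w - u) (w - u) < r u])).
case.
- move=> u _; have /continuousP := cd u; by move=> /(_ _ (@open_lt _ (r u))).
- by move=> u eu; exists u => //=; rewrite subrr dotv0l; exact: (rP _ eu).1.
move=> D De Dcov.
(* Positive exactly on the ball where the choice made at [u] remains admissible. The weights are
   left unnormalized since admissible pairs form a cone. *)
pose w u v := flat_fun 1 (r u - dotv (v - u) (v - u)).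
have sw u : smooth_on setT (w u).
  apply: (@smooth_on_comp_real _ _ _ openT setT (flat_fun 1)) => //.
    exact: smooth_flat.
  apply: smooth_onD => //; first exact: openT.
    exact: smooth_on_cst.
  apply: smooth_onN => //; first exact: openT.
exists (fun v => \sum_(u <- enum_fset D) w u v * (sel u).1).
exists (fun v => \sum_(u <- enum_fset D) w u v * (sel u).2).
split.
- apply: smooth_on_sum => [|u]; first exact: openT.
  by apply: smooth_onM; [exact: openT|exact: sw|exact: smooth_on_cst].
- apply: smooth_on_sum => [|u]; first exact: openT.
  by apply: smooth_onM; [exact: openT|exact: sw|exact: smooth_on_cst].
move=> v ev; have [u uD uv] := Dcov _ ev.
have wu : 0 < w u v by rewrite flat_fun_gt0 subr_gt0.
have wge0 u' : 0 <= w u' v by exact: flat_fun_ge0.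
have Dr u' : u' \in enum_fset D -> equator u' by move=> /De /set_mem.
split.
  apply: (@semicircle_in_sum U v _ (enum_fset D) (w ^~ v) _ _ u) => //.
  move=> u' u'D; rewrite flat_fun_gt0 subr_gt0.
  exact: (rP _ (Dr _ u'D)).2.
move=> b0; rewrite (big_rem u) //= ltr_wpDr //; last first.
  by apply: mulr_gt0 => //; apply/b0/Dr.
rewrite big_seq; apply: sumr_ge0 => u' /mem_rem u'D.
by apply: mulr_ge0 => //; apply/ltW/b0/Dr.
Qed.

End Selection.

(** * Removing zeros in the case n = 2 *)

Section Perturbation.
Context {R : realType}.

(** Compactness of the equator makes the openness of admissibility uniform, so one and the same
    small vector can be subtracted everywhere. *)
Lemma semicircle_in_perturb n (U : set 'rV[R]_n.+1) (a b : 'rV[R]_n.+1 -> R) :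
  open U -> smooth_on setT a -> smooth_on setT b ->
  (forall u, equator u -> semicircle_in U u (a u) (b u)) ->
  exists2 e : R, 0 < e & forall v w, `|v| < e -> `|w| < e ->
    forall u, equator u -> semicircle_in U u (a u - v) (b u - w).
Proof.
move=> oU sa sb ab.
have /compact_near_coveringP cpt := @equator_compact R n.
have : \forall v \near ((0 : R), (0 : R)), @equator R n `<=`
    (fun u => semicircle_in U u (a u - v.1) (b u - v.2)).
  apply: (cpt _ (nbhs ((0 : R), (0 : R)))
    (fun v u => semicircle_in U u (a u - v.1) (b u - v.2))) => u eu.
  have h : {for (u, (0, 0)), continuous (fun z : 'rV[R]_n.+1 * (R * R) =>
      (z.1, (a z.1 - z.2.1, b z.1 - z.2.2)))}.
    have c1 : {for (u, (0, 0)), continuous (fun z : 'rV[R]_n.+1 * (R * R) => z.1)}.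
      exact: cvg_fst.
    have c21 : {for (u, (0, 0)), continuous (fun z : 'rV[R]_n.+1 * (R * R) => z.2.1)}.
      apply: (@continuous_comp _ _ _ (@snd 'rV[R]_n.+1 (R * R)) (@fst R R)).
        exact: cvg_snd.
      exact: cvg_fst.
    have c22 : {for (u, (0, 0)), continuous (fun z : 'rV[R]_n.+1 * (R * R) => z.2.2)}.
      apply: (@continuous_comp _ _ _ (@snd 'rV[R]_n.+1 (R * R)) (@snd R R)).
        exact: cvg_snd.
      exact: cvg_snd.
    apply: continuous_pair => //; apply: continuous_pair.
      apply: (@continuousB _ _ _ (fun z : 'rV[R]_n.+1 * (R * R) => a z.1)) => //.
      apply: (@continuous_comp _ _ _ (@fst 'rV[R]_n.+1 (R * R)) a) => //.
      exact: (smooth_on_continuous sa).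
    apply: (@continuousB _ _ _ (fun z : 'rV[R]_n.+1 * (R * R) => b z.1)) => //.
    apply: (@continuous_comp _ _ _ (@fst 'rV[R]_n.+1 (R * R)) b) => //.
      exact: (smooth_on_continuous sb).
  have := ab _ eu; rewrite -[a u]subr0 -[b u]subr0 => /(semicircle_in_open oU) near0.
  exact: (h _ near0).
move=> /nbhs_ballP [e /= e0 He]; exists e => // v w ve we u eu.
apply: (He (v, w)) => //; split; rewrite /= /ball /= sub0r normrN //.
Qed.

Lemma smooth_lipschitz (g : R -> R) (x y : R) : x <= y -> smooth_on setT g ->
  exists2 L, 0 <= L & forall s t, x <= s <= y -> x <= t <= y ->
    `|g t - g s| <= L * `|t - s|.
Proof.
move=> xy sg.
have cD : continuous (fun t => `|'D_1 g t|).
  move=> t; apply: (@continuous_comp _ _ _ ('D_1 g) Num.Def.normr).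
    by apply: (smooth_on_continuous (smooth_on_derive (1 : R) sg)).
  exact: norm_continuous.
have [c _ cmax] := EVT_max xy (continuous_subspaceT cD).
exists `|'D_1 g c| => //.
have gd (t : R) : is_derive t 1 g ('D_1 g t).
  by apply: derivableP; apply: diff_derivable; exact: (smooth_on_differentiable sg).
have main s t : x <= s -> s <= t -> t <= y -> `|g t - g s| <= `|'D_1 g c| * `|t - s|.
  move=> xs st ty.
  have [|t0 t0st ->] := @MVT_segment _ g ('D_1 g) s t st (fun t _ => gd t).
    apply: continuous_subspaceT => t0; exact: (smooth_on_continuous sg).
  rewrite normrM ler_wpM2r // cmax //.
  by move: t0st; rewrite !in_itv /= => /andP[? ?]; lra.
move=> s t /andP[xs sy] /andP[xt ty].
have [st|/ltW ts] := leP s t; first exact: main.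
by rewrite distrC [X in _ * X]distrC; exact: main.
Qed.

(* Pigeonhole: two of the [N ^ 2] points of a grid would come from one of the
   [N ^ 2 - 1] subintervals of [[x, y]]. *)
Lemma lipschitz_curve_avoids (g h : R -> R) (x y L e : R) :
  x < y -> 0 <= L -> 0 < e ->
  (forall s t, x <= s <= y -> x <= t <= y -> `|g t - g s| <= L * `|t - s|) ->
  (forall s t, x <= s <= y -> x <= t <= y -> `|h t - h s| <= L * `|t - s|) ->
  exists v w, [/\ `|v| < e, `|w| < e &
    forall t, x <= t <= y -> ~ (g t = v /\ h t = w)].
Proof.
move=> xy L0 e0 gL hL; apply: contrapT => none.
have {}none v w : `|v| < e -> `|w| < e ->
    exists t, [/\ x <= t <= y, g t = v & h t = w].
  move=> ve we; apply: contrapT => no; apply: none; exists v, w; split=> // t xty.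
  by move=> [gt ht]; apply: no; exists t.
(* Grid points in the same class have parameters less than (y - x) / K apart, so their coordinates
   differ by at most L (y - x) / K. As [2 <= N] gives K >= N^2 / 2, this is at most 2 L (y - x) /
   N^2, which is below the mesh e / N by the choice of [N]. *)
pose N := (Num.bound (2 * (y - x) * L / e)).+2.
pose K := (N * N - 2)%N.
have N2 : (2 <= N)%N by [].
have KN : (N * N <= 2 * K)%N by rewrite /K; nia.
have NK : (K.+1 < N * N)%N by rewrite /K; nia.
have K0 : (0 < K)%N by rewrite /K; nia.
have N0R : 0 < N%:R :> R by rewrite ltr0n.
have K0R : 0 < K%:R :> R by rewrite ltr0n.
have hN : 2 * (y - x) * L < e * N%:R.
  have X0 : 0 <= 2 * (y - x) * L / e.
    apply: divr_ge0; last exact: ltW.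
    by apply: mulr_ge0 => //; lra.
  have := archi_boundP X0; rewrite ltr_pdivrMr // [ltRHS]mulrC => /lt_le_trans; apply.
  rewrite ler_wpM2l ?ler_nat ?ltW //; exact: (leq_trans (leqnSn _) (leqnSn _)).
clearbody K; clearbody N.
have grid (ij : 'I_N * 'I_N) : exists t, [/\ x <= t <= y,
    g t = e * (ij.1%:R / N%:R) & h t = e * (ij.2%:R / N%:R)].
  have lt (i : 'I_N) : `|e * (i%:R / N%:R)| < e.
    rewrite ger0_norm; last first.
      by apply: mulr_ge0; [exact: ltW|exact: divr_ge0].
    by rewrite gtr_pMr // ltr_pdivrMr // mul1r ltr_nat.
  exact: none.
have [t tP] := choice grid.
pose z ij := (t ij - x) / (y - x) * K%:R.
have yx : 0 < y - x by rewrite subr_gt0.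
have z0 ij : 0 <= z ij <= K%:R.
  have [/andP[xt ty] _ _] := tP ij; apply/andP; split.
    by apply: mulr_ge0 => //; apply: divr_ge0; lra.
  apply: ler_piMl; first exact: ltW.
  by rewrite ler_pdivrMr // mul1r; lra.
(* [z] takes values in [0, K] with both ends allowed, hence K + 1 classes, the last one for the end
   point alone. *)
pose f ij : 'I_K.+1 := inord (Num.truncn (z ij)).
have fE ij : f ij = Num.truncn (z ij) :> nat.
  rewrite inordK // ltnS -(ler_nat R); have /andP[z1 z2] := z0 ij.
  by apply: le_trans z2; have /andP[] := truncn_itv z1.
have : ~~ injectiveb f.
  apply/negP => /injectiveP /leq_card; rewrite card_prod !card_ord.
  by rewrite leqNgt NK.
move=> /injectivePn [ij [kl neq fij]].
have zz : `|z ij - z kl| < 1.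
  have /andP[z1 z2] := truncn_itv (andP (z0 ij)).1.
  have /andP[z3 z4] := truncn_itv (andP (z0 kl)).1.
  move: z1 z2; rewrite -fE fij fE => z1 z2.
  rewrite ltr_norml; move: z2 z4; rewrite -natr1; lra.
have tt : `|t ij - t kl| * K%:R < y - x.
  have -> : `|t ij - t kl| * K%:R = `|z ij - z kl| * (y - x).
    rewrite -[K%:R]ger0_norm ?ltW // -normrM -[in RHS](ger0_norm (ltW yx)) -normrM.
    by congr `|_|; rewrite /z; field; rewrite gt_eqF.
  by rewrite gtr_pMl.
have small (i j : 'I_N) :
    `|e * (i%:R / N%:R) - e * (j%:R / N%:R)| <= L * `|t ij - t kl| -> i = j.
  move=> d; apply/eqP; apply: contraT => ij'.
  have : 1 <= `|i%:R - j%:R : R|.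
    have : (1 <= `|(i%:Z - j%:Z)%R|)%R.
      by move: ij'; rewrite -val_eqE /=; clear; lia.
    by rewrite -(ler_int R) intr_norm intrB.
  move=> one.
  have : e <= L * `|t ij - t kl| * N%:R.
    apply: le_trans (ler_wpM2r (ltW N0R) d).
    rewrite -mulrBr -mulrBl normrM (gtr0_norm e0) normrM normfV (gtr0_norm N0R).
    by rewrite -mulrA divfK ?gt_eqF // ler_peMr // ltW.
  move=> eN.
  have : e * K%:R <= L * (y - x) * N%:R.
    apply: (le_trans (ler_wpM2r (ltW K0R) eN)).
    have -> : L * `|t ij - t kl| * N%:R * K%:R =
      L * N%:R * (`|t ij - t kl| * K%:R) by ring.
    have -> : L * (y - x) * N%:R = L * N%:R * (y - x) by ring.
    by apply: ler_wpM2l; [apply: mulr_ge0 => //; exact: ltW|exact: ltW].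
  have : e * N%:R * N%:R <= 2 * e * K%:R.
    have -> : 2 * e * K%:R = e * (2 * K)%:R by rewrite natrM; ring.
    have -> : e * N%:R * N%:R = e * (N * N)%:R by rewrite natrM; ring.
    by apply: ler_wpM2l; [exact: ltW|rewrite ler_nat].
  move=> h1 h2.
  have : e * N%:R <= 2 * L * (y - x).
    rewrite -(ler_pM2r N0R); lra.
  lra.
have [tij gij hij] := tP ij; have [tkl gkl hkl] := tP kl.
move: neq; rewrite [ij]surjective_pairing [kl]surjective_pairing.
rewrite (small ij.1 kl.1); last by rewrite -gij -gkl; exact: gL.
rewrite (small ij.2 kl.2); last by rewrite -hij -hkl; exact: hL.
by rewrite eqxx.
Qed.

End Perturbation.

Section CenterField.
Context {R : realType}.

Definition pole_circle n (u : 'rV[R]_n.+1) : set 'rV[R]_n.+1 :=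
  sphere `&` [set x | x \in <<[:: u; north_pole n]>>%VS].

Lemma pole_circleP n (u x : 'rV[R]_n.+1) :
  (x \in <<[:: u; north_pole n]>>%VS) <->
  exists a b, x = a *: u + b *: north_pole n.
Proof.
rewrite span_cons span_seq1; split.
  by move=> /memv_addP [_ /vlineP [a ->] [_ /vlineP [b ->] ->]]; exists a, b.
move=> [a [b ->]]; apply: memv_add; exact/memvZ/memv_line.
Qed.

Lemma dotv_equator n (u : 'rV[R]_n.+1) a b c d : equator u ->
  dotv (a *: u + b *: north_pole n) (c *: u + d *: north_pole n) = a * c + b * d.
Proof.
move=> [u1 u0]; rewrite !dotv_lin u1 u0 dotv_pole (dotvC _ u) u0; ring.
Qed.

Lemma pole_circle_great n (u : 'rV[R]_n.+1) : equator u ->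
  great_circle (pole_circle u) /\ pole_circle u (north_pole n).
Proof.
move=> [u1 u0]; split.
  exists <<[:: u; north_pole n]>>%VS => //.
  have /eqP -> // : free [:: u; north_pole n].
  have p0 : north_pole n != 0 :> 'rV[R]_n.+1.
    by rewrite -dotv_eq0 dotv_pole oner_eq0.
  rewrite free_cons span_seq1 seq1_free p0 andbT.
  apply/negP => /vlineP [k uk]; move: u0 u1; rewrite uk dotvZl dotv_pole mulr1.
  by move=> ->; rewrite scale0r dotv0l => /eqP; rewrite eq_sym oner_eq0.
split; first exact: dotv_pole.
by apply/pole_circleP; exists 0, 1; rewrite scale0r scale1r add0r.
Qed.

Lemma semicircle_inP n (A U : set 'rV[R]_n.+1) u a b :
  A `<=` U -> equator u ->
  semicircle (pole_circle u) (a *: u + b *: north_pole n) `<=` A ->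
  semicircle_in U u a b.
Proof.
move=> AU eu sA c s cs cs0; apply/AU/sA; split.
  split; last by apply/pole_circleP; exists c, s.
  by rewrite /sphere /= dotv_equator // -!expr2.
by rewrite dotv_equator // (mulrC a) (mulrC b).
Qed.

Lemma equator_curve (u : 'rV[R]_3) : equator u ->
  exists t, - pi <= t <= pi /\
    u = cos t *: delta_mx 0 0 + sin t *: delta_mx 0 (inord 1).
Proof.
move=> [u1 u0]; move: u0; rewrite dotv_delta => u0.
have : u 0 0 ^+ 2 + u 0 (inord 1) ^+ 2 = 1.
  rewrite -u1 /dotv !big_ord_recr big_ord0 /= add0r u0 mulr0 addr0 !expr2.
  by congr (u _ _ * u _ _ + u _ _ * u _ _); apply/val_inj; rewrite /= ?inordK.
move=> /cos_sin_surj [t [tp c s]]; exists t; split=> //.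
apply/rowP => j; rewrite !mxE /= -c -s -!val_eqE /= inordK //.
case: j => -[|[|[|//]]] j3 /=; rewrite ?(mulr1, mulr0, addr0, add0r).
- by congr (u _ _); exact: val_inj.
- by congr (u _ _); apply: val_inj; rewrite /= inordK.
- by rewrite -u0; congr (u _ _); exact: val_inj.
Qed.

Lemma exists_center_field (n : nat) (n_ge2 : (2 <= n)%N)
    (A : set 'rV[R]_n.+1) (A_open : open_in_sphere A)
    (A_semicircle : forall C : set 'rV[R]_n.+1,
      great_circle C -> C (north_pole n) ->
      exists2 x, C x & semicircle C x `<=` A)
    (A_alternative : (3 <= n)%N ->
      (forall C : set 'rV[R]_n.+1, great_circle C -> C (north_pole n) ->
        exists x, [/\ C x, semicircle C x `<=` A &
                      semicircle C x (north_pole n)])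
      \/
      (forall C : set 'rV[R]_n.+1, great_circle C -> C (north_pole n) ->
        ~ (C `<=` A))) :
  exists U a b, [/\ open U, A = U `&` sphere,
    smooth_on setT a, smooth_on setT b &
    forall u, equator u -> semicircle_in U u (a u) (b u) /\
                           0 < a u ^+ 2 + b u ^+ 2].
Proof.
have [U oU AU] := A_open; exists U.
have AsubU : A `<=` U by rewrite AU => x [].
have selP u : exists ab : R * R, equator u -> semicircle_in U u ab.1 ab.2.
  have [eu|] := pselect (equator u); last by exists (0, 0).
  have [gC Cp] := pole_circle_great eu.
  have [x [x1 /pole_circleP [a [b xE]]] xA] := A_semicircle _ gC Cp.
  by exists (a, b) => _; apply: (semicircle_inP AsubU) => //=; rewrite -xE.
have [sel {}selP] := choice selP.
have [a [b [sa sb ab]]] := smooth_section oU selP.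
(* In each case below it remains to exclude the second alternative for the center. *)
have sq0 (x y : R) : 0 < x ^+ 2 + y ^+ 2 \/ x = 0 /\ y = 0.
  have [->|x0] := eqVneq x 0; last first.
    by left; rewrite ltr_pwDl ?sqr_ge0 // exprn_even_gt0.
  have [->|y0] := eqVneq y 0; first by right.
  by left; rewrite ltr_wpDl ?sqr_ge0 // exprn_even_gt0.
have [n2|n3] := leqP n 2.
  have {n2 n_ge2} n2 : n = 2%N by apply/eqP; rewrite eqn_leq n2.
  subst n.
  have [e e0 He] := semicircle_in_perturb oU sa sb (fun u eu => (ab u eu).1).
  pose g (t : R) : 'rV[R]_3 := cos t *: delta_mx 0 0 + sin t *: delta_mx 0 (inord 1).
  have sg : smooth_on setT g.
    apply: smooth_onD; first exact: openT.
      by apply: smooth_onZ; [exact: openT|exact: smooth_cos|exact: smooth_on_cst].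
    by apply: smooth_onZ; [exact: openT|exact: smooth_sin|exact: smooth_on_cst].
  have pp : - pi <= pi :> R by have := pi_ge0 R; lra.
  have pp' : - pi < pi :> R by have := pi_gt0 R; lra.
  have sag : smooth_on setT (fun t => a (g t)).
    exact: (smooth_on_comp_scalar openT (U' := setT)).
  have sbg : smooth_on setT (fun t => b (g t)).
    exact: (smooth_on_comp_scalar openT (U' := setT)).
  have [La La0 HLa] := smooth_lipschitz pp sag.
  have [Lb Lb0 HLb] := smooth_lipschitz pp sbg.
  have [|s t sp tp|s t sp tp|v [w [ve we vw]]] := @lipschitz_curve_avoids R
    (fun t => a (g t)) (fun t => b (g t)) _ _ (La + Lb) e pp' _ e0.
  - exact: addr_ge0.
  - by apply: le_trans (HLa _ _ sp tp) _; apply: ler_wpM2r => //; lra.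
  - by apply: le_trans (HLb _ _ sp tp) _; apply: ler_wpM2r => //; lra.
  exists (fun u => a u - v), (fun u => b u - w); split=> //.
  - by apply: smooth_onD; [exact: openT| |exact: smooth_on_cst].
  - by apply: smooth_onD; [exact: openT| |exact: smooth_on_cst].
  move=> u eu; split; first exact: He.
  have [//|[av bw]] := sq0 (a u - v) (b u - w).
  have [t [tp ut]] := equator_curve eu.
  case: (vw t tp); rewrite /g -ut; split; lra.
have [h|h] := A_alternative n3; last first.
  exists a, b; split=> // u eu; split; first exact: (ab _ eu).1.
  have [//|[a0 b0]] := sq0 (a u) (b u).
  have [gC Cp] := pole_circle_great eu.
  case: (h _ gC Cp) => y [y1 /pole_circleP [c [s ycs]]].
  rewrite AU; split=> //; rewrite ycs; apply: (ab _ eu).1.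
    by rewrite !expr2 -(dotv_equator _ _ _ _ eu) -ycs.
  by rewrite a0 b0 !mulr0 addr0.
(* The semicircle contains the pole exactly when its center has [0 <= s]. Openness allows [s] to be
   raised a little, which makes it strictly positive. *)
have selP' u : exists ab : R * R,
    equator u -> semicircle_in U u ab.1 ab.2 /\ 0 < ab.2.
  have [eu|] := pselect (equator u); last by exists (0, 0).
  have [gC Cp] := pole_circle_great eu.
  have [x [[x1 /pole_circleP [c [s xE]]] xA [_ xp]]] := h _ gC Cp.
  have s0 : 0 <= s.
    move: xp; rewrite xE -[X in dotv _ X](scale1r _) -[X in dotv _ X]add0r.
    by rewrite -(scale0r u) dotv_equator // mulr0 add0r mulr1.
  have Ucs : semicircle_in U u c s by apply: (semicircle_inP AsubU) => //; rewrite -xE.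
  have c1 : {for s, continuous (fun b : R => (u, (c, b)))}.
    apply: continuous_pair; first exact: cst_continuous.
    by apply: continuous_pair; [exact: cst_continuous|exact: cvg_id].
  have : \forall b \near s, semicircle_in U u c b.
    exact: (c1 _ (semicircle_in_open oU Ucs)).
  move=> /nbhs_ballP [e /= e0 He]; exists (c, s + e / 2) => _ /=; split.
    by apply: He; rewrite /ball /= opprD addNKr normrN gtr0_norm; lra.
  lra.
have [sel' {}selP'] := choice selP'.
have [a' [b' [sa' sb' ab']]] := smooth_section oU (fun u eu => (selP' u eu).1).
exists a', b'; split=> // u eu; have [h1 h2] := ab' _ eu; split=> //.
have b0 : 0 < b' u by apply: h2 => u' eu'; exact: (selP' _ eu').2.
by rewrite ltr_wpDl ?sqr_ge0 // exprn_gt0.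
Qed.

End CenterField.

(** * The adapted frame *)

Section Normalize.
Context {R : realType} {k : nat}.
Implicit Types w : 'rV[R]_k.

(** Written with a real power so that [smooth_powR] gives smoothness away from 0. *)
Definition normalize w : 'rV[R]_k := (dotv w w `^ (- 2^-1)) *: w.

Lemma powR_inv_sqrt (x : R) : 0 < x -> (x `^ (- 2^-1)) ^+ 2 * x = 1.
Proof.
move=> x0; rewrite powRN powR12_sqrt ?ltW // exprVn sqr_sqrtr ?ltW //.
by rewrite mulVf ?gt_eqF.
Qed.

Lemma normalize_unit w : w != 0 -> dotv (normalize w) (normalize w) = 1.
Proof.
by rewrite -dotv_gt0 => w0; rewrite !dotv_lin mulrA -expr2 powR_inv_sqrt.
Qed.

Lemma normalizeZ (l : R) w : 0 < l -> normalize (l *: w) = normalize w.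
Proof.
move=> l0; rewrite /normalize !dotv_lin scalerA mulrA -expr2; congr (_ *: _).
rewrite powRM ?sqr_ge0 ?dotv_ge0 // mulrAC powRN powR12_sqrt ?sqr_ge0 //.
by rewrite sqrtr_sqr gtr0_norm // mulVf ?gt_eqF // mul1r.
Qed.

Lemma smooth_on_normalize (V : normedModType R) (U : set V) (g : V -> 'rV[R]_k) :
  open U -> (forall x, U x -> g x != 0) -> smooth_on U g ->
  smooth_on U (fun x => normalize (g x)).
Proof.
move=> oU g0 gs; apply: smooth_onZ => //.
apply: (smooth_on_comp_real oU (U' := [set x : R | 0 < x])
  (g := fun x => x `^ (- 2^-1)) (h := fun x => dotv (g x) (g x))).
- by move=> x Ux /=; rewrite dotv_gt0 g0.
- exact: smooth_powR.
- exact: smooth_on_dotv.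
Qed.

End Normalize.

Section UnitNormal.
Context {R : realType} {m : nat} {M : topologicalType}.
Variables (At : set (chart R M m)) (f : M -> 'rV[R]_m.+2).
Hypothesis sAt : smooth_atlas At.
Hypothesis iF : smooth_immersion At f.
Hypothesis f0 : forall q, f q 0 ord_max = 0.
Local Notation p := (@north_pole R m.+1).

Let jac (c : chart R M m) q := 'J (f \o chart_inv c) (chart_map c q).

Lemma horizontal_jacobian (c : chart R M m) x v :
  differentiable (f \o chart_inv c) x ->
  dotv (v *m 'J (f \o chart_inv c) x) p = 0.
Proof.
move=> df; rewrite dotv_delta mxE big1 // => i _; rewrite jacobianE //.
rewrite (derive_mx (@diff_derivable _ _ _ _ _ (delta_mx 0 i) df)) mxE.
rewrite (_ : (fun t => _) = cst 0) ?derive_cst ?mulr0 //.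
by apply/funext => t; exact: f0.
Qed.

Let dimE : m.+2 = (m + 1 + 1)%N. Proof. by rewrite !addn1. Qed.

(** The pole supplies the missing row: [cross] needs m + 1 rows in dimension m + 2, and the result
    is then horizontal. *)
Definition raw_normal (J : 'M[R]_(m, m.+2)) : 'rV[R]_m.+2 :=
  cross (col_mx J p).

Lemma raw_normal_orth J v : dotv (raw_normal J) (v *m J) = 0.
Proof.
have := cross_orth dimE (col_mx J p) (row_mx v 0).
by rewrite mul_row_col mul0mx addr0.
Qed.

Lemma raw_normal_pole J : dotv (raw_normal J) p = 0.
Proof.
have := cross_orth dimE (col_mx J p) (row_mx 0 1%:M).
by rewrite mul_row_col mul0mx mul1mx add0r.
Qed.

Lemma raw_normal_mul (P : 'M[R]_m) J :
  raw_normal (P *m J) = \det P *: raw_normal J.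
Proof.
rewrite /raw_normal.
have -> : col_mx (P *m J) p = block_mx P 0 0 1%:M *m col_mx J p.
  by rewrite mul_block_col !mul0mx mul1mx addr0 add0r.
by rewrite (cross_mul dimE) det_ublock det1 mulr1.
Qed.

Lemma raw_normal_neq0 J : row_free J -> (forall v, dotv (v *m J) p = 0) ->
  raw_normal J != 0.
Proof.
move=> /row_freeP [J' JJ'] Jp; apply: (cross_neq0 dimE).
rewrite -kermx_eq0; apply/rowV0P => v /sub_kermxP.
rewrite -[v]hsubmxK mul_row_col [rsubmx v]mx11_scalar mul_scalar_mx.
set s := rsubmx v 0 0 => e.
have s0 : s = 0.
  have := congr1 (fun w => dotv w p) e.
  by rewrite !dotv_lin Jp add0r dotv_pole mulr1.
move: e; rewrite s0 scale0r addr0 => e.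
by rewrite -[lsubmx v]mulmx1 -JJ' mulmxA e mul0mx raddf0 row_mx0.
Qed.

(** Between charts of an oriented atlas [raw_normal] is multiplied by a positive determinant, which
    normalization removes. The value at a point is thus independent of the chart, and an arbitrary
    choice of charts still yields a smooth field. *)
Lemma exists_unit_normal : orientable At ->
  exists nu : M -> 'rV[R]_m.+2, [/\ smooth_map At nu,
    forall q, equator (nu q) &
    forall q y, Defs.normal_space At f q y <->
      exists a b, y = a *: nu q + b *: p].
Proof.
move=> [ O [sB Ocov Opos]]; have [Bch Bcov Bs] := sB.
have [_ Acov _] := sAt.
have OB : O `<=` At `|` O by move=> c; right.
have AB : At `<=` At `|` O by move=> c; left.
have fB : smooth_map (At `|` O) f := smooth_map_sub sB Acov AB iF.1.
have fO c q : O c -> chart_dom c q -> row_free (jac c q).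
  move=> Oc cq; have [c' Ac' c'q] := Acov q.
  apply: (row_free_chart_change sB fB (AB _ Ac') (OB _ Oc) c'q cq).
  by apply/injective_jacobian; exact: iF.2.
have dO c q : O c -> chart_dom c q ->
    differentiable (f \o chart_inv c) (chart_map c q).
  by move=> /OB Bc; exact: differentiable_in_chart fB Bc.
have [cc ccP] : exists cc : M -> chart R M m,
    forall q, O (cc q) /\ chart_dom (cc q) q.
  have [q|cc ccP] := @choice _ _ (fun q c => O c /\ chart_dom c q); last by exists cc.
  by have [c Oc cq] := Ocov q; exists c.
pose nu q := normalize (raw_normal (jac (cc q) q)).
have nuE c q : O c -> chart_dom c q -> nu q = normalize (raw_normal (jac c q)).
  move=> Oc cq; have [Oc' c'q] := ccP q.
  rewrite /nu /jac (jacobian_chart_change sB fB (OB _ Oc') (OB _ Oc) c'q cq).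
  by rewrite raw_normal_mul normalizeZ //; exact: Opos.
have nz c q : O c -> chart_dom c q -> raw_normal (jac c q) != 0.
  move=> Oc cq; apply: raw_normal_neq0; first exact: fO.
  by move=> v; apply: horizontal_jacobian; exact: dO.
have nuO : smooth_map O nu.
  move=> c Oc; have [_ oi _ _ _] := Bch _ (OB _ Oc).
  have : smooth_on (chart_map c @` chart_dom c)
      (fun v => normalize (raw_normal ('J (f \o chart_inv c) v))).
    apply: smooth_on_normalize => //.
      by move=> _ [q cq <-]; exact: nz.
    apply: smooth_on_cross => // i j; rewrite -[i]splitK.
    case: (fintype.split i) => a /=.
      have : smooth_on (chart_map c @` chart_dom c)
          (fun v => 'J (f \o chart_inv c) v a j).
        by apply: smooth_on_jacobian => //; exact: fB _ (OB _ Oc).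
      by apply: smooth_on_eq => // x _; rewrite col_mxEu.
    apply: smooth_on_eq (smooth_on_cst _ (p a j)) => // x _.
    by rewrite col_mxEd.
  move=> h; apply: (smooth_on_eq oi _ h) => _ [q cq <-].
  change (normalize (raw_normal (jac c q)) = nu (chart_inv c (chart_map c q))).
  have [_ _ cK _ _] := Bch _ (OB _ Oc).
  by rewrite (cK _ cq) (nuE c q Oc cq).
have nu_eq q : equator (nu q).
  have [Oc cq] := ccP q; split; first by rewrite normalize_unit ?nz.
  by rewrite /nu /normalize dotvZl raw_normal_pole mulr0.
exists nu; split=> //.
  have nuB : smooth_map (At `|` O) nu := smooth_map_sub sB Ocov OB nuO.
  by move=> c /AB; exact: nuB.
move=> q y; have [c Ac cq] := Acov q; have [Oc' c'q] := ccP q.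
have Jp v : dotv p (v *m jac c q) = 0.
  rewrite dotvC; apply: horizontal_jacobian.
  exact: differentiable_in_chart iF.1 Ac cq.
have Jnu v : dotv (nu q) (v *m jac c q) = 0.
  rewrite /jac (jacobian_chart_change sB fB (AB _ Ac) (OB _ Oc') cq c'q) mulmxA.
  by rewrite /nu /normalize dotvZl raw_normal_orth mulr0.
split=> [|[a [b ->]]]; last first.
  apply/(normal_spaceP _ sAt iF.1 Ac cq) => v.
  by rewrite dotvDl dotvZl dotvZl Jp Jnu !mulr0 addr0.
move=> /(normal_spaceP _ sAt iF.1 Ac cq) yJ.
have [nu1 nup] := nu_eq q.
exists (dotv y (nu q)), (dotv y p); apply/eqP; rewrite -subr_eq0; apply/eqP.
(* [z] is orthogonal to the tangent space, to the pole and to [nu q], which together span the whole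
   space. *)
set z := y - _.
have zE w : dotv z w =
    dotv y w - (dotv y (nu q) * dotv (nu q) w + dotv y p * dotv p w).
  by rewrite /z dotvDl dotvNl dotvDl dotvZl dotvZl.
have zJ v : dotv z (v *m jac c q) = 0.
  by rewrite zE Jp Jnu yJ !mulr0 addr0 subr0.
have zp : dotv z p = 0 by rewrite zE nup dotv_pole; ring.
have znu : dotv z (nu q) = 0 by rewrite zE nu1 (dotvC p) nup; ring.
have r0 := nz _ _ Oc' c'q.
apply: (orth_eq0 dimE _ _ r0).
  move: znu; rewrite /nu /normalize dotvZr => /eqP; rewrite mulf_eq0.
  by rewrite gt_eqF ?powR_gt0 ?dotv_gt0 // => /eqP.
move=> v; rewrite -[v]hsubmxK mul_row_col dotvDr.
rewrite [rsubmx v]mx11_scalar mul_scalar_mx dotvZr zp mulr0 addr0.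
by rewrite /jac (jacobian_chart_change sB fB (OB _ Oc') (AB _ Ac) c'q cq) mulmxA.
Qed.

End UnitNormal.

(** [N1] is [a nu + b p] normalized, and [N2] is its quarter turn [- b nu + a p] with the same
    factor. *)
Lemma exists_adapted_frame (R : realType) (m : nat) (M : topologicalType)
    (A U : set 'rV[R]_m.+2) (a b : 'rV[R]_m.+2 -> R)
    (At : set (chart R M m)) (f nu : M -> 'rV[R]_m.+2) :
  smooth_atlas At -> A = U `&` sphere -> smooth_on setT a -> smooth_on setT b ->
  (forall u, equator u -> semicircle_in U u (a u) (b u) /\
                          0 < a u ^+ 2 + b u ^+ 2) ->
  smooth_map At nu -> (forall q, equator (nu q)) ->
  (forall q y, Defs.normal_space At f q y <->
      exists x z, y = x *: nu q + z *: north_pole m.+1) ->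
  exists N1 N2, adapted_frame A At f N1 N2.
Proof.
move=> [Ach _ _] AU sa sb ab snu nueq nuN.
pose r u := (a u ^+ 2 + b u ^+ 2) `^ (- 2^-1).
pose F (x y : 'rV[R]_m.+2 -> R) q :=
  (r (nu q) * x (nu q)) *: nu q + (r (nu q) * y (nu q)) *: north_pole m.+1.
have rP q : r (nu q) ^+ 2 * (a (nu q) ^+ 2 + b (nu q) ^+ 2) = 1.
  by rewrite powR_inv_sqrt //; exact: (ab _ (nueq q)).2.
have r0 q : 0 < r (nu q) by rewrite powR_gt0 //; exact: (ab _ (nueq q)).2.
have sF x y : smooth_on setT x -> smooth_on setT y -> smooth_map At (F x y).
  move=> sx sy c Ac; have [_ oi _ _ _] := Ach _ Ac.
  have snc := snu _ Ac.
  pose I := chart_map c @` chart_dom c.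
  have comp (g : 'rV[R]_m.+2 -> R) : smooth_on setT g ->
      smooth_on I (fun v => g (nu (chart_inv c v))).
    move=> sg; exact: (@smooth_on_comp_scalar _ _ _ oi _ setT g (nu \o chart_inv c)).
  have sr : smooth_on I (fun v => r (nu (chart_inv c v))).
    apply: (smooth_on_comp_real oi (U' := [set x : R | 0 < x])
      (g := fun x => x `^ (- 2^-1))
      (h := fun v => a (nu (chart_inv c v)) ^+ 2 + b (nu (chart_inv c v)) ^+ 2)).
    - by move=> v _; exact: (ab _ (nueq _)).2.
    - exact: smooth_powR.
    - by apply: smooth_onD => //; apply: smooth_onM => //; exact: comp.
  apply: smooth_onD => //.
    apply: smooth_onZ => //; apply: smooth_onM => //; exact: comp.
  apply: smooth_onZ => //; last exact: smooth_on_cst.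
  apply: smooth_onM => //; exact: comp.
have sNb : smooth_on setT (fun u => - b u) by apply: smooth_onN => //; exact: openT.
have pe q y z : r (nu q) * y * (r (nu q) * z) = r (nu q) ^+ 2 * (y * z) by ring.
exists (F a b), (F (fun u => - b u) a); split.
- by split; exact: sF.
- move=> q; rewrite /sphere /F /=; split; rewrite dotv_equator //.
  + by rewrite !pe -mulrDr -!expr2 rP.
  + by rewrite !pe -mulrDr mulrNN addrC -!expr2 rP.
  + by rewrite !pe; ring.
- move=> q; apply/seteqP; split=> y.
    move=> /nuN [x [z ->]]; have := rP q.
    set ra := r (nu q); set aa := a (nu q); set bb := b (nu q) => e.
    exists (ra * (aa * x + bb * z)), (ra * (aa * z - bb * x)).
    rewrite /F -/ra -/aa -/bb !scalerDr !scalerA addrACA -!scalerDl.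
    congr (_ *: _ + _ *: _).
      by rewrite -[LHS]mul1r -e; ring.
    by rewrite -[LHS]mul1r -e; ring.
  move=> [x [z ->]]; apply/nuN.
  exists (x * (r (nu q) * a (nu q)) + z * (r (nu q) * - b (nu q))),
    (x * (r (nu q) * b (nu q)) + z * (r (nu q) * a (nu q))).
  by rewrite /F !scalerDr !scalerA addrACA -!scalerDl.
- move=> q y [[y1 /nuN [c [s ycs]]]]; rewrite /F ycs dotv_equator // => h.
  have [abs _] := ab _ (nueq q).
  rewrite AU; split; last by rewrite -ycs.
  apply: abs.
    by rewrite !expr2 -(dotv_equator _ _ _ _ (nueq q)) -ycs.
  move: h; rewrite -(mulrA (r _)) -(mulrA (r _)) -mulrDr pmulr_rge0 //.
  by rewrite (mulrC c) (mulrC s).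
Qed.

(** * The figure eight tube *)

Lemma continuous_mulmx (R : realType) (T : topologicalType) p q
    (g : T -> 'rV[R]_p) (J : T -> 'M[R]_(p, q)) x :
  {for x, continuous g} -> (forall i j, {for x, continuous (fun y => J y i j)}) ->
  {for x, continuous (fun y => g y *m J y)}.
Proof.
move=> cg cJ; apply: continuous_rV => j.
have : {for x, continuous (fun y => dotv (g y) (\row_i J y i j))}.
  apply: continuous_dotv => //; apply: continuous_rV => i.
  rewrite (_ : (fun _ => _) = (fun y => J y i j)) //.
  by apply/funext => y; rewrite mxE.
rewrite (_ : (fun y => dotv _ _) = (fun y => (g y *m J y) 0 j)) //.
by apply/funext => y; rewrite mxE; apply: eq_bigr => i _; rewrite mxE.
Qed.

(** * Derivatives of the frame dominated by those of the immersion *)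

Section DerivativeBound.
Context {R : realType} {m k l : nat} {M : topologicalType}.
Variables (At : set (chart R M m)) (f : M -> 'rV[R]_k) (N : M -> 'rV[R]_l).
Hypothesis sAt : smooth_atlas At.
Hypothesis iF : smooth_immersion At f.
Hypothesis sN : smooth_map At N.

(** Since [f] is an immersion, the right-hand form is positive on unit vectors, and homogeneity
    reduces to these. Taking [C] near +oo lets the compactness argument pass silently to the largest
    of finitely many constants. *)
Lemma derivative_bound_local c q : At c -> chart_dom c q ->
  \forall x \near chart_map c q & C \near +oo, forall v : 'rV[R]_m,
    dotv (v *m 'J (N \o chart_inv c) x) (v *m 'J (N \o chart_inv c) x) <=
    C * dotv (v *m 'J (f \o chart_inv c) x) (v *m 'J (f \o chart_inv c) x).
Proof.
move=> Ac cq; have [Ach _ _] := sAt; have [_ oi _ _ _] := Ach _ Ac.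
pose sq k (g : M -> 'rV[R]_k) (v x : 'rV[R]_m) :=
  dotv (v *m 'J (g \o chart_inv c) x) (v *m 'J (g \o chart_inv c) x).
have Iq : (chart_map c @` chart_dom c) (chart_map c q) by exists q.
have csq k' (g : M -> 'rV[R]_k') v0 : smooth_map At g ->
    {for (v0, chart_map c q), continuous (fun z => sq k' g z.1 z.2)}.
  move=> sg.
  have h : {for (v0, chart_map c q), continuous
      (fun z : 'rV[R]_m * 'rV[R]_m => z.1 *m 'J (g \o chart_inv c) z.2)}.
    apply: continuous_mulmx; first exact: cvg_fst.
    move=> i j; apply: (@continuous_comp _ _ _ (@snd 'rV[R]_m 'rV[R]_m)
      (fun x => 'J (g \o chart_inv c) x i j)); first exact: cvg_snd.
    by apply: (smooth_on_continuous (smooth_on_jacobian i j oi (sg _ Ac))).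
  exact: continuous_dotv.
have /compact_near_coveringP cpt := @unit_sphere_compact R m.
have : \forall z \near (nbhs (chart_map c q), (+oo : set_system R)),
    [set u : 'rV[R]_m | dotv u u = 1] `<=`
    (fun v => sq _ N v z.1 < z.2 * sq _ f v z.1).
  apply: (cpt _ (filter_prod (nbhs (chart_map c q)) (pinfty_nbhs R))
    (fun z v => sq _ N v z.1 < z.2 * sq _ f v z.1)) => v0 v01.
  have b0 : 0 < sq _ f v0 (chart_map c q).
    rewrite dotv_gt0; apply/eqP => v0J.
    have fr : row_free ('J (f \o chart_inv c) (chart_map c q)).
      by apply/injective_jacobian; exact: iF.2.
    have /row_freeP [J' JJ'] := fr.
    move: v01; rewrite -[v0]mulmx1 -JJ' mulmxA v0J mul0mx /= dotv0l.
    by move/eqP; rewrite eq_sym oner_eq0.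
  set b := sq _ f v0 _ in b0; set a := sq _ N v0 (chart_map c q).
  have near1 : \forall z \near (v0, chart_map c q), sq _ N z.1 z.2 < a + 1.
    have h : sq _ N (v0, chart_map c q).1 (v0, chart_map c q).2 < a + 1.
      by rewrite ltrDl.
    exact: (csq _ N v0 sN _ (lt_nbhsl h)).
  have near2 : \forall z \near (v0, chart_map c q), b / 2 < sq _ f z.1 z.2.
    have h : b / 2 < sq _ f (v0, chart_map c q).1 (v0, chart_map c q).2.
      by rewrite /= -/b; lra.
    exact: (csq _ f v0 iF.1 _ (lt_nbhsr h)).
  (* Near the given point the left form is below a + 1 and the right one above b / 2. *)
  have near3 : \forall C \near +oo, (a + 1) / (b / 2) < C.
    by apply: nbhs_pinfty_gt; rewrite num_real.
  have [[S1 S2] /= [nS1 nS2] S12] := filterI near1 near2.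
  exists (S1, [set z | S2 z.1 /\ (a + 1) / (b / 2) < z.2]) => /=.
    split=> //; exists (S2, [set C | (a + 1) / (b / 2) < C]) => //=.
  move=> [v [x C]] /= [S1v [S2x aC]].
  have [/= N1 f1] := S12 (v, x) (conj S1v S2x).
  have b2 : 0 < b / 2 by lra.
  have a0 : 0 <= a by exact: dotv_ge0.
  have C0 : 0 < C by apply: le_lt_trans aC; apply: divr_ge0; lra.
  rewrite ltr_pdivrMr // in aC.
  apply: (lt_trans N1); apply: (lt_trans aC); by rewrite ltr_pM2l.
move=> [[S1 S2] /= [nS1 nS2] S12].
exists (S1, S2) => // -[x C] /= [S1x S2C] v.
have [->|v0] := eqVneq v 0; first by rewrite !mul0mx !dotv0l mulr0.
have := S12 (x, C) (conj S1x S2C) (normalize v) (normalize_unit v0).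
rewrite /sq /= /normalize -!scalemxAl !dotvZl !dotvZr => h.
set s := dotv v v `^ _ in h.
have s0 : 0 < s by rewrite powR_gt0 // dotv_gt0.
rewrite -(ler_pM2l s0) -(ler_pM2l s0); apply: (le_trans (ltW h)).
by rewrite le_eqVlt; apply/orP; left; apply/eqP; ring.
Qed.

(** A change of chart replaces [v] by the same vector on both sides, so a constant found in one
    chart near a point is valid there in every chart; compactness of [M] does the rest. *)
Lemma derivative_bound : compact [set: M] -> exists2 C, 0 < C &
  forall c q (v : 'rV[R]_m), At c -> chart_dom c q ->
    dotv (v *m 'J (N \o chart_inv c) (chart_map c q))
         (v *m 'J (N \o chart_inv c) (chart_map c q)) <=
    C * dotv (v *m 'J (f \o chart_inv c) (chart_map c q))
             (v *m 'J (f \o chart_inv c) (chart_map c q)).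
Proof.
move=> /compact_near_coveringP cpt; have [Ach Acov As] := sAt.
pose P C q := forall c (v : 'rV[R]_m), At c -> chart_dom c q ->
    dotv (v *m 'J (N \o chart_inv c) (chart_map c q))
         (v *m 'J (N \o chart_inv c) (chart_map c q)) <=
    C * dotv (v *m 'J (f \o chart_inv c) (chart_map c q))
             (v *m 'J (f \o chart_inv c) (chart_map c q)).
have : \forall C \near +oo, [set: M] `<=` P C.
  apply: cpt => q0 _; have [c0 Ac0 c0q] := Acov q0.
  have [od _ _ cm _] := Ach _ Ac0.
  have [[S1 S2] /= [nS1 nS2] S12] := derivative_bound_local Ac0 c0q.
  exists (chart_dom c0 `&` chart_map c0 @^-1` S1, S2) => /=.
    split=> //; apply: filterI; first exact: open_nbhs_nbhs.
    exact: (cm _ c0q).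
  move=> [q C] /= [[c0q' S1q] S2C] c v Ac cq.
  rewrite (jacobian_chart_change sAt sN Ac Ac0 cq c0q').
  rewrite (jacobian_chart_change sAt iF.1 Ac Ac0 cq c0q').
  rewrite !mulmxA; exact: (S12 (_, _) (conj S1q S2C)).
move=> [C [_ HC]]; exists (Num.max (C + 1) 1); first by rewrite lt_max ltr01 orbT.
move=> c q v; apply: HC => //=; rewrite lt_max; apply/orP; left; lra.
Qed.

End DerivativeBound.

(** At each pair (q, w) of the compact product, either one of the conditions with eta = 0 fails
    strictly, and the relaxed condition still fails nearby for small eta, or [w] lies in the open
    set [U]. *)
Lemma near_semicircle (R : realType) n (M : topologicalType)
    (A U : set 'rV[R]_n.+1) (N1 N2 : M -> 'rV[R]_n.+1) :
  compact [set: M] -> open U -> A = U `&` sphere ->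
  continuous N1 -> continuous N2 ->
  (forall q w, dotv w w = 1 -> 0 <= dotv w (N1 q) ->
     w = dotv w (N1 q) *: N1 q + dotv w (N2 q) *: N2 q -> A w) ->
  exists2 eta, 0 < eta & forall q w, dotv w w = 1 -> - eta <= dotv w (N1 q) ->
    (let h := w - (dotv w (N1 q) *: N1 q + dotv w (N2 q) *: N2 q) in
     dotv h h <= eta) -> A w.
Proof.
move=> cM oU AU c1 c2 inA.
have /compact_near_coveringP cpt := compact_setX cM (@unit_sphere_compact R n.+1).
pose h (z : M * 'rV[R]_n.+1) :=
  z.2 - (dotv z.2 (N1 z.1) *: N1 z.1 + dotv z.2 (N2 z.1) *: N2 z.1).
pose P (eta : R) (z : M * 'rV[R]_n.+1) :=
  dotv z.2 z.2 = 1 -> - eta <= dotv z.2 (N1 z.1) -> dotv (h z) (h z) <= eta -> A z.2.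
have : \forall eta \near (0 : R),
    ([set: M] `*` [set u : 'rV[R]_n.+1 | dotv u u = 1]) `<=` P eta.
  apply: (cpt _ (nbhs (0 : R)) P) => -[q w] [_ /= w1].
  have cw : {for ((q, w), 0), continuous (fun y : (M * 'rV[R]_n.+1) * R => y.1.2)}.
    by apply: (@continuous_comp _ _ _ (@fst (M * 'rV[R]_n.+1) R) (@snd M 'rV[R]_n.+1));
      [exact: cvg_fst|exact: cvg_snd].
  have cq : {for ((q, w), 0), continuous (fun y : (M * 'rV[R]_n.+1) * R => y.1.1)}.
    by apply: (@continuous_comp _ _ _ (@fst (M * 'rV[R]_n.+1) R) (@fst M 'rV[R]_n.+1));
      [exact: cvg_fst|exact: cvg_fst].
  have ce : {for ((q, w), 0), continuous (fun y : (M * 'rV[R]_n.+1) * R => y.2)}.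
    exact: cvg_snd.
  have cN (N : M -> 'rV[R]_n.+1) : continuous N ->
      {for ((q, w), 0), continuous (fun y : (M * 'rV[R]_n.+1) * R => N y.1.1)}.
    move=> cNN; apply: (@continuous_comp _ _ _
      (fun y : (M * 'rV[R]_n.+1) * R => y.1.1) N _ cq); exact: cNN.
  have cd (N : M -> 'rV[R]_n.+1) : continuous N ->
      {for ((q, w), 0), continuous
        (fun y : (M * 'rV[R]_n.+1) * R => dotv y.1.2 (N y.1.1))}.
    by move=> cNN; apply: continuous_dotv => //; exact: cN.
  have ch : {for ((q, w), 0), continuous (fun y : (M * 'rV[R]_n.+1) * R => h y.1)}.
    apply: continuousB => //; apply: continuousD.
      by apply: continuousZ; [exact: cd|exact: cN].
    by apply: continuousZ; [exact: cd|exact: cN].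
  have [neg|pos] := ltP (dotv w (N1 q)) 0.
    have cs : {for ((q, w), 0), continuous
        (fun y : (M * 'rV[R]_n.+1) * R => dotv y.1.2 (N1 y.1.1) + y.2)}.
      by apply: continuousD => //; exact: cd.
    have s0 : dotv (q, w, (0 : R)).1.2 (N1 (q, w, (0 : R)).1.1) + (q, w, (0 : R)).2 < 0.
      by rewrite addr0.
    have : \forall y \near ((q, w), (0 : R)), dotv y.1.2 (N1 y.1.1) + y.2 < 0.
      exact: (cs _ (lt_nbhsl s0)).
    by apply: filterS => -[z eta] /= z0 _ ez _; exfalso; move: z0 ez; clear; lra.
  have [h0|hn] := eqVneq (h (q, w)) 0; last first.
    have cs : {for ((q, w), 0), continuous
        (fun y : (M * 'rV[R]_n.+1) * R => dotv (h y.1) (h y.1) - y.2)}.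
      by apply: continuousB => //; exact: continuous_dotv.
    have s0 : 0 < dotv (h (q, w, (0 : R)).1) (h (q, w, (0 : R)).1) - (q, w, (0 : R)).2.
      by rewrite subr0 dotv_gt0.
    have : \forall y \near ((q, w), (0 : R)), 0 < dotv (h y.1) (h y.1) - y.2.
      exact: (cs _ (lt_nbhsr s0)).
    by apply: filterS => -[z eta] /= z0 _ _ ez; exfalso; move: z0 ez; clear; lra.
  have Uw : U w.
    have : A w by apply: (inA q) => //; apply/eqP; rewrite -subr_eq0; apply/eqP.
    by rewrite AU => -[].
  have : \forall y \near ((q, w), (0 : R)), U y.1.2.
    by apply: cw; exact: open_nbhs_nbhs.
  by apply: filterS => -[z eta] /= Uz z1 _ _; rewrite AU.
move=> /nbhs_ballP [e /= e0 He]; exists (e / 2); first by rewrite divr_gt0.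
move=> q w w1 wN hw; apply: (He (e / 2) _ (q, w)) => //.
by rewrite /ball /= sub0r normrN gtr0_norm; move: e0; clear; lra.
Qed.

Section TubeJacobian.
Context {R : realType} {m n : nat} {M : topologicalType}.
Variables (At : set (chart R M m)) (f N1 N2 : M -> 'rV[R]_n.+1).
Variables (eps delta : R).
Hypothesis sAt : smooth_atlas At.
Hypothesis sf : smooth_map At f.
Hypothesis s1 : smooth_map At N1.
Hypothesis s2 : smooth_map At N2.
Local Notation F := (figure_eight_tube f N1 N2 eps delta).
Local Notation tube_chart c a := (prod_chart c (@circle_chart R a)).

Lemma tube_in_chart (c : chart R M m) a v :
  F (chart_inv (tube_chart c a) v) =
  f (chart_inv c (lsubmx v)) + eps *: (cos (rsubmx v 0 0) *: N1 (chart_inv c (lsubmx v))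
    + (delta * sin (2 * rsubmx v 0 0)) *: N2 (chart_inv c (lsubmx v))).
Proof. exact: figure_eight_tubeE. Qed.

Lemma smooth_tube : smooth_map (prod_atlas At (circle_atlas R)) F.
Proof.
move=> _ [c [_ [Ac [a _ <-] ->]]]; have [Ach _ _] := sAt.
have pc := prod_chart_is_chart (Ach _ Ac) (circle_chart_is_chart a).
have [_ oi _ _ _] := pc; have [_ oc _ _ _] := Ach _ Ac.
set I := _ @` _ in oi *.
have comp (g : M -> 'rV[R]_n.+1) : smooth_map At g ->
    smooth_on I (fun v => g (chart_inv c (lsubmx v))).
  move=> sg; apply: (smooth_on_comp oi oc (g := g \o chart_inv c)).
  - by move=> _ [[x y] [/= cx _] <-] /=; rewrite row_mxKl; exists x.
  - exact: sg.
  - exact: smooth_on_lsubmx.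
have sr : smooth_on I (fun v : 'rV[R]_(m + 1) => rsubmx v 0 0).
  by apply: smooth_on_coord => //; exact: smooth_on_rsubmx.
apply: (@smooth_on_eq _ _ _ _ (fun v => f (chart_inv c (lsubmx v)) +
    eps *: (cos (rsubmx v 0 0) *: N1 (chart_inv c (lsubmx v)) +
    (delta * sin (2 * rsubmx v 0 0)) *: N2 (chart_inv c (lsubmx v))))) => //.
  by move=> v _; rewrite -(tube_in_chart c a v).
apply: smooth_onD => //; first exact: comp.
apply: smooth_onZ => //; first exact: smooth_on_cst.
apply: smooth_onD => //; apply: smooth_onZ => //; try exact: comp.
  exact: (smooth_on_comp_real oi (U' := setT) (g := cos) _ smooth_cos sr).
apply: smooth_onMl => //.
exact: (smooth_on_comp_real oi (U' := setT) (g := sin) _ smooth_sin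
  (smooth_onMl oi 2 sr)).
Qed.

(** The upper rows are the derivatives along [M], the last row is the derivative along the
    circle. *)
Lemma tube_jacobian c a q t : At c -> chart_dom c q -> a < t < a + pi *+ 2 ->
  'J (F \o chart_inv (tube_chart c a)) (chart_map (tube_chart c a) (q, angle t)) =
  col_mx ('J (f \o chart_inv c) (chart_map c q) +
          eps *: (cos t *: 'J (N1 \o chart_inv c) (chart_map c q) +
                  (delta * sin (2 * t)) *: 'J (N2 \o chart_inv c) (chart_map c q)))
    (eps *: (- sin t *: N1 q + (2 * delta * cos (2 * t)) *: N2 q)).
Proof.
move=> Ac cq ta; have [Ach _ _] := sAt.
have sAt1 := smooth_prod_atlas sAt (@smooth_circle_atlas R).
have A1c : prod_atlas At (circle_atlas R) (tube_chart c a).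
  by exists c, (circle_chart a); split=> //; exists a.
have dx : chart_dom (tube_chart c a) (q, angle t) by split=> //; exists t.
set x := chart_map _ _.
have xE : x = row_mx (chart_map c q) (const_mx t).
  by rewrite -(circle_chartK ta).
have dF : differentiable (F \o chart_inv (tube_chart c a)) x.
  exact: differentiable_in_chart smooth_tube A1c dx.
have xl : lsubmx x = chart_map c q by rewrite xE row_mxKl.
have xr : rsubmx x 0 0 = t by rewrite xE row_mxKr mxE.
have qx : chart_inv c (chart_map c q) = q by have [_ _ cK _ _] := Ach _ Ac; exact: cK.
have dcomp (g : M -> 'rV[R]_n.+1) (u : 'rV[R]_(m + 1)) j : smooth_map At g ->
    is_derive x u (fun v => g (chart_inv c (lsubmx v)) 0 j)
      ((lsubmx u *m 'J (g \o chart_inv c) (chart_map c q)) 0 j).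
  move=> sg.
  have dg : differentiable (g \o chart_inv c) (lsubmx x).
    by rewrite xl; exact: differentiable_in_chart sg Ac cq.
  have dgl : differentiable ((g \o chart_inv c) \o lsubmx) x.
    by apply: differentiable_comp => //; exact: differentiable_lsubmx.
  have dgj : differentiable
      (fun v : 'rV[R]_(m + 1) => ((g \o chart_inv c) \o lsubmx) v 0 j) x.
    apply: (@differentiable_comp _ _ _ _ ((g \o chart_inv c) \o lsubmx)
      (fun w : 'rV[R]_n.+1 => w 0 j)) => //.
    exact: differentiable_coord.
  apply: DeriveDef; first exact: (@diff_derivable _ _ _ _ _ u dgj).
  have := derive_mx (@diff_derivable _ _ _ _ _ u dgl) => /rowP /(_ j); rewrite mxE => <-.
  rewrite (derive_comp u (differentiable_lsubmx x) dg).
  rewrite (deriveE u (differentiable_lsubmx x)).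
  rewrite (diff_lin _ (@continuous_lsubmx R 1 m 1)).
  by rewrite -xl (deriveEjacobian _ dg).
have dr (u : 'rV[R]_(m + 1)) :
    is_derive x u (fun v : 'rV[R]_(m + 1) => rsubmx v 0 0) (rsubmx u 0 0).
  have dl : differentiable (fun v : 'rV[R]_(m + 1) => v 0 (rshift m 0)) x.
    exact: differentiable_coord.
  have -> : (fun v : 'rV[R]_(m + 1) => rsubmx v 0 0) = (fun v => v 0 (rshift m 0)).
    by apply/funext => v; rewrite mxE.
  apply: DeriveDef; first exact: diff_derivable.
  have := derive_mx (@derivable_id _ _ x u) => /rowP /(_ (rshift m 0)).
  by rewrite mxE => <-; rewrite derive_id mxE.
have dreal (u : 'rV[R]_(m + 1)) (h : R -> R) (l : R) : is_derive t 1 h l ->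
    is_derive x u (fun v => h (rsubmx v 0 0)) (rsubmx u 0 0 * l).
  move=> [hd <-]; have [_ ru] := dr u.
  have dh : differentiable h (rsubmx x 0 0) by rewrite xr; apply/derivable1_diffP.
  have drx : differentiable (fun v : 'rV[R]_(m + 1) => rsubmx v 0 0) x.
    apply: (@differentiable_comp _ _ _ _ rsubmx (fun w : 'rV[R]_1 => w 0 0)).
      exact: differentiable_rsubmx.
    exact: differentiable_coord.
  apply: DeriveDef; first exact/diff_derivable/(differentiable_comp drx dh).
  apply: etrans (derive_comp u drx dh) _; rewrite ru -xr.
  rewrite (deriveE _ dh) (deriveE (1 : R) dh).
  by rewrite -[X in 'd _ _ X](mulr1 (rsubmx u 0 0)) -[_ * 1]/(_ *: (1 : R)) linearZ.
apply/matrixP => i j; rewrite (jacobianE i j dF).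
rewrite (derive_mx (@diff_derivable _ _ _ _ _ (delta_mx 0 i) dF)) mxE.
set u : 'rV[R]_(m + 1) := delta_mx 0 i.
have d1 := dcomp f u j sf.
have d2 := dcomp N1 u j s1.
have d3 := dcomp N2 u j s2.
have dc := dreal u cos _ (is_derive_cos t).
have ds : is_derive x u (fun v : 'rV[R]_(m + 1) => sin (2 * rsubmx v 0 0))
    (rsubmx u 0 0 * (cos (2 * t) * 2)).
  apply: (dreal u (fun s => sin (2 * s))).
  apply: (@is_derive1_comp _ sin (fun s => 2 * s)).
  have := @is_deriveZ _ _ _ id 2 t 1 1 (is_derive_id _ _).
  by rewrite /GRing.scale /= mulr1.
(* One coordinate of the tube as a scalar expression, arranged to match the shape that the
   derivation rules produce. *)
pose Fj (v : 'rV[R]_(m + 1)) := f (chart_inv c (lsubmx v)) 0 j +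
  eps * (cos (rsubmx v 0 0) * N1 (chart_inv c (lsubmx v)) 0 j +
    delta * (sin (2 * rsubmx v 0 0) * N2 (chart_inv c (lsubmx v)) 0 j)).
rewrite (_ : (fun v => _) = Fj); last first.
  apply/funext => v; rewrite -[LHS]/(F (chart_inv (tube_chart c a) v) 0 j).
  rewrite tube_in_chart /Fj; move: (rsubmx v 0 0) => r.
  by rewrite !mxE; ring.
have dFj : is_derive x u Fj ((lsubmx u *m 'J (f \o chart_inv c) (chart_map c q)) 0 j +
    eps * (cos t * (lsubmx u *m 'J (N1 \o chart_inv c) (chart_map c q)) 0 j +
           N1 q 0 j * (rsubmx u 0 0 * - sin t) +
           delta * (sin (2 * t) *
             (lsubmx u *m 'J (N2 \o chart_inv c) (chart_map c q)) 0 j +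
             N2 q 0 j * (rsubmx u 0 0 * (cos (2 * t) * 2))))).
  have := is_deriveD d1 (is_deriveZ eps (is_deriveD (is_deriveM dc d2)
    (is_deriveZ delta (is_deriveM ds d3)))).
  by rewrite xl xr qx.
have [_ ->] := dFj; rewrite /u.
move: ('J (f \o _) _) ('J (N1 \o _) _) ('J (N2 \o _) _) => Jf J1 J2.
clear; rewrite -[i]splitK; case: (fintype.split i) => k /=.
  have -> : lsubmx (delta_mx 0 (lshift 1 k) : 'rV[R]_(m + 1)) = delta_mx 0 k.
    by apply/rowP => b; rewrite !mxE /= eq_lshift.
  have -> : rsubmx (delta_mx 0 (lshift 1 k) : 'rV[R]_(m + 1)) 0 0 = 0.
    by rewrite !mxE /= eq_rlshift.
  rewrite -!rowE col_mxEu !mxE; ring.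
have -> : lsubmx (delta_mx 0 (rshift m k) : 'rV[R]_(m + 1)) = 0.
  by apply/rowP => b; rewrite !mxE /= eq_lrshift.
have -> : rsubmx (delta_mx 0 (rshift m k) : 'rV[R]_(m + 1)) 0 0 = 1.
  by rewrite !mxE /= !ord1 eqxx.
rewrite !mul0mx col_mxEd !mxE ord1; ring.
Qed.

End TubeJacobian.

(** * Linear algebra of the tube at one point *)

Section TubeAlgebra.
Context {R : realType} {m n : nat}.
Variables (Jf J1 J2 : 'M[R]_(m, n)) (n1 n2 : 'rV[R]_n) (eps delta C t : R).
Hypotheses (n11 : dotv n1 n1 = 1) (n22 : dotv n2 n2 = 1) (n12 : dotv n1 n2 = 0).
Hypothesis nspan : forall y : 'rV_n, (forall v : 'rV_m, dotv y (v *m Jf) = 0) <->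
  exists a b, y = a *: n1 + b *: n2.
Hypothesis b1 : forall v : 'rV_m,
  dotv (v *m J1) (v *m J1) <= C * dotv (v *m Jf) (v *m Jf).
Hypothesis b2 : forall v : 'rV_m,
  dotv (v *m J2) (v *m J2) <= C * dotv (v *m Jf) (v *m Jf).
Hypotheses (C0 : 0 < C) (eps0 : 0 < eps) (delta0 : 0 < delta) (delta1 : delta <= 1).

(** [tube_shear] is the contribution of the moving frame to the derivatives along [M], and
    [tube_velocity] the derivative along the circle, both divided by eps. [tube_conormal] is the
    velocity turned by a right angle in the plane of [n1] and [n2]; [tube_speed] is the squared
    length of both. *)
Definition tube_shear : 'M[R]_(m, n) := cos t *: J1 + (delta * sin (2 * t)) *: J2.
Definition tube_velocity : 'rV[R]_n := - sin t *: n1 + (2 * delta * cos (2 * t)) *: n2.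
Definition tube_conormal : 'rV[R]_n := (2 * delta * cos (2 * t)) *: n1 + sin t *: n2.
Definition tube_speed : R := (2 * delta * cos (2 * t)) ^+ 2 + sin t ^+ 2.

Let J := Jf + eps *: tube_shear.
Let normal_part (w : 'rV[R]_n) := dotv w n1 *: n1 + dotv w n2 *: n2.

(** The figure eight is immersed: cos 2t = 1 wherever sin t vanishes. *)
Lemma tube_speed_gt0 : 0 < tube_speed.
Proof.
rewrite /tube_speed; have [s0|s0] := eqVneq (sin t) 0; last first.
  by rewrite ltr_wpDl ?sqr_ge0 // exprn_even_gt0.
have c2 : cos (2 * t) = 1.
  by rewrite mulr_natl cos_mulr2n cos2sin2 s0 expr0n /= subr0 mulr2n addrK.
by rewrite c2 s0 mulr1 ltr_pwDl ?sqr_ge0 // exprn_gt0 // mulr_gt0.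
Qed.

(** The factor 4 comes from |x + y|^2 <= 2 |x|^2 + 2 |y|^2 with two terms bounded by [C]; the
    coefficients are at most 1 in absolute value because [delta <= 1]. *)
Lemma tube_shear_bound v :
  dotv (v *m tube_shear) (v *m tube_shear) <= 4 * C * dotv (v *m Jf) (v *m Jf).
Proof.
rewrite /tube_shear mulmxDr -!scalemxAr.
set x := v *m J1; set y := v *m J2; set z := v *m Jf.
set c := cos t; set d := delta * sin (2 * t).
have c1 : c ^+ 2 <= 1 by rewrite cos2sin2 gerBl sqr_ge0.
have d1 : d ^+ 2 <= 1.
  have s1 : sin (2 * t) ^+ 2 <= 1 by rewrite sin2cos2 gerBl sqr_ge0.
  have e1 : delta ^+ 2 <= 1 by apply: exprn_ile1 => //; exact: ltW.
  by rewrite exprMn; apply: mulr_ile1 => //; exact: sqr_ge0.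
have h1 : dotv x x <= C * dotv z z := b1 v.
have h2 : dotv y y <= C * dotv z z := b2 v.
have := dotv_ge0 (c *: x - d *: y); rewrite !dotv_lin (dotvC y x) => h3.
have x0 := dotv_ge0 x; have y0 := dotv_ge0 y.
have h4 : c ^+ 2 * dotv x x <= dotv x x by rewrite ler_piMl.
have h5 : d ^+ 2 * dotv y y <= dotv y y by rewrite ler_piMl.
lra.
Qed.

Lemma normal_orth v : dotv n1 (v *m Jf) = 0 /\ dotv n2 (v *m Jf) = 0.
Proof.
split; [apply: (nspan n1).2 v|apply: (nspan n2).2 v].
  by exists 1, 0; rewrite scale1r scale0r addr0.
by exists 0, 1; rewrite scale1r scale0r add0r.
Qed.

(** The rows of [Jf] together with [n1] and [n2] span: a vector orthogonal to [Jf] is a combination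
    of [n1] and [n2], and orthogonality to these kills it. Pairing with [n1] and [n2] then removes
    their coefficients. *)
Lemma tangent_part w : exists k : 'rV_m, w - normal_part w = k *m Jf.
Proof.
have [|z zE] := @spanning_of_orth R _ _ (col_mx (col_mx Jf n1) n2) _ (w - normal_part w).
  move=> y yB.
  have yf v : dotv y (v *m Jf) = 0.
    have := yB (row_mx (row_mx v 0) 0).
    by rewrite !mul_row_col !mul0mx !addr0.
  have y1 : dotv y n1 = 0.
    have := yB (row_mx (row_mx 0 1%:M) 0).
    by rewrite !mul_row_col !mul0mx mul1mx addr0 add0r.
  have y2 : dotv y n2 = 0.
    have := yB (row_mx 0 1%:M).
    by rewrite !mul_row_col !mul0mx mul1mx add0r.
  have [a [b yab]] := (nspan y).1 yf.
  move: y1 y2; rewrite yab !dotv_lin n11 n22 n12 (dotvC n2) n12.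
  rewrite !mulr0 !mulr1 addr0 add0r => -> ->.
  by rewrite !scale0r addr0.
move: zE; rewrite -[z]hsubmxK -[lsubmx z]hsubmxK !mul_row_col.
set k := lsubmx _; rewrite [rsubmx (lsubmx z)]mx11_scalar.
rewrite [rsubmx z]mx11_scalar !mul_scalar_mx.
set a := _ 0 0; set b := _ 0 0 => zE; exists k.
have [k1 k2] := normal_orth k.
have e1 := congr1 (dotv n1) zE; have e2 := congr1 (dotv n2) zE.
move: e1 e2; rewrite /normal_part !dotv_lin k1 k2 n11 n22 n12 (dotvC n2 n1) n12.
rewrite (dotvC n1 w) (dotvC n2 w) => e1 e2.
have a0 : a = 0 by lra.
have b0 : b = 0 by lra.
by rewrite -/(normal_part w) zE a0 b0 !scale0r !addr0.
Qed.

(* [h] is tangent to [f], so [h = k *m Jf]; pairing [w] with [k *m J] gives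
   [dotv h h = - eps * dotv w (k *m tube_shear)], and Cauchy-Schwarz concludes. *)
Lemma tube_normal_close w : (forall v, dotv w (v *m J) = 0) ->
  dotv (w - normal_part w) (w - normal_part w) <= 4 * C * eps ^+ 2 * dotv w w.
Proof.
move=> wJ; have [k hk] := tangent_part w; set h := w - _ in hk *.
have hE : w = h + normal_part w by rewrite subrK.
clearbody h.
have [k1 k2] := normal_orth k.
have hw : dotv h h = dotv w h.
  have -> : dotv w h = dotv h h + dotv (normal_part w) h.
    by rewrite -dotvDl -hE.
  by rewrite /normal_part dotvDl !dotvZl hk k1 k2 !mulr0 !addr0.
have hS : dotv h h = - eps * dotv w (k *m tube_shear).
  have := wJ k; rewrite /J mulmxDr dotvDr -scalemxAr dotvZr -hk -hw; lra.
have := dotv_sqr_le w (k *m tube_shear); have := tube_shear_bound k.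
rewrite -hk => S1 S2; have h0 := dotv_ge0 h; have w0 := dotv_ge0 w.
have [->|hn] := eqVneq (dotv h h) 0.
  by rewrite !mulr_ge0 // ?sqr_ge0 //; exact: ltW.
have hp : 0 < dotv h h by rewrite lt_neqAle eq_sym hn.
rewrite -(ler_pM2r hp).
have -> : dotv h h * dotv h h = eps ^+ 2 * dotv w (k *m tube_shear) ^+ 2.
  by rewrite {1 2}hS; ring.
have -> : 4 * C * eps ^+ 2 * dotv w w * dotv h h =
  eps ^+ 2 * (dotv w w * (4 * C * dotv h h)) by ring.
rewrite ler_pM2l ?exprn_gt0 //; apply: le_trans S2 _.
by apply: ler_wpM2l.
Qed.

(** In the plane of [n1] and [n2], velocity and conormal are orthogonal with squared length
    [tube_speed]; the two ring identities expand [w] in this basis. *)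
Lemma tube_normal_coords w : dotv w tube_velocity = 0 ->
  let c := dotv w tube_conormal / tube_speed in
  dotv w n1 = c * (2 * delta * cos (2 * t)) /\ dotv w n2 = c * sin t.
Proof.
have := tube_speed_gt0; rewrite /tube_velocity /tube_conormal !dotv_lin.
rewrite /tube_speed; set a := _ * cos _; set s := sin t => D0 wT.
split; apply: (mulIf (lt0r_neq0 D0)); rewrite mulrAC divfK ?gt_eqF //.
  have -> : dotv w n1 * (a ^+ 2 + s ^+ 2) =
    (a * dotv w n1 + s * dotv w n2) * a - s * (- s * dotv w n1 + a * dotv w n2) by ring.
  by rewrite wT mulr0 subr0.
have -> : dotv w n2 * (a ^+ 2 + s ^+ 2) =
  (a * dotv w n1 + s * dotv w n2) * s + a * (- s * dotv w n1 + a * dotv w n2) by ring.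
by rewrite wT mulr0 addr0.
Qed.

Hypothesis epsC : 4 * C * eps ^+ 2 < 1.

(** Otherwise the normal part of [w] vanishes, and [tube_normal_close] bounds |w|^2 by a multiple of
    itself with factor less than 1. *)
Lemma tube_conormal_neq0 w : w != 0 -> (forall v, dotv w (v *m J) = 0) ->
  dotv w tube_velocity = 0 -> dotv w tube_conormal != 0.
Proof.
move=> w0 wJ wT; apply/eqP => c0.
have [a1 a2] := tube_normal_coords wT; rewrite c0 !mul0r in a1 a2.
have := tube_normal_close wJ; rewrite /= /normal_part a1 a2 !scale0r addr0 subr0.
by rewrite -dotv_gt0 in w0; rewrite leNgt gtr_pMl // epsC.
Qed.

(** Pairing a relation between the rows with [k *m Jf], which is orthogonal to the velocity, leaves
    |k Jf|^2 = - eps <k Jf, k shear>. Cauchy-Schwarz and smallness of eps give k = 0, and the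
    velocity is nonzero. *)
Lemma tube_row_free : row_free Jf -> row_free (col_mx J (eps *: tube_velocity)).
Proof.
move=> /row_freeP [J' JJ']; rewrite -kermx_eq0; apply/rowV0P => v /sub_kermxP.
rewrite -[v]hsubmxK mul_row_col [rsubmx v]mx11_scalar mul_scalar_mx.
set k := lsubmx v; set s := rsubmx v 0 0 => e.
have [k1 k2] := normal_orth k.
have kT : dotv (k *m Jf) tube_velocity = 0.
  by rewrite dotvC /tube_velocity dotvDl !dotvZl k1 k2 !mulr0 addr0.
have kS : dotv (k *m Jf) (k *m Jf) = - eps * dotv (k *m Jf) (k *m tube_shear).
  have := congr1 (dotv (k *m Jf)) e.
  rewrite /J mulmxDr -scalemxAr !dotvDr !dotvZr kT dotv0r; lra.
have kf0 : k *m Jf = 0.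
  apply/eqP; apply: contraT; rewrite -dotv_gt0 => kf.
  have := dotv_sqr_le (k *m Jf) (k *m tube_shear); have := tube_shear_bound k.
  move: kS kf; set z := dotv (k *m Jf) _; set y := dotv (k *m Jf) _.
  set x := dotv _ _ => zy z0 xz yz.
  have : z ^+ 2 <= eps ^+ 2 * (z * (4 * C * z)).
    rewrite {1}zy exprMn sqrrN ler_pM2l ?exprn_gt0 //; apply: le_trans yz _.
    by rewrite ler_pM2l.
  have -> : eps ^+ 2 * (z * (4 * C * z)) = 4 * C * eps ^+ 2 * z ^+ 2 by ring.
  by rewrite leNgt gtr_pMl ?exprn_gt0 // epsC.
have k0 : k = 0 by rewrite -[k]mulmx1 -JJ' mulmxA kf0 mul0mx.
move: e; rewrite k0 mul0mx add0r => e.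
have TT : dotv tube_velocity tube_velocity = tube_speed.
  rewrite /tube_velocity /tube_speed !dotv_lin n11 n22 n12 (dotvC n2) n12; ring.
have s0 : s = 0.
  have := congr1 (dotv tube_velocity) e; rewrite !dotvZr TT dotv0r => /eqP.
  by rewrite !mulf_eq0 (gt_eqF eps0) (gt_eqF tube_speed_gt0) !orbF => /eqP.
by rewrite s0 raddf0 row_mx0.
Qed.

End TubeAlgebra.

Lemma circle_fun_continuous (R : realType) (h : R -> R) :
  continuous h -> periodic h (pi *+ 2) -> continuous (circle_fun h).
Proof.
move=> ch ph; apply/quotient_continuous.
have -> : circle_fun h \o \pi_(circle R)%qT = h; last exact: ch.
by apply/funext => t; exact: circle_funE.
Qed.

(** * A continuous unit normal singled out by a transverse field *)

Section NormalField.
Context {R : realType} {M : topologicalType} {d k : nat}.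
Variables (At : set (chart R M d)) (F nu : M -> 'rV[R]_k).
Hypothesis kd : k = (d + 1)%N.
Hypothesis sAt : smooth_atlas At.
Hypothesis iF : smooth_immersion At F.
Hypothesis cnu : continuous nu.
Hypothesis nu_transverse : forall x w, w != 0 -> Defs.normal_space At F x w ->
  dotv w (nu x) != 0.

Let w (c : chart R M d) x := cross ('J (F \o chart_inv c) (chart_map c x)).

(** The cross product [w] of a chart has an arbitrary sign. The vector [dotv w nu *: w] is quadratic
    in [w], so a change of chart multiplies it by a squared determinant, and its normalization is
    globally defined. *)
Lemma exists_normal_field : exists G : M -> 'rV[R]_k,
  [/\ continuous G, forall x, dotv (G x) (G x) = 1,
      forall x, Defs.normal_space At F x (G x) &
      forall x, 0 < dotv (G x) (nu x)].
Proof.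
have [Ach Acov As] := sAt.
have wn c x : At c -> chart_dom c x -> Defs.normal_space At F x (w c x).
  move=> Ac cx; apply/(normal_spaceP _ sAt iF.1 Ac cx) => v.
  exact: cross_orth.
have w0 c x : At c -> chart_dom c x -> w c x != 0.
  move=> Ac cx; apply: (cross_neq0 kd).
  by apply/injective_jacobian; exact: iF.2.
have wnu c x : At c -> chart_dom c x -> dotv (w c x) (nu x) != 0.
  by move=> Ac cx; apply: nu_transverse; [exact: w0|exact: wn].
pose g c x := dotv (w c x) (nu x) *: w c x.
have g0 c x : At c -> chart_dom c x -> g c x != 0.
  by move=> Ac cx; rewrite scaler_eq0 negb_or wnu // w0.
have gc c c' x : At c -> At c' -> chart_dom c x -> chart_dom c' x ->
    normalize (g c x) = normalize (g c' x).
  move=> Ac Ac' cx c'x.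
  have e : w c x = \det ('J (transition c c') (chart_map c x)) *: w c' x.
    by rewrite /w (jacobian_chart_change sAt iF.1 Ac Ac' cx c'x) (cross_mul kd).
  have l0 : \det ('J (transition c c') (chart_map c x)) != 0.
    by apply: contraNneq (w0 _ _ Ac cx) => l0; rewrite e l0 scale0r.
  move: l0 e; set l := \det _ => l0 e.
  rewrite /g e dotvZl scalerA -(normalizeZ (g c' x) (l := l ^+ 2)).
    by rewrite /g scalerA; congr (normalize (_ *: _)); ring.
  by rewrite exprn_even_gt0.
have gn c x : At c -> chart_dom c x ->
    Defs.normal_space At F x (normalize (g c x)).
  move=> Ac cx; apply/(normal_spaceP _ sAt iF.1 Ac cx) => v.
  by rewrite /normalize /g !dotvZl (cross_orth kd) !mulr0.
have gpos c x : At c -> chart_dom c x -> 0 < dotv (normalize (g c x)) (nu x).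
  move=> Ac cx; rewrite /normalize dotvZl; apply: mulr_gt0.
    by rewrite powR_gt0 // dotv_gt0 g0.
  by rewrite /g dotvZl -expr2 exprn_even_gt0 //= wnu.
have cg c x : At c -> chart_dom c x -> {for x, continuous (g c)}.
  move=> Ac cx; have [od oi _ cm _] := Ach _ Ac.
  have cw : {for x, continuous (w c)}.
    apply: (@continuous_comp _ _ _ (chart_map c)
      (fun v => cross ('J (F \o chart_inv c) v))); first exact: cm.
    apply: (smooth_on_continuous (U := chart_map c @` chart_dom c)).
      apply: smooth_on_cross => // i j; apply: smooth_on_jacobian => //.
      exact: iF.1.
    by exists x.
  have cd : {for x, continuous (fun y => dotv (w c y) (nu y))}.
    by apply: continuous_dotv => //; exact: cnu.
  by apply: continuousZ.
clearbody g.
have cn c x : At c -> chart_dom c x ->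
    {for x, continuous (fun y => normalize (g c y))}.
  move=> Ac cx; have cgx := cg _ _ Ac cx.
  apply: (@continuousZ _ _ _ (fun y => dotv (g c y) (g c y) `^ (- 2^-1)) (g c)) => //.
  apply: (@continuous_comp _ _ _ (fun y => dotv (g c y) (g c y))
    (fun s : R => s `^ (- 2^-1))); first exact: continuous_dotv.
  apply: (smooth_on_continuous (smooth_powR (- 2^-1))).
  by change (0 < dotv (g c x) (g c x)); rewrite dotv_gt0 g0.
have [x|cc ccP] := @choice _ _ (fun x c => At c /\ chart_dom c x).
  by have [c Ac cx] := Acov x; exists c.
exists (fun x => normalize (g (cc x) x)); split.
- move=> x; have [Ac cx] := ccP x; have [od _ _ _ _] := Ach _ Ac.
  have e : \forall y \near x, normalize (g (cc x) y) = normalize (g (cc y) y).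
    near=> y; have [Ac' cy'] := ccP y; apply: gc => //.
    by near: y; exact: open_nbhs_nbhs.
  exact: (cvg_trans (near_eq_cvg e) (cn _ _ Ac cx)).
- by move=> x; have [Ac cx] := ccP x; rewrite normalize_unit ?g0.
- by move=> x; have [Ac cx] := ccP x; exact: gn.
- by move=> x; have [Ac cx] := ccP x; exact: gpos.
Unshelve. all: by end_near. Qed.

End NormalField.

Lemma pos_of_continuous_neq0 (R : realType) (h : R -> R) (t : R) :
  continuous h -> (forall s, h s != 0) -> 0 < h 0 -> 0 < h t.
Proof.
move=> ch h0 h00; rewrite ltNge; apply/negP => ht.
have [s hs] : exists s, h s = 0.
  have mm a b : Num.min (h a) (h b) <= 0 <= Num.max (h a) (h b) -> a <= b ->
      exists s, h s = 0.
    move=> hab ab; have [s _ hs] := IVT ab (continuous_subspaceT ch) hab.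
    by exists s.
  have [t0|/ltW t0] := leP 0 t; apply: mm t0.
    by rewrite ge_min le_max ht (ltW h00) orbT.
  by rewrite ge_min le_max ht (ltW h00) orbT.
by have := h0 s; rewrite hs eqxx.
Qed.

(** Used with [k] the coefficient along the conormal, [D] the squared speed and [c] = cos 2t. The
    lower bound on [D] gives k <= 2, whence the value - 4 d. *)
Lemma bounded_coord (R : realType) (k D c d e : R) : 0 < k -> k ^+ 2 * D <= 1 ->
  1 / 2 <= D -> -1 <= c -> 0 < d -> 4 * d <= e -> - e <= k * (2 * d * c).
Proof.
move=> k0 kD D2 c1 d0 de; have k2 : k <= 2 by nra.
have : 0 <= k * d * (c + 1) by rewrite !mulr_ge0 //; lra.
have : k * d <= 2 * d by rewrite ler_pM2r.
nra.
Qed.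

(** * The tube over the whole manifold *)

Section Tube.
Context {R : realType} {m : nat} {M : topologicalType}.
Variables (At : set (chart R M m)) (f N1 N2 : M -> 'rV[R]_m.+2).
Hypothesis sAt : smooth_atlas At.
Hypothesis iF : smooth_immersion At f.
Hypothesis s1 : smooth_map At N1.
Hypothesis s2 : smooth_map At N2.
Hypothesis n11 : forall q, dotv (N1 q) (N1 q) = 1.
Hypothesis n22 : forall q, dotv (N2 q) (N2 q) = 1.
Hypothesis n12 : forall q, dotv (N1 q) (N2 q) = 0.
Hypothesis nspan : forall q y, Defs.normal_space At f q y <->
  exists a b, y = a *: N1 q + b *: N2 q.
Variables (C eps delta : R).
Let jac (N : M -> 'rV[R]_m.+2) (c : chart R M m) q :=
  'J (N \o chart_inv c) (chart_map c q).
Hypothesis b1 : forall c q, At c -> chart_dom c q -> forall v : 'rV_m,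
  dotv (v *m jac N1 c q) (v *m jac N1 c q) <=
  C * dotv (v *m jac f c q) (v *m jac f c q).
Hypothesis b2 : forall c q, At c -> chart_dom c q -> forall v : 'rV_m,
  dotv (v *m jac N2 c q) (v *m jac N2 c q) <=
  C * dotv (v *m jac f c q) (v *m jac f c q).
Hypotheses (C0 : 0 < C) (eps0 : 0 < eps) (delta0 : 0 < delta) (delta1 : delta <= 1).
Hypothesis epsC : 4 * C * eps ^+ 2 < 1.
Local Notation F := (figure_eight_tube f N1 N2 eps delta).
Local Notation At1 := (prod_atlas At (circle_atlas R)).

Let sAt1 : smooth_atlas At1.
Proof. exact: smooth_prod_atlas sAt (@smooth_circle_atlas R). Qed.

Let sF : smooth_map At1 F.
Proof. exact: smooth_tube sAt iF.1 s1 s2. Qed.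

Let span c q : At c -> chart_dom c q -> forall y : 'rV_m.+2,
  (forall v : 'rV_m, dotv y (v *m jac f c q) = 0) <->
  exists a b, y = a *: N1 q + b *: N2 q.
Proof.
move=> Ac cq y; rewrite -(nspan q y); apply: iff_sym.
exact: normal_spaceP sAt iF.1 Ac cq.
Qed.

Lemma tube_immersion : smooth_immersion At1 F.
Proof.
split=> // _ [q y] [c [_ [Ac [a _ <-] ->]]] [/= cq [t ta ty]].
rewrite -ty; apply/injective_jacobian.
rewrite (tube_jacobian eps delta sAt iF.1 s1 s2 Ac cq ta).
have ff : row_free (jac f c q) by apply/injective_jacobian; exact: iF.2.
exact: (tube_row_free t (n11 q) (n22 q) (n12 q) (span Ac cq) (b1 Ac cq)
  (b2 Ac cq) eps0 delta0 delta1 epsC ff).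
Qed.

Lemma tube_normal c q t w : At c -> chart_dom c q ->
  Defs.normal_space At1 F (q, angle t) w ->
  (forall v : 'rV_m, dotv w (v *m (jac f c q +
     eps *: tube_shear (jac N1 c q) (jac N2 c q) delta t)) = 0) /\
  dotv w (tube_velocity (N1 q) (N2 q) delta t) = 0.
Proof.
(* The chart of the circle centered at t. *)
move=> Ac cq; set a := t - pi.
have ta : a < t < a + pi *+ 2 by have := pi_gt0 R; rewrite /a; lra.
have A1 : At1 (prod_chart c (circle_chart a)).
  by exists c, (circle_chart a); split=> //; exists a.
have d1 : chart_dom (prod_chart c (circle_chart a)) (q, angle t).
  by split=> //; exists t.
move=> /(normal_spaceP _ sAt1 sF A1 d1).
rewrite (tube_jacobian eps delta sAt iF.1 s1 s2 Ac cq ta) => wJ; split.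
  by move=> v; have := wJ (row_mx v 0); rewrite mul_row_col mul0mx addr0.
have := wJ (row_mx 0 1%:M); rewrite mul_row_col mul0mx mul1mx add0r dotvZr.
by move=> /eqP; rewrite mulf_eq0 (gt_eqF eps0) => /eqP.
Qed.

Let conormal (x : M * circle R) : 'rV[R]_m.+2 :=
  circle_fun (fun t => 2 * delta * cos (2 * t)) x.2 *: N1 x.1 +
  circle_fun sin x.2 *: N2 x.1.

Let periodic2 (h : R -> R) : periodic h (pi *+ 2) ->
  periodic (fun t => h (2 * t)) (pi *+ 2).
Proof.
move=> ph t /=; rewrite mulrDr [2 * (pi *+ 2)]mulr_natl.
by rewrite [X in h (_ + X)]mulr2n addrA !ph.
Qed.

Let conormalE q t : conormal (q, angle t) = tube_conormal (N1 q) (N2 q) delta t.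
Proof.
rewrite /conormal /= !circle_funE //; first exact: sinD2pi.
by move=> s; rewrite /= (periodic2 (@cosD2pi R)).
Qed.

Let conormal_continuous : continuous conormal.
Proof.
have sc : smooth_on setT (fun t : R => 2 * delta * cos (2 * t)).
  apply: smooth_onMl; first exact: openT.
  apply: (smooth_on_comp_real openT (U' := setT) (g := cos)) => //.
    exact: smooth_cos.
  by apply: smooth_onMl; [exact: openT|exact: smooth_on_id].
have cc : continuous (circle_fun (fun t : R => 2 * delta * cos (2 * t))).
  apply: circle_fun_continuous => [t|s].
    exact: smooth_on_continuous sc _.
  by rewrite /= (periodic2 (@cosD2pi R)).
have cs : continuous (circle_fun (@sin R)).
  by apply: circle_fun_continuous; [exact: continuous_sin|exact: sinD2pi].
have cN (N : M -> 'rV[R]_m.+2) : smooth_map At N ->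
    continuous (fun x : M * circle R => N x.1).
  move=> sN x; apply: (@continuous_comp _ _ _ (@fst M (circle R)) N).
    exact: cvg_fst.
  exact: smooth_map_continuous sAt sN _.
have cf (h : circle R -> R) : continuous h ->
    continuous (fun x : M * circle R => h x.2).
  move=> ch x; apply: (@continuous_comp _ _ _ (@snd M (circle R)) h).
    exact: cvg_snd.
  exact: ch.
have cZ (h : circle R -> R) (N : M -> 'rV[R]_m.+2) : continuous h ->
    smooth_map At N -> continuous (fun x : M * circle R => h x.2 *: N x.1).
  by move=> ch sN x; apply: continuousZ; [exact: cf|exact: cN].
by move=> x; exact: (continuousD (@cZ _ _ cc s1 x) (@cZ _ _ cs s2 x)).
Qed.

Let conormal_transverse x w : w != 0 -> Defs.normal_space At1 F x w ->
  dotv w (conormal x) != 0.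
Proof.
case: x => q y w0; have [t <-] : exists t, angle t = y.
  by exists (repr y); rewrite /angle reprK.
have [_ Acov _] := sAt; have [c Ac cq] := Acov q.
move=> /(tube_normal Ac cq) [wJ wT]; rewrite conormalE.
exact: (tube_conormal_neq0 (n11 q) (n22 q) (n12 q) (span Ac cq) (b1 Ac cq)
  (b2 Ac cq) C0 eps0 delta0 delta1 epsC w0 wJ wT).
Qed.

Let convention (G : M * circle R -> 'rV[R]_m.+2) :=
  forall q, 0 < dotv (G (q, angle 0)) (N1 q).

Let conormal0 q : conormal (q, angle 0) = (2 * delta) *: N1 q.
Proof. by rewrite conormalE /tube_conormal mulr0 cos0 sin0 mulr1 scale0r addr0. Qed.

(** The normal field pairing positively with the conormal satisfies the convention, since the
    conormal at t = 0 is 2 delta N1; this field then determines the orientation. *)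
Lemma tube_gauss_map : exists O G,
  [/\ orientation At1 O, gauss_map At1 O F G & convention G].
Proof.
have dimE : m.+2 = (m + 1 + 1)%N by rewrite !addn1.
have [G [cG G1 Gn Gpos]] :=
  exists_normal_field dimE sAt1 tube_immersion conormal_continuous conormal_transverse.
have d0 : (0 < m + 1)%N by rewrite addn1.
have [Or [OG gG]] := orientation_of_normal dimE sAt1 tube_immersion cG G1 Gn d0.
exists Or, G; split=> // q; have := Gpos (q, angle 0).
by rewrite conormal0 dotvZr pmulr_rgt0 // mulr_gt0.
Qed.

Variables (A : set 'rV[R]_m.+2) (eta : R).
Hypothesis eta0 : 0 < eta.
Hypothesis inA : forall q w, dotv w w = 1 -> - eta <= dotv w (N1 q) ->
  dotv (w - (dotv w (N1 q) *: N1 q + dotv w (N2 q) *: N2 q))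
       (w - (dotv w (N1 q) *: N1 q + dotv w (N2 q) *: N2 q)) <= eta -> A w.
Hypothesis epsE : 4 * C * eps ^+ 2 <= eta.
Hypothesis deltaE : 4 * delta <= eta.

Lemma tube_directed Or G : gauss_map At1 Or F G -> convention G ->
  range G `<=` A.
Proof.
move=> [cG G1 Gn _] conv _ [[q y] _ <-].
have [t <-] : exists t, angle t = y by exists (repr y); rewrite /angle reprK.
have Gnz x : G x != 0 by rewrite -dotv_gt0 G1.
(* Lifting the circle to the real line lets the intermediate value theorem carry the sign from 0 to
   t. *)
have pos : 0 < dotv (G (q, angle t)) (conormal (q, angle t)).
  apply: (@pos_of_continuous_neq0 _
    (fun t => dotv (G (q, angle t)) (conormal (q, angle t)))).
  - have ca : continuous (fun t : R => (q, angle t)).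
      move=> s; apply: continuous_pair; first exact: cst_continuous.
      exact: angle_continuous.
    have c1 : continuous (fun t : R => G (q, angle t)).
      by move=> s; apply: (@continuous_comp _ _ _ (fun t : R => (q, angle t)) G);
        [exact: ca|exact: cG].
    have c2 : continuous (fun t : R => conormal (q, angle t)).
      by move=> s; apply: (@continuous_comp _ _ _ (fun t : R => (q, angle t)) conormal);
        [exact: ca|exact: conormal_continuous].
    move=> s; exact: (continuous_dotv (@c1 s) (@c2 s)).
  - by move=> s; exact: conormal_transverse.
  - by rewrite conormal0 dotvZr mulr_gt0 // mulr_gt0.
have [_ Acov _] := sAt; have [c Ac cq] := Acov q.
have [wJ wT] := tube_normal Ac cq (@Gn (q, angle t)).
have close := tube_normal_close (n11 q) (n22 q) (n12 q) (span Ac cq) (b1 Ac cq)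
  (b2 Ac cq) C0 eps0 delta0 delta1 wJ.
have [a1 a2] := tube_normal_coords delta0 wT.
move: pos; rewrite conormalE => pos.
apply: (@inA q); rewrite ?G1 //; last first.
  by apply: le_trans close _; rewrite G1 mulr1.
have D0 := tube_speed_gt0 t delta0.
set w := G (q, angle t) in a1 a2 pos *.
set k := dotv w _ / _ in a1 a2.
have k0 : 0 < k by exact: divr_gt0.
(* Bessel's inequality for the unit vector [w] and the orthonormal pair [N1 q], [N2 q]. *)
have kD : k ^+ 2 * tube_speed delta t <= 1.
  have -> : k ^+ 2 * tube_speed delta t = dotv w (N1 q) ^+ 2 + dotv w (N2 q) ^+ 2.
    by rewrite a1 a2 /tube_speed; ring.
  have := dotv_ge0 (w - (dotv w (N1 q) *: N1 q + dotv w (N2 q) *: N2 q)).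
  rewrite !dotv_lin n11 n22 n12 (dotvC (N2 q) (N1 q)) n12 (dotvC _ w).
  rewrite (dotvC (N2 q) w) G1; lra.
have [c0|c0] := leP 0 (cos (2 * t)).
  have : 0 <= dotv w (N1 q).
    rewrite a1; apply: mulr_ge0; first exact: ltW.
    by apply: mulr_ge0 => //; apply: mulr_ge0 => //; exact: ltW.
  by apply: le_trans; rewrite oppr_le0 ltW.
have c1 : -1 <= cos (2 * t) by exact: cos_geN1.
(* Here cos 2t < 0, that is, sin^2 t > 1/2. *)
have s12 : 1 / 2 <= tube_speed delta t.
  have := c0; rewrite mulr_natl cos_mulr2n cos2sin2 /tube_speed => ?.
  have := sqr_ge0 (2 * delta * cos (2 * t)); lra.
rewrite a1; exact: bounded_coord k0 kD s12 c1 delta0 deltaE.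
Qed.

End Tube.

Theorem theorem1p3 (R : realType) (n : nat) (n_ge2 : (2 <= n)%N)
    (A : set 'rV[R]_n.+1) (A_open : open_in_sphere A)
    (A_semicircle : forall C : set 'rV[R]_n.+1,
      great_circle C -> C (north_pole n) ->
      exists2 x, C x & semicircle C x `<=` A)
    (A_alternative : (3 <= n)%N ->
      (forall C : set 'rV[R]_n.+1, great_circle C -> C (north_pole n) ->
        exists x, [/\ C x, semicircle C x `<=` A &
                      semicircle C x (north_pole n)])
      \/
      (forall C : set 'rV[R]_n.+1, great_circle C -> C (north_pole n) ->
        ~ (C `<=` A)))
    (M : topologicalType) (At : set (chart R M n.-1))
    (M_closed : closed_manifold At) (M_orientable : orientable At)
    (f : M -> 'rV[R]_n.+1) (f_immersion : smooth_immersion At f)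
    (f_horizontal : forall q, f q 0 ord_max = 0) :
  (exists N1 N2 : M -> 'rV[R]_n.+1, adapted_frame A At f N1 N2)
  /\
  (forall N1 N2 : M -> 'rV[R]_n.+1, adapted_frame A At f N1 N2 ->
    exists eps0 delta0 : R, [/\ 0 < eps0, 0 < delta0 &
      forall eps delta : R, 0 < eps < eps0 -> 0 < delta < delta0 ->
        let F := figure_eight_tube f N1 N2 eps delta in
        let At1 := prod_atlas At (circle_atlas R) in
        let convention (G : M * circle R -> 'rV[R]_n.+1) :=
          forall q, 0 < dotv (G (q, angle 0)) (N1 q) in
        [/\ smooth_immersion At1 F,
            exists O G, [/\ orientation At1 O, gauss_map At1 O F G &
                            convention G] &
            forall O G, orientation At1 O -> gauss_map At1 O F G ->
              convention G -> range G `<=` A]]).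
Proof.
(* Writing n as m + 1 makes the dimension [n.-1] of [M] reduce to m. *)
case: n n_ge2 A A_open A_semicircle A_alternative At M_closed M_orientable f
  f_immersion f_horizontal => [//|m] n_ge2 A A_open A_semicircle A_alternative
  At [sAt _ cM] M_orientable f iF f0.
split.
  have [U [a [b [oU AU sa sb ab]]]] :=
    exists_center_field n_ge2 A_open A_semicircle A_alternative.
  have [nu [snu nueq nuN]] := exists_unit_normal sAt iF f0 M_orientable.
  exact: exists_adapted_frame sAt AU sa sb ab snu nueq nuN.
move=> N1 N2 [[s1 s2] orth nspace Asemi].
have nspan q y : Defs.normal_space At f q y <->
    exists a b, y = a *: N1 q + b *: N2 q by rewrite nspace.
have n11 q : dotv (N1 q) (N1 q) = 1 by have [] := orth q.
have n22 q : dotv (N2 q) (N2 q) = 1 by have [] := orth q.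
have n12 q : dotv (N1 q) (N2 q) = 0 by have [] := orth q.
have [U oU AU] := A_open.
have [C1 C10 bound1] := derivative_bound sAt iF s1 cM.
have [C2 C20 bound2] := derivative_bound sAt iF s2 cM.
have [eta eta0 inA] : exists2 eta : R, 0 < eta & forall q w, dotv w w = 1 ->
    - eta <= dotv w (N1 q) ->
    dotv (w - (dotv w (N1 q) *: N1 q + dotv w (N2 q) *: N2 q))
         (w - (dotv w (N1 q) *: N1 q + dotv w (N2 q) *: N2 q)) <= eta -> A w.
  apply: (near_semicircle cM oU AU (smooth_map_continuous sAt s1)
    (smooth_map_continuous sAt s2)) => q w w1 wN wE.
  apply: (Asemi q); split; last by rewrite dotvC.
  by split=> //; apply/nspan; exists (dotv w (N1 q)), (dotv w (N2 q)).
(* [C] dominates both derivative bounds. The quantity 4 C eps^2 must be below 1 for the immersion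
   and at most eta for the normals to stay in [A]. *)
pose C := C1 + C2; pose eta1 := Num.min 1 eta.
have C0 : 0 < C by exact: addr_gt0.
have eta10 : 0 < eta1 by rewrite lt_min ltr01.
(* With eps < 1, 4 C eps^2 is at most 4 C eps < eta1. The bounds on delta give [delta <= 1] for the
   shear and [4 * delta <= eta] for the coordinate along [N1]. *)
exists (Num.min 1 (eta1 / (4 * C))), (Num.min 1 (eta / 4)); split.
- by rewrite lt_min ltr01 divr_gt0 // mulr_gt0.
- by rewrite lt_min ltr01 divr_gt0.
move=> eps delta /andP[eps0]; rewrite lt_min => /andP[eps1 epsC].
move=> /andP[delta0]; rewrite lt_min => /andP[delta1 deltaE] F At1 convention.
have epsE : 4 * C * eps ^+ 2 < eta1.
  rewrite ltr_pdivlMr ?mulr_gt0 // in epsC; apply: le_lt_trans epsC.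
  rewrite mulrC ler_wpM2r ?mulr_ge0 ?ltW //.
  by rewrite expr2 gtr_pMr // ltW.
have [epsE1 epsEeta] : 4 * C * eps ^+ 2 < 1 /\ 4 * C * eps ^+ 2 <= eta.
  by move: epsE; rewrite lt_min => /andP[? /ltW].
have CP (C' x y : R) : C' <= C -> 0 <= x -> y <= C' * x -> y <= C * x.
  by move=> CC x0 /le_trans; apply; rewrite ler_wpM2r.
have b1 c q (Ac : At c) (cq : chart_dom c q) v :=
  CP _ _ _ (ler_wpDr (ltW C20) (lexx C1)) (dotv_ge0 _) (bound1 c q v Ac cq).
have b2 c q (Ac : At c) (cq : chart_dom c q) v :=
  CP _ _ _ (ler_wpDl (ltW C10) (lexx C2)) (dotv_ge0 _) (bound2 c q v Ac cq).
have d1 := ltW delta1.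
have d4 : 4 * delta <= eta by rewrite mulrC -ler_pdivlMr // ltW.
split.
- exact (tube_immersion sAt iF s1 s2 n11 n22 n12 nspan b1 b2 eps0 delta0 d1
    epsE1).
- exact (tube_gauss_map sAt iF s1 s2 n11 n22 n12 nspan b1 b2 C0 eps0 delta0 d1
    epsE1).
- move=> Or G _ gG conv.
  exact (tube_directed sAt iF s1 s2 n11 n22 n12 nspan b1 b2 C0 eps0 delta0 d1
    epsE1 eta0 inA epsEeta d4 gG conv).
Qed.
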